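(* Let $(\mathfrak h,W)$ be an irreducible finite complex reflection group and $K\lhd W$ a normal subgroup which acts on $\mathfrak h$ (by restriction) as a complex reflection group. Let $\mathbf c:\mathrm{Ref}(K)\to\mathbb C$ be invariant under $W$-conjugation, extended by zero to $\mathrm{Ref}(W)$, and let $\Gamma=W/K$. Let $\Omega_{\mathbf c}(W)$ and $\Omega_{\mathbf c}(K)$ denote the sets of Calogero–Moser $\mathbf c$-families of $W$ and $K$. (a) The group $\Gamma$ acts on $\Omega_{\mathbf c}(K)$ by ${}^\sigma\mathcal F=\{{}^\sigma\lambda\mid\lambda\in\mathcal F\}$ for $\sigma\in\Gamma$ and $\mathcal F\in\Omega_{\mathbf c}(K)$. (b) There is a natural bijection between $\Omega_{\mathbf c}(W)$ and $\Omega_{\mathbf c}(K)/\Gamma$: to $\mathcal F\in\Omega_{\mathbf c}(W)$ corresponds the $\Gamma$-orbit of families of $K$ whose union is $$\{\lambda\in\mathrm{Irr}(K)\mid\lambda\subset\mathrm{Res}^W_K\mu\text{ for some }\mu\in\mathcal F\}.$$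
   Context: A finite complex reflection group is a pair $(\mathfrak h,W)$ with $\mathfrak h$ a finite-dimensional complex vector space and $W\subset GL(\mathfrak h)$ a non-trivial finite subgroup generated by its set $\mathrm{Ref}(W)$ of reflections (elements $s$ with $\mathrm{Ker}(1-s)$ of codimension one). For $s\in\mathrm{Ref}(W)$ let $\alpha_s\in\mathfrak h^*$ span $\mathrm{Im}(s-1)|_{\mathfrak h^*}$ and $\alpha_s^\vee\in\mathfrak h$ span $\mathrm{Im}(s-1)|_{\mathfrak h}$, with $\alpha_s(\alpha_s^\vee)=2$. $\mathsf H_{\mathbf c}(W)$ is the quotient of $T(\mathfrak h\oplus\mathfrak h^* )\rtimes W$ by $[x,x']=[y,y']=0$ and $[y,x]=-\sum_{s\in\mathrm{Ref}(W)}\mathbf c(s)(y,\alpha_s)(\alpha_s^\vee,x)s$ for $x,x'\in\mathfrak h^*$, $y,y'\in\mathfrak h$, where $(y,x)=x(y)$. The subalgebra $D(W)=\mathbb C[\mathfrak h]^W\otimes\mathbb C[\mathfrak h^*]^W$ is central; $\overline{\mathsf H}_{\mathbf c}(W)=\mathsf H_{\mathbf c}(W)/D(W)_+\mathsf H_{\mathbf c}(W)$, where $D(W)_+$ consists of elements with zero constant term. For $\lambda\in\mathrm{Irr}\,W$, $L_{\mathbf c}(\lambda)$ is the simple head of the baby Verma module $\overline{\mathsf H}_{\mathbf c}(W)\otimes_{\mathbb C[\mathfrak h^*]^{\mathrm{co}W}\rtimes W}\lambda$, where $\mathbb C[\mathfrak h^*]^{\mathrm{co}W}=\mathbb C[\mathfrak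 h^*]/\langle\mathbb C[\mathfrak h^*]^W_+\rangle$ acts on $\lambda$ through its augmentation; $\lambda\mapsto L_{\mathbf c}(\lambda)$ is a bijection $\mathrm{Irr}\,W\to\mathrm{Irr}\,\overline{\mathsf H}_{\mathbf c}(W)$. The Calogero–Moser $\mathbf c$-families of $W$ are the classes of $\mathrm{Irr}\,W$ under: $\lambda\sim\mu$ iff $L_{\mathbf c}(\lambda)$ and $L_{\mathbf c}(\mu)$ lie in the same block of $\overline{\mathsf H}_{\mathbf c}(W)$. All these notions are defined likewise for $(\mathfrak h,K)$. $W$ acts on $\mathrm{Irr}(K)$ by conjugation and this action factors through $\Gamma=W/K$; it is written $\lambda\mapsto{}^\sigma\lambda$. *)

(* Defs.v *)
From HB Require Import structures.
From mathcomp Require Import all_boot all_order all_algebra all_fingroup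
  all_solvable all_field all_character.
From mathcomp Require Import ring_quotient.
From mathcomp Require Import boolp reals complex.
From mathcomp Require Import monalg.
From mathcomp Require Import mpoly.

Set Implicit Arguments.
Unset Strict Implicit.
Unset Printing Implicit Defensive.

Import GroupScope GRing.Theory.
Local Open Scope ring_scope.
Local Open Scope quotient_scope.

Local Notation qrepr := generic_quotient.repr.

(* monalg.v also declares the notation {mpoly _[_]}, so the type of            *)
(* multivariate polynomials of mpoly.v is written [mpoly n C] throughout.      *)

Section RingQuotient.
Variables (A : pzRingType) (S : A -> Prop).

Definition two_sided_ideal (I : A -> Prop) : Prop :=
  [/\ I 0, forall a b, I a -> I b -> I (a - b)
    & forall a x b, I x -> I (a * x * b)].

Definition ideal_gen : {pred A} :=
  [pred a | `[< forall I, two_sided_ideal I ->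
                  (forall s, S s -> I s) -> I a >]].

Lemma ideal_genP a : reflect
  (forall I, two_sided_ideal I -> (forall s, S s -> I s) -> I a)
  (a \in ideal_gen).
Proof. exact: asboolP. Qed.

Lemma ideal_gen_zmod_closed : zmod_closed ideal_gen.
Proof.
split; first by apply/ideal_genP => I [].
move=> a b /ideal_genP Ia /ideal_genP Ib; apply/ideal_genP => I idI SI.
by have [_ IB _] := idI; apply: IB; [exact: Ia | exact: Ib].
Qed.

HB.instance Definition _ :=
  GRing.isZmodClosed.Build A ideal_gen ideal_gen_zmod_closed.

Lemma ideal_genM a x b : x \in ideal_gen -> a * x * b \in ideal_gen.
Proof.
move=> /ideal_genP Ix; apply/ideal_genP => I idI SI.
by have [_ _ IM] := idI; apply: IM; apply: Ix.
Qed.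

Definition ring_quot : Type := Quotient.quot (ideal_gen : zmodClosed A).
HB.instance Definition _ := GRing.Zmodule.on ring_quot.
HB.instance Definition _ := EqQuotient.on ring_quot.

Definition ring_proj : A -> ring_quot := \pi_ring_quot.

Lemma ring_projP a b : reflect (ring_proj a = ring_proj b) (a - b \in ideal_gen).
Proof. by rewrite Quotient.idealrBE; apply: eqP. Qed.

Lemma ring_projK q : ring_proj (qrepr q) = q.
Proof. exact: reprK. Qed.

Lemma ring_projD a b : ring_proj (a + b) = ring_proj a + ring_proj b.
Proof. exact: Quotient.pi_add. Qed.

Definition ring_quot_mul (p q : ring_quot) : ring_quot :=
  ring_proj (qrepr p * qrepr q).

Lemma ring_proj_mul a b :
  ring_quot_mul (ring_proj a) (ring_proj b) = ring_proj (a * b).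
Proof.
apply/ring_projP; set a' := qrepr _; set b' := qrepr _.
have aa' : a' - a \in ideal_gen by apply/ring_projP; rewrite ring_projK.
have bb' : b' - b \in ideal_gen by apply/ring_projP; rewrite ring_projK.
have -> : a' * b' - a * b = 1 * (a' - a) * b' + a * (b' - b) * 1.
  by rewrite mul1r mulr1 mulrBl mulrBr addrA subrK.
by rewrite rpredD // ideal_genM.
Qed.

Fact ring_quot_mulA : associative ring_quot_mul.
Proof.
move=> p q r; rewrite -[p]ring_projK -[q]ring_projK -[r]ring_projK.
by rewrite !ring_proj_mul mulrA.
Qed.

Fact ring_quot_mul1 : left_id (ring_proj 1) ring_quot_mul.
Proof. by move=> p; rewrite -[p]ring_projK ring_proj_mul mul1r. Qed.

Fact ring_quot_mulr1 : right_id (ring_proj 1) ring_quot_mul.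
Proof. by move=> p; rewrite -[p]ring_projK ring_proj_mul mulr1. Qed.

Fact ring_quot_mulDl : left_distributive ring_quot_mul +%R.
Proof.
move=> p q r; rewrite -[p]ring_projK -[q]ring_projK -[r]ring_projK.
by rewrite -ring_projD !ring_proj_mul mulrDl ring_projD.
Qed.

Fact ring_quot_mulDr : right_distributive ring_quot_mul +%R.
Proof.
move=> p q r; rewrite -[p]ring_projK -[q]ring_projK -[r]ring_projK.
by rewrite -ring_projD !ring_proj_mul mulrDr ring_projD.
Qed.

HB.instance Definition _ := GRing.Zmodule_isPzRing.Build ring_quot
  ring_quot_mulA ring_quot_mul1 ring_quot_mulr1 ring_quot_mulDl ring_quot_mulDr.

Lemma ring_projM a b : ring_proj (a * b) = ring_proj a * ring_proj b.
Proof. by rewrite -[LHS]ring_proj_mul. Qed.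

End RingQuotient.

Section ModuleQuotient.
Variables (A : pzRingType) (M : lmodType A) (S : M -> Prop).

Definition submodule (N : M -> Prop) : Prop :=
  [/\ N 0, forall u v, N u -> N v -> N (u - v) & forall a v, N v -> N (a *: v)].

Definition submod_gen : {pred M} :=
  [pred v | `[< forall N, submodule N -> (forall s, S s -> N s) -> N v >]].

Lemma submod_genP v : reflect
  (forall N, submodule N -> (forall s, S s -> N s) -> N v) (v \in submod_gen).
Proof. exact: asboolP. Qed.

Lemma submod_gen_zmod_closed : zmod_closed submod_gen.
Proof.
split; first by apply/submod_genP => N [].
move=> u v /submod_genP Nu /submod_genP Nv; apply/submod_genP => N modN SN.
by have [_ NB _] := modN; apply: NB; [exact: Nu | exact: Nv].
Qed.

HB.instance Definition _ :=
  GRing.isZmodClosed.Build M submod_gen submod_gen_zmod_closed.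

Lemma submod_genZ a v : v \in submod_gen -> a *: v \in submod_gen.
Proof.
move=> /submod_genP Nv; apply/submod_genP => N modN SN.
by have [_ _ NZ] := modN; apply: NZ; apply: Nv.
Qed.

Definition mod_quot : Type := Quotient.quot (submod_gen : zmodClosed M).
HB.instance Definition _ := GRing.Zmodule.on mod_quot.
HB.instance Definition _ := EqQuotient.on mod_quot.

Definition mod_proj : M -> mod_quot := \pi_mod_quot.

Lemma mod_projP u v : reflect (mod_proj u = mod_proj v) (u - v \in submod_gen).
Proof. by rewrite Quotient.idealrBE; apply: eqP. Qed.

Lemma mod_projK q : mod_proj (qrepr q) = q.
Proof. exact: reprK. Qed.

Lemma mod_projD u v : mod_proj (u + v) = mod_proj u + mod_proj v.
Proof. exact: Quotient.pi_add. Qed.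

Definition mod_quot_scale (a : A) (q : mod_quot) : mod_quot :=
  mod_proj (a *: qrepr q).

Lemma mod_proj_scale a v : mod_quot_scale a (mod_proj v) = mod_proj (a *: v).
Proof.
apply/mod_projP; rewrite -scalerBr; apply: submod_genZ.
by apply/mod_projP; rewrite mod_projK.
Qed.

Fact mod_quot_scaleA a b q :
  mod_quot_scale a (mod_quot_scale b q) = mod_quot_scale (a * b) q.
Proof. by rewrite -[q]mod_projK !mod_proj_scale scalerA. Qed.

Fact mod_quot_scale1 : left_id 1 mod_quot_scale.
Proof. by move=> q; rewrite -[q]mod_projK mod_proj_scale scale1r. Qed.

Fact mod_quot_scaleDr : right_distributive mod_quot_scale +%R.
Proof.
move=> a p q; rewrite -[p]mod_projK -[q]mod_projK.
by rewrite -mod_projD !mod_proj_scale scalerDr mod_projD.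
Qed.

Fact mod_quot_scaleDl q : {morph mod_quot_scale^~ q : a b / a + b}.
Proof.
by move=> a b; rewrite -[q]mod_projK !mod_proj_scale scalerDl mod_projD.
Qed.

HB.instance Definition _ := GRing.Zmodule_isLmodule.Build A mod_quot
  mod_quot_scaleA mod_quot_scale1 mod_quot_scaleDr mod_quot_scaleDl.

Lemma mod_projZ a v : mod_proj (a *: v) = a *: mod_proj v.
Proof. by rewrite -[LHS]mod_proj_scale. Qed.

End ModuleQuotient.

Section HeadsBlocks.
Variable A : pzRingType.

Definition maximal_submodule (M : lmodType A) (N : M -> Prop) : Prop :=
  [/\ submodule N, exists v, ~ N v
    & forall N', submodule N' -> (forall v, N v -> N' v) ->
        (forall v, N' v -> N v) \/ (forall v, N' v)].

Definition radical (M : lmodType A) (v : M) : Prop :=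
  forall N, maximal_submodule N -> N v.

Definition head (M : lmodType A) : lmodType A := mod_quot (@radical M).

Definition central_idempotent (e : A) : Prop :=
  e * e = e /\ forall a, e * a = a * e.

(* The blocks of A are the ideals bA for b a primitive central idempotent.     *)
Definition block_idempotent (b : A) : Prop :=
  [/\ central_idempotent b, b <> 0
    & forall e f, central_idempotent e -> central_idempotent f ->
        e * f = 0 -> b = e + f -> e = 0 \/ f = 0].

Definition in_block (b : A) (L : lmodType A) : Prop := forall v : L, b *: v = v.

Definition same_block (L L' : lmodType A) : Prop :=
  exists b, [/\ block_idempotent b, in_block b L & in_block b L'].

End HeadsBlocks.

(* An mx_representation rG of degree n makes the row space 'rV_n a right      *)
(* module, so the left G-module h is 'rV_n with g acting by y |-> y g^-1; its  *)
(* dual h* is 'cV_n with g acting by x |-> g x, and (y, x) = x(y) is y *m x.   *)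

Section ReflectionGroup.
Variables (C : fieldType) (gT : finGroupType) (G : {group gT}) (n : nat).
Variable rG : mx_representation C G n.

Definition act_h (g : gT) (y : 'rV[C]_n) : 'rV[C]_n := y *m rG g^-1%g.
Definition act_dual (g : gT) (x : 'cV[C]_n) : 'cV[C]_n := rG g *m x.
Definition pairing (y : 'rV[C]_n) (x : 'cV[C]_n) : C := (y *m x) 0 0.

Definition reflections : {set gT} :=
  [set s in G | (\rank (kermx (1%:M - rG s^-1%g))).+1 == n].

(* G is identified with its image in GL(h).                                    *)
Definition complex_reflection_group : Prop :=
  [/\ mx_faithful rG, G :!=: 1%g & generated reflections = G].

(* The image of s - 1 on h is a row space, its image on h* a column space.     *)
Definition root_pair (s : gT) (alpha : 'cV[C]_n) (alphav : 'rV[C]_n) : Prop :=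
  [/\ (alpha^T == (rG s - 1%:M)^T)%MS,
      (alphav == rG s^-1%g - 1%:M)%MS
    & pairing alphav alpha = 2%:R].

(* C[h] is mpoly n C with 'X_i the i-th coordinate function on 'rV_n, and      *)
(* C[h* ] is mpoly n C with 'X_i the i-th coordinate function on 'cV_n.        *)
Definition invariant_h (f : mpoly n C) : Prop :=
  forall g y, g \in G ->
    meval (fun i => act_h g y 0 i) f = meval (fun i => y 0 i) f.

Definition invariant_dual (f : mpoly n C) : Prop :=
  forall g x, g \in G ->
    meval (fun i => act_dual g x i 0) f = meval (fun i => x i 0) f.

Definition constant_term (f : mpoly n C) : C := meval (fun=> 0) f.

Definition ch_gen : choiceType := ('rV[C]_n + 'cV[C]_n + subg_of G)%type.
Definition ch_free : lalgType C := {malg C[{fmonom ch_gen}]}.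

Definition gen (z : ch_gen) : ch_free := mkmalgU (fmu z) 1.
Definition gY (y : 'rV[C]_n) : ch_free := gen (inl (inl y)).
Definition gX (x : 'cV[C]_n) : ch_free := gen (inl (inr x)).
Definition gW (w : subg_of G) : ch_free := gen (inr w).

(* The quotient of ch_free by these elements is T(h + h* ) ><| G.              *)
Inductive smash_rel : ch_free -> Prop :=
| smash_linY a y y' : smash_rel (gY (a *: y + y') - (a *: gY y + gY y'))
| smash_linX a x x' : smash_rel (gX (a *: x + x') - (a *: gX x + gX x'))
| smash_one : smash_rel (gW 1%g - 1)
| smash_mul w w' : smash_rel (gW (w * w')%g - gW w * gW w')
| smash_actY w y : smash_rel (gW w * gY y - gY (act_h (sgval w) y) * gW w)
| smash_actX w x : smash_rel (gW w * gX x - gX (act_dual (sgval w) x) * gW w).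

(* (y, alpha_s)(alphav_s, x) does not depend on the choice of the root pairs.  *)
Inductive cherednik_rel (c : gT -> C) : ch_free -> Prop :=
| ch_XX x x' : cherednik_rel c (gX x * gX x' - gX x' * gX x)
| ch_YY y y' : cherednik_rel c (gY y * gY y' - gY y' * gY y)
| ch_YX y x (alpha : gT -> 'cV[C]_n) (alphav : gT -> 'rV[C]_n) :
    (forall s, s \in reflections -> root_pair s (alpha s) (alphav s)) ->
    cherednik_rel c
      ((gY y * gX x - gX x * gY y)
       - (- \sum_(s : subg_of G | sgval s \in reflections)
              (c (sgval s) * pairing y (alpha (sgval s))
                 * pairing (alphav (sgval s)) x) *: gW s)).

Variable c : gT -> C.

Definition cherednik : pzRingType :=
  ring_quot (fun a : ch_free => smash_rel a \/ cherednik_rel c a).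

Definition to_cherednik : ch_free -> cherednik := @ring_proj _ _.

(* Evaluations of elements of C[h] and of C[h* ] = Sym(h).                     *)
Definition eval_X (f : mpoly n C) : ch_free :=
  mmap (fun a => a%:A) (fun i => gX (delta_mx i 0)) f.
Definition eval_Y (f : mpoly n C) : ch_free :=
  mmap (fun a => a%:A) (fun i => gY (delta_mx 0 i)) f.

(* The elements of D(G) = C[h]^G (x) C[h* ]^G with zero constant term.         *)
Definition D_plus (d : cherednik) : Prop :=
  exists s : seq (mpoly n C * mpoly n C),
    [/\ forall p, p \in s -> invariant_h p.1 /\ invariant_dual p.2,
        \sum_(p <- s) constant_term p.1 * constant_term p.2 = 0
      & d = \sum_(p <- s) to_cherednik (eval_X p.1 * eval_Y p.2)].

(* As D(G) is central, D(G)_+ H is the two-sided ideal generated by D(G)_+.    *)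
Definition restricted_cherednik : pzRingType := ring_quot D_plus.

Definition to_restricted (a : ch_free) : restricted_cherednik :=
  @ring_proj _ D_plus (to_cherednik a).

Section BabyVerma.
Variables (d : nat) (rE : mx_representation C G d).
Local Notation Hbar := restricted_cherednik.

(* As E = C^d, the free left module 'rV[Hbar]_d is Hbar (x)_C E.               *)
Definition tens (h : Hbar) (v : 'rV[C]_d) : 'rV[Hbar]_d :=
  \row_i (h * to_restricted (v 0 i)%:A).

(* C[h* ]^co ><| G is spanned by the f(Y) g, which acts on E as f(0) g.        *)
Definition verma_rel (m : 'rV[Hbar]_d) : Prop :=
  exists h (f : mpoly n C) (g : subg_of G) (v : 'rV[C]_d),
    m = tens (h * to_restricted (eval_Y f * gW g)) v
        - tens h (constant_term f *: (v *m rE (sgval g)^-1%g)).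

Definition baby_verma : lmodType Hbar := mod_quot verma_rel.

End BabyVerma.

Variable sG : irrType C G.

Definition simple_head (l : sG) : lmodType restricted_cherednik :=
  head (baby_verma (irr_repr l)).

Definition cm_equiv (l m : sG) : Prop :=
  same_block (simple_head l) (simple_head m).

Definition cm_families : {set {set sG}} :=
  [set [set m | `[< cm_equiv l m >]] | l : sG].

End ReflectionGroup.

Section Conjugation.
Variables (C : fieldType) (gT : finGroupType) (K : {group gT}).

Section ConjRepr.
Variables (d : nat) (rK : mx_representation C K d) (w : gT).
Hypothesis nKw : w \in 'N(K).

Definition conj_mx (k : gT) : 'M[C]_d := rK (k ^ w)%g.

Lemma conj_mx_repr : mx_repr K conj_mx.
Proof.
split=> [|x y Kx Ky]; first by rewrite /conj_mx conj1g repr_mx1.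
by rewrite /conj_mx conjMg repr_mxM ?memJ_norm.
Qed.
Canonical conj_repr := MxRepresentation conj_mx_repr.

End ConjRepr.

Variable sK : irrType C K.

Definition irr_conj (sigma : coset_of K) (l : sK) : sK :=
  irr_comp sK (conj_repr (irr_repr l) (repr_coset_norm sigma)).

(* The choice of a representative of the coset sigma does not matter.          *)
Lemma irr_conj_coset w (nKw : w \in 'N(K)) (l : sK) :
  [pchar C]^'.-group K ->
  irr_conj (coset K w) l = irr_comp sK (conj_repr (irr_repr l) nKw).
Proof.
move=> C'K; apply: irr_comp_rsim_pchar => //.
have: repr (coset K w) \in (w *: K)%g.
  by rewrite -norm_rlcoset // -val_coset // mem_repr_coset.
case/lcosetP=> k Kk def_w.
exists (irr_repr l k^-1%g) => // [|x Kx].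
  by rewrite row_free_unit repr_mx_unit ?groupV.
rewrite /conj_repr /= /conj_mx def_w conjgM.
have Kxw : (x ^ w)%g \in K by rewrite memJ_norm.
rewrite -repr_mxM ?groupV ?(groupJ Kxw) // -repr_mxM ?groupV //.
by rewrite conjgE -!mulgA mulgV mulg1.
Qed.

Definition family_conj (sigma : coset_of K) (F : {set sK}) : {set sK} :=
  [set irr_conj sigma l | l in F].

Definition is_constituent (l : sK) m (rE : mx_representation C K m) : Prop :=
  exists (U : 'M[C]_m) (modU : mxmodule rE U),
    mx_rsim (irr_repr l) (submod_repr modU).

Variables (W : {group gT}) (sW : irrType C W) (sKW : K \subset W).

Definition res_constituents (F : {set sW}) : {set sK} :=
  [set l : sK | [exists m in F,
     `[< is_constituent l (subg_repr (irr_repr m) sKW) >]]].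

Definition family_orbit (F : {set sK}) : {set {set sK}} :=
  [set family_conj sigma F | sigma in (W / K)%g].

End Conjugation.

Definition extend_by_zero (C : fieldType) (gT : finGroupType) (D : {set gT})
    (c : gT -> C) (s : gT) : C :=
  if s \in D then c s else 0.

(* Main.v *)
(** Write Hbar(W) for the restricted algebra with parameter extended by zero, and
    Hbar(K) for that of K.  The quotient of Hbar(G) by h* Hbar + Hbar h is the group
    algebra CG; let eps_g(z) be the coefficient of g in the class of z, and put
    M_l(z) = sum_g eps_g(z) l(g^-1) for l in Irr G.  A central idempotent e acts on
    L(l) as M_l(e), which is 0 or 1, and a central z with all M_l(z) = 0 is nilpotent
    because a high power of it has large order in h* and h.  So the unions of families
    are exactly the sets S with M_l(e) = [l in S] for a central idempotent e, and
    the families are the atoms of this Boolean algebra.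

    From W to K: write a central idempotent e of Hbar(W) as a sum of P_g g modulo
    Hbar h, with P_g in C[h].  A K-invariant f commutes with h because c is supported
    on K, so P_g (g f - f) lies in the ideal of W-invariants; if eps_g(e) = P_g(0) is
    not 0 then g f - f does too, and a graded Nakayama argument shows that g fixes
    C[h]^K, that is, g lies in K.  Moreover e acts on the module coinduced from Hbar(K)
    through a central z of Hbar(K) with the same coefficients, and z is idempotent
    modulo nilpotents.

    From K to W: the subalgebra of Hbar(W) generated by h, h* and K maps onto Hbar(K),
    up to the ideal spanned by the positive degree K-invariants of h and of h*; these
    are central in the subalgebra, so the ideal is nilpotent.  Central idempotents of
    Hbar(K) lift uniquely, and the lift of a W-stable one commutes with W.

    Clifford theory for K in W turns these two passages into the bijection between
    atoms for W and Gamma-orbits of atoms for K. *)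

From HB Require Import structures.
Require Import Defs.
From mathcomp Require Import all_boot all_order all_algebra all_fingroup
  all_solvable all_field all_character.
From mathcomp Require Import ring zify.
From mathcomp Require Import finmap boolp reals complex.
From mathcomp Require Import monalg.
From mathcomp Require Import mpoly.

Set Implicit Arguments.
Unset Strict Implicit.
Unset Printing Implicit Defensive.

Import GroupScope GRing.Theory.
Local Open Scope ring_scope.

(** The restricted algebras are given by generators and relations, without a basis, so the
    coefficients eps_g must be shown to be well defined. This takes a concrete module: C[h]-valued
    functions on the group, where h acts by Dunkl operators stripped of their derivative. These
    operators preserve the functions with values in the Hilbert ideal, and reading them on a delta
    function gives the fragment of the PBW theorem that the proof uses ([ro_indep]). Arguments are
    made for any ring with maps [W], [EX], [EY] subject to the Cherednik relations. They then apply
    alike to the restricted algebras, the model, coinduced modules, twists by elements of W, Hbar(W)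
    regarded over K and, with c replaced by -c, to the exchange of h and h*. Invariants of W are
    invariants of K, hence Hbar(W) acts on what is coinduced from Hbar(K). Positive degree
    invariants of K need not vanish in Hbar(W), hence the way up passes through a nilpotent
    ideal. *)

Lemma malg_lift_supp (C : nzRingType) (K : choiceType) (B : pzRingType)
    (sc : C -> B) (F : K -> B) (d : {fset K}) (h : {malg C[K]}) :
  sc 0 = 0 -> (monalg.msupp h `<=` d)%fset ->
  \sum_(k <- monalg.msupp h) sc (monalg.mcoeff k h) * F k
    = \sum_(k <- d) sc (monalg.mcoeff k h) * F k.
Proof.
move=> sc0 le_d; rewrite [LHS](big_fset_incl _ le_d) //= => k _.
by move/mcoeff_outdom->; rewrite sc0 mul0r.
Qed.

Lemma malg_scalar (C : nzRingType) (I : choiceType) a :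
  a%:A = mkmalgU mone a :> {malg C[{fmonom I}]}.
Proof.
apply/monalg.malgP => k.
by rewrite monalg.mcoeffZ monalg.mcoeff1 mcoeffU mulr_natr eq_sym.
Qed.

(** * Maps out of free algebras and of ring quotients *)

Section FreeLift.
Variables (C : nzRingType) (I : choiceType) (B : pzRingType).
Variables (sc : C -> B) (gm : I -> B).
Hypothesis scD : {morph sc : a b / a + b}.
Hypothesis scM : {morph sc : a b / a * b}.
Hypothesis sc1 : sc 1 = 1.
Hypothesis scC : forall a b, sc a * b = b * sc a.
Local Notation A := {malg C[{fmonom I}]}.

Definition word_prod (k : {fmonom I}) : B := \prod_(z <- fmonom_val k) gm z.

Definition free_lift (h : A) : B :=
  \sum_(k <- monalg.msupp h) sc (monalg.mcoeff k h) * word_prod k.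

Let sc0 : sc 0 = 0.
Proof. by apply: (addrI (sc 0)); rewrite -scD !addr0. Qed.

Lemma free_liftD : {morph free_lift : a b / a + b}.
Proof.
move=> a b; rewrite /free_lift.
set d := (monalg.msupp a `|` monalg.msupp b `|` monalg.msupp (a + b))%fset.
rewrite !(@malg_lift_supp _ _ _ _ _ d) // ?fsubsetUr //.
- rewrite -big_split /=; apply: eq_bigr => k _.
  by rewrite monalg.mcoeffD scD mulrDl.
- by rewrite /d fsubsetU // fsubsetUr.
by rewrite /d -fsetUA fsubsetUl.
Qed.

Lemma free_lift0 : free_lift 0 = 0.
Proof. by apply: (addrI (free_lift 0)); rewrite -free_liftD !addr0. Qed.

Lemma free_lift_sum (J : Type) (r : seq J) (P : pred J) (F : J -> A) :
  free_lift (\sum_(j <- r | P j) F j) = \sum_(j <- r | P j) free_lift (F j).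
Proof. exact: (big_morph _ free_liftD free_lift0). Qed.

Lemma free_liftU a k : free_lift (mkmalgU k a) = sc a * word_prod k.
Proof.
rewrite /free_lift (@malg_lift_supp _ _ _ _ _ [fset k]%fset) ?msuppU_le //.
by rewrite big_seq_fset1 mcoeffUU.
Qed.

Lemma word_prodM k k' : word_prod (mmul k k') = word_prod k * word_prod k'.
Proof. by rewrite /word_prod fmM big_cat. Qed.

Lemma free_liftM : {morph free_lift : a b / a * b}.
Proof.
move=> a b; rewrite malgME free_lift_sum {2}/free_lift mulr_suml.
apply: eq_bigr => k _; rewrite free_lift_sum {2}/free_lift mulr_sumr.
apply: eq_bigr => k' _; rewrite free_liftU scM word_prodM.
by rewrite -!mulrA; congr (_ * _); rewrite !mulrA scC.
Qed.

Lemma free_lift_scalar a : free_lift a%:A = sc a.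
Proof.
rewrite malg_scalar.
by rewrite free_liftU /word_prod fm1 big_nil mulr1.
Qed.

Lemma free_lift1 : free_lift 1 = 1.
Proof. by rewrite -[X in free_lift X]scale1r free_lift_scalar. Qed.

Lemma free_lift_gen z : free_lift (mkmalgU (fmu z) 1) = gm z.
Proof. by rewrite free_liftU sc1 mul1r /word_prod fmU big_seq1. Qed.

End FreeLift.

(** Words grow by a letter on the left, which matches the way triangular elements are shown to be
    stable: under left multiplication by each kind of generator. *)
Lemma free_ind (C : nzRingType) (I : choiceType) (P : {malg C[{fmonom I}]} -> Prop) :
  P 0 -> (forall a b, P a -> P b -> P (a + b)) ->
  (forall a h, P h -> P (a *: h)) -> P 1 ->
  (forall z h, P h -> P (mkmalgU (fmu z) 1 * h)) -> forall h, P h.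
Proof.
move=> P0 PD PZ P1 PM h; rewrite [h]monalg.monalgE.
apply: (big_ind P) => // k _.
have -> : mkmalgU k (monalg.mcoeff k h) = monalg.mcoeff k h *: mkmalgU k 1.
  by apply/monalg.malgP => k'; rewrite monalg.mcoeffZ !mcoeffU mulr_natr.
apply: PZ; rewrite -(fmK k); elim: (fmonom_val k) => [|z s IH].
  by rewrite -fmoneE.
have -> : FMonom (z :: s) = (mmul (fmu z) (FMonom s)).
  by apply/eqP; rewrite fmP /= fmM fmU.
have -> : mkmalgU (mmul (fmu z) (FMonom s)) 1
            = mkmalgU (fmu z) 1 * mkmalgU (FMonom s) 1 :> {malg C[{fmonom I}]}.
  by rewrite malgM_def fgmulUU mulr1.
exact: PM.
Qed.

Section QuotLift.
Variables (A B : pzRingType) (S : A -> Prop) (f : A -> B).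
Hypothesis fD : {morph f : a b / a + b}.
Hypothesis fM : {morph f : a b / a * b}.
Hypothesis f1 : f 1 = 1.
Hypothesis fS : forall s, S s -> f s = 0.

Lemma quot_kill a b : ring_proj S a = ring_proj S b -> f a = f b.
Proof.
move/ring_projP/ideal_genP=> /(_ (fun a => f a = 0)) fab.
have f0 : f 0 = 0 by apply: (addrI (f 0)); rewrite -fD !addr0.
have fN x : f (- x) = - f x by apply/eqP; rewrite -addr_eq0 -fD addNr f0.
apply/eqP; rewrite -subr_eq0 -fN -fD; apply/eqP; apply: fab => //.
split=> // [x y fx fy | x y z fy]; first by rewrite fD fN fx fy subr0.
by rewrite !fM fy mulr0 mul0r.
Qed.

End QuotLift.

Lemma ring_proj_rel (A : pzRingType) (S : A -> Prop) s :
  S s -> ring_proj S s = 0.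
Proof.
move=> Ss; have -> : (0 : ring_quot S) = ring_proj S 0.
  by apply: (addrI (ring_proj S 0)); rewrite -ring_projD !addr0.
by apply/ring_projP/ideal_genP => I _ /(_ s Ss); rewrite subr0.
Qed.

(** * Rings of additive endomorphisms *)

Record addmap (V : zmodType) :=
  Addmap { addmap_fun :> V -> V; addmapD : {morph addmap_fun : u v / u + v} }.

Lemma addmap0 (V : zmodType) (f : addmap V) : f 0 = 0.
Proof. by apply: (addrI (f 0)); rewrite -addmapD !addr0. Qed.

Lemma addmapN (V : zmodType) (f : addmap V) u : f (- u) = - f u.
Proof. by apply/eqP; rewrite -addr_eq0 -addmapD addNr addmap0. Qed.

Section AdditiveEndomorphisms.
Variables (V : zmodType) (S : Type) (sigma : S -> addmap V).

(** Commutation with [sigma] stands for linearity. In the coinduced module the scalars exist only as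
    the elements [EX a%:MP] of a ring, and commutation is what makes them central among the
    operators, as [co_sC] requires. *)
Record aend := Aend { aend_fun :> V -> V;
  aendD : {morph aend_fun : u v / u + v};
  aendS : forall s u, aend_fun (sigma s u) = sigma s (aend_fun u) }.

Lemma aend_eq (f g : aend) : f =1 g -> f = g.
Proof.
case: f g => [f fD fS] [g gD gS] /= /funext fg; case: _ / fg in gD gS *.
by congr Aend; apply: Prop_irrelevance.
Qed.

HB.instance Definition _ := gen_eqMixin aend.
HB.instance Definition _ := gen_choiceMixin aend.

Fact aend_zeroD : {morph (fun _ : V => 0 : V) : u v / u + v}.
Proof. by move=> u v; rewrite addr0. Qed.
Fact aend_zeroS s u : (fun _ : V => 0 : V) (sigma s u) = sigma s 0.
Proof. by rewrite addmap0. Qed.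
Definition aend0 := Aend aend_zeroD aend_zeroS.

Fact aend_oppD (f : aend) : {morph (fun u => - f u) : u v / u + v}.
Proof. by move=> u v; rewrite aendD opprD. Qed.
Fact aend_oppS (f : aend) s u : - f (sigma s u) = sigma s (- f u).
Proof. by rewrite aendS addmapN. Qed.
Definition aend_opp f := Aend (aend_oppD f) (aend_oppS f).

Fact aend_addD (f g : aend) : {morph (fun u => f u + g u) : u v / u + v}.
Proof. by move=> u v; rewrite !aendD addrACA. Qed.
Fact aend_addS (f g : aend) s u : f (sigma s u) + g (sigma s u) = sigma s (f u + g u).
Proof. by rewrite !aendS addmapD. Qed.
Definition aend_add f g := Aend (aend_addD f g) (aend_addS f g).

Fact aend_mulD (f g : aend) : {morph (fun u => f (g u)) : u v / u + v}.
Proof. by move=> u v; rewrite !aendD. Qed.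
Fact aend_mulS (f g : aend) s u : f (g (sigma s u)) = sigma s (f (g u)).
Proof. by rewrite !aendS. Qed.
Definition aend_mul f g := Aend (aend_mulD f g) (aend_mulS f g).

Fact aend_oneD : {morph (fun u : V => u) : u v / u + v}. Proof. by []. Qed.
Fact aend_oneS s u : (fun u : V => u) (sigma s u) = sigma s u. Proof. by []. Qed.
Definition aend1 := Aend aend_oneD aend_oneS.

Fact aend_addA : associative aend_add.
Proof. by move=> f g h; apply: aend_eq => u /=; rewrite addrA. Qed.
Fact aend_addC : commutative aend_add.
Proof. by move=> f g; apply: aend_eq => u /=; rewrite addrC. Qed.
Fact aend_add0 : left_id aend0 aend_add.
Proof. by move=> f; apply: aend_eq => u /=; rewrite add0r. Qed.
Fact aend_addN : left_inverse aend0 aend_opp aend_add.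
Proof. by move=> f; apply: aend_eq => u /=; rewrite addNr. Qed.

HB.instance Definition _ :=
  GRing.isZmodule.Build aend aend_addA aend_addC aend_add0 aend_addN.

Fact aend_mulA : associative aend_mul.
Proof. by move=> f g h; apply: aend_eq. Qed.
Fact aend_mul1 : left_id aend1 aend_mul.
Proof. by move=> f; apply: aend_eq. Qed.
Fact aend_mulr1 : right_id aend1 aend_mul.
Proof. by move=> f; apply: aend_eq. Qed.
Fact aend_mulDl : left_distributive aend_mul aend_add.
Proof. by move=> f g h; apply: aend_eq. Qed.
Fact aend_mulDr : right_distributive aend_mul aend_add.
Proof. by move=> f g h; apply: aend_eq => u /=; rewrite aendD. Qed.

HB.instance Definition _ := GRing.Zmodule_isPzRing.Build aend
  aend_mulA aend_mul1 aend_mulr1 aend_mulDl aend_mulDr.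

Lemma aend_addE (f g : aend) u : (f + g) u = f u + g u. Proof. by []. Qed.
Lemma aend_oppE (f : aend) u : (- f) u = - f u. Proof. by []. Qed.
Lemma aend_zeroE u : (0 : aend) u = 0. Proof. by []. Qed.
Lemma aend_mulE (f g : aend) u : (f * g) u = f (g u). Proof. by []. Qed.
Lemma aend_sumE (J : Type) (r : seq J) (P : pred J) (F : J -> aend) u :
  (\sum_(j <- r | P j) F j) u = \sum_(j <- r | P j) F j u.
Proof. by apply: (big_morph (fun f : aend => f u)). Qed.

End AdditiveEndomorphisms.

(** The Newton step z -> 3z^2 - 2z^3, written z^2 (z + 3(1 - z)), turns z(1 - z) into a multiple of
    its square, so k steps suffice for exponent 2^k. The predicate [P] carries along whatever the
    step preserves: centrality, prescribed scalars, or lying over a given idempotent. *)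
Lemma idempotent_lift (B : pzRingType) (P : B -> Prop) :
  (forall z, P z -> P (z * z * (z + (1 - z) *+ 3))) ->
  forall k z, P z -> (z * (1 - z)) ^+ (2 ^ k)%N = 0 ->
  exists2 e, P e & e * e = e.
Proof.
move=> Pstep; elim=> [|k IH] z Pz.
  rewrite expr1 mulrBr mulr1 => /eqP; rewrite subr_eq0 => /eqP zz.
  by exists z.
set n := 1 - z; have zn1 : z + n = 1 by rewrite addrC subrK.
have Pz' : P (z * z * (z + n *+ 3)) by exact: Pstep.
have nz : n * z = z * n by rewrite /n mulrBl mulrBr mul1r mulr1.
clearbody n => zn0; pose z' := z * z * (z + n *+ 3).
pose n' := n * n * (n + z *+ 3).
(* Applied to z + n = 1, this splits 1 into z' and its mirror image n', so that 1 - z' = n'. *)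
have cube a b : b * a = a * b ->
    (a + b) * (a + b) * (a + b)
      = a * a * (a + b *+ 3) + b * b * (b + a *+ 3) :> B.
  move=> ba; have ab2 : a * b * a = a * a * b by rewrite -mulrA ba mulrA.
  have bb : b * b * a = a * b * b by rewrite -mulrA ba mulrA ba.
  rewrite !(mulrDl, mulrDr) ba ab2 bb -!addrA; do 3!congr (_ + _).
  by rewrite addrCA; congr (_ + _); rewrite [RHS]addrC -!addrA.
have zn'1 : z' + n' = 1 by rewrite /z' /n' -cube // zn1 !mulr1.
have def_n' : 1 - z' = n' by apply/eqP; rewrite subr_eq addrC zn'1.
have comm_zn : GRing.comm z n by rewrite /GRing.comm nz.
pose q := (z + n *+ 3) * (n + z *+ 3).
have comm_q : GRing.comm (z * n) q.
  have czq : GRing.comm (z * n) z by rewrite /GRing.comm -mulrA nz mulrA.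
  have cnq : GRing.comm (z * n) n by rewrite /GRing.comm [RHS]mulrA nz.
  by rewrite /q; apply: commrM; apply: commrD => //; apply: commrMn.
have zn' : z' * n' = (z * n) ^+ 2 * q.
  have c3 : (z + n *+ 3) * (n * n) = n * n * (z + n *+ 3).
    have cn : GRing.comm n (z + n *+ 3).
      by apply: commrD => //; apply: commrMn.
    by apply: commrM; apply: commr_sym.
  rewrite /z' /n' /q; move: (z + _) (n + _) c3 => a b c3; rewrite expr2.
  have -> : z * n * (z * n) = z * z * (n * n) by rewrite mulrA -(mulrA z n) nz !mulrA.
  rewrite -!mulrA; do 2!congr (z * _).
  by rewrite (mulrA n n b) [LHS]mulrA c3 -!mulrA.
apply: (IH z') => //.
rewrite def_n' zn' exprMn_comm; last by apply/commr_sym/commrX/commr_sym.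
by rewrite -exprM -expnS zn0 mul0r.
Qed.

(** * Polynomials on h: substitutions, order at the origin, divided differences *)

Section Polynomials.
Variables (C : fieldType) (n : nat).
Local Notation mp := (mpoly n C).

Lemma mpoly_ring_ind (P : mp -> Prop) :
  (forall c, P c%:MP) -> (forall i, P 'X_i) ->
  (forall p q, P p -> P q -> P (p + q)) ->
  (forall p q, P p -> P q -> P (p * q)) -> forall p, P p.
Proof.
move=> PC PX PD PM; elim/mpolyind=> [|c m p _ _ Pp]; first by rewrite -mpolyC0.
apply: PD => //; rewrite -mul_mpolyC; apply: (PM) => //.
rewrite mpolyXE_id; apply: (big_ind P) => // [|i _]; first by rewrite -mpolyC1.
elim: (m i) => [|k IH]; first by rewrite expr0 -mpolyC1.
by rewrite exprS; apply: PM.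
Qed.

Definition lin (x : 'cV[C]_n) : mp := \sum_i x i 0 *: 'X_i.

Lemma linD : {morph lin : x y / x + y}.
Proof.
by move=> x y; rewrite /lin -big_split; apply: eq_bigr => i _; rewrite mxE scalerDl.
Qed.

Lemma linZ a x : lin (a *: x) = a *: lin x.
Proof.
by rewrite /lin scaler_sumr; apply: eq_bigr => i _; rewrite mxE scalerA.
Qed.

Lemma lin_delta i : lin (delta_mx i 0) = 'X_i.
Proof.
rewrite /lin (bigD1 i) //= mxE !eqxx scale1r big1 ?addr0 // => j ji.
by rewrite mxE (negPf ji) scale0r.
Qed.

Lemma lin0 : lin 0 = 0.
Proof. by rewrite -(scale0r (0 : 'cV_n)) linZ scale0r. Qed.

Lemma meval_lin (y : 'I_n -> C) x : meval y (lin x) = \sum_i y i * x i 0.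
Proof.
rewrite /lin raddf_sum; apply: eq_bigr => i _.
by rewrite /= mevalZ mevalXU mulrC.
Qed.

Lemma lin_eq0 x : (lin x == 0) = (x == 0).
Proof.
apply/eqP/eqP=> [lx0|->]; last exact: lin0.
apply/matrixP => i j; rewrite ord1 mxE.
have := meval_lin (fun k => (k == i)%:R) x; rewrite lx0 meval0 (bigD1 i) //=.
rewrite eqxx mul1r big1 ?addr0 => [->//|k ki]; by rewrite (negPf ki) mul0r.
Qed.

(** The algebra endomorphism that takes [lin x] to [lin (A *m x)]. On functions of a row vector it
    is f(y) -> f(yA), so [sub (rG g)] is the action of g on C[h]. *)
Definition sub (A : 'M[C]_n) : mp -> mp :=
  comp_mpoly [tuple lin (col i A) | i < n].

HB.instance Definition _ A := GRing.Additive.on (sub A).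
HB.instance Definition _ A := GRing.RMorphism.on (sub A).

Lemma subC A c : sub A c%:MP = c%:MP. Proof. exact: comp_mpolyC. Qed.
Lemma subD A : {morph sub A : p q / p + q}. Proof. exact: raddfD. Qed.
Lemma subM A : {morph sub A : p q / p * q}.
Proof. exact: rmorphM. Qed.
Lemma subZ A a p : sub A (a *: p) = a *: sub A p.
Proof. exact: comp_mpolyZ. Qed.

Lemma subX A i : sub A 'X_i = lin (col i A).
Proof. by rewrite /sub /comp_mpoly mmapX mmap1U tnth_mktuple. Qed.

Lemma sub_lin A x : sub A (lin x) = lin (A *m x).
Proof.
rewrite /lin raddf_sum /=; under eq_bigr do rewrite subZ subX /lin scaler_sumr.
rewrite exchange_big; apply: eq_bigr => i _ /=; rewrite mxE scaler_suml.
by apply: eq_bigr => j _; rewrite !mxE scalerA mulrC.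
Qed.

Lemma sub_mul A B p : sub A (sub B p) = sub (A *m B) p.
Proof.
elim/mpoly_ring_ind: p => [c|i|p q|p q]; rewrite ?subC //.
- by rewrite -lin_delta !sub_lin mulmxA.
- by rewrite !subD => -> ->.
by rewrite !subM => -> ->.
Qed.

Lemma sub1 p : sub 1%:M p = p.
Proof.
elim/mpoly_ring_ind: p => [c|i|p q|p q]; rewrite ?subC //.
- by rewrite -lin_delta sub_lin mul1mx.
- by rewrite subD => -> ->.
by rewrite subM => -> ->.
Qed.

Lemma meval_sub (y : 'rV[C]_n) A p :
  meval (fun i => y 0 i) (sub A p) = meval (fun i => (y *m A) 0 i) p.
Proof.
elim/mpoly_ring_ind: p => [c|i|p q|p q].
- by rewrite subC !mevalC.
- rewrite subX meval_lin mevalXU !mxE; apply: eq_bigr => j _.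
  by rewrite mxE.
- by rewrite subD !mevalD => -> ->.
by rewrite subM !mevalM => -> ->.
Qed.

Definition order_ge (k : nat) (p : mp) : Prop := forall m, (mdeg m < k)%N -> p@_m = 0.

Lemma order_ge0 p : order_ge 0 p. Proof. by []. Qed.
Lemma order_ge_zero k : order_ge k 0. Proof. by move=> m _; rewrite mcoeff0. Qed.
Lemma order_geD k p q : order_ge k p -> order_ge k q -> order_ge k (p + q).
Proof. by move=> op oq m mk; rewrite mcoeffD op ?oq ?addr0. Qed.
Lemma order_geW j k p : (j <= k)%N -> order_ge k p -> order_ge j p.
Proof. by move=> jk op m mj; apply: op; apply: leq_trans jk. Qed.

Lemma order_geM j k p q : order_ge j p -> order_ge k q -> order_ge (j + k) (p * q).
Proof.
move=> op oq m mk; rewrite mcoeffM big1 // => -[m1 m2] /= /eqP def_m.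
have [m1j|m1j] := ltnP (mdeg m1) j; first by rewrite op ?mul0r.
rewrite oq ?mulr0 // -(ltn_add2l (mdeg m1)) -mdegD -def_m.
by rewrite (leq_trans mk) // leq_add2r.
Qed.

Lemma order_ge_eq0 p : (forall k, order_ge k p) -> p = 0.
Proof. by move=> op; apply/mpolyP => m; rewrite mcoeff0 (op (mdeg m).+1). Qed.

Lemma constant_termE (p : mp) : constant_term p = p@_0%MM.
Proof.
rewrite /constant_term; elim/mpolyind: p => [|c m p _ _ IH].
  by rewrite raddf0 mcoeff0.
rewrite mevalD mcoeffD IH mevalZ mcoeffZ mevalX mcoeffX; congr (_ * _ + _).
have [->|m0] := eqVneq m 0%MM; first by rewrite big1 // => i _; rewrite mnm0E.
have [i mi]: exists i, m i != 0%N.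
  apply/existsP; apply: contraR m0; rewrite negb_exists => /forallP m0.
  by apply/eqP/mnmP => i; rewrite mnm0E; apply/eqP; have := m0 i; rewrite negbK.
by rewrite (bigD1 i) //= expr0n (negPf mi) mul0r.
Qed.

Lemma order_ge1 p : order_ge 1 p <-> constant_term p = 0.
Proof.
rewrite constant_termE; split=> [->|p0 m]; first by [].
- by rewrite mdeg0.
by rewrite ltnS leqn0 mdeg_eq0 => /eqP->.
Qed.

Lemma constant_termD (p q : mp) :
  constant_term (p + q) = constant_term p + constant_term q.
Proof. exact: mevalD. Qed.
Lemma constant_termM (p q : mp) :
  constant_term (p * q) = constant_term p * constant_term q.
Proof. exact: mevalM. Qed.
Lemma constant_termC c : constant_term (c%:MP : mp) = c.
Proof. exact: mevalC. Qed.
Lemma constant_term_lin x : constant_term (lin x) = 0.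
Proof. by rewrite /constant_term meval_lin big1 // => i _; rewrite mul0r. Qed.

Lemma constant_term_sub A (p : mp) : constant_term (sub A p) = constant_term p.
Proof.
elim/mpoly_ring_ind: p => [c|i|p q|p q].
- by rewrite subC.
- by rewrite -lin_delta sub_lin !constant_term_lin.
- by rewrite subD !constant_termD => -> ->.
by rewrite subM !constant_termM => -> ->.
Qed.

Lemma order_sub A k p : order_ge k p -> order_ge k (sub A p).
Proof.
move=> op; rewrite [p]mpolyE raddf_sum /=.
elim/big_rec: _ => [|m q _ oq]; first exact: order_ge_zero.
apply: order_geD => //; have [mk|km] := ltnP (mdeg m) k.
  by rewrite op // scale0r raddf0; apply: order_ge_zero.
apply: (order_geW km); rewrite subZ -mul_mpolyC -[mdeg m]add0n.
apply: order_geM => //; rewrite mpolyXE_id rmorph_prod mdegE /=.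
elim/big_rec2: _ => [|i k1 q1 _ o1] //.
apply: order_geM => //; rewrite rmorphXn /= subX.
elim: (m i) => [|j IH] //; rewrite exprS -add1n; apply: order_geM => //.
by apply/order_ge1; rewrite constant_term_lin.
Qed.

Section DividedDifference.
Variables (alpha : 'cV[C]_n) (beta : 'rV[C]_n) (k : C).
Hypotheses (k0 : k != 0) (alpha0 : alpha != 0).
Let A : 'M[C]_n := 1%:M + k *: (alpha *m beta).
Let la := k *: lin alpha.

Let la0 : la != 0.
Proof. by rewrite /la scaler_eq0 negb_or k0 lin_eq0. Qed.

Lemma sub_reflection x : sub A (lin x) = lin x + la * ((beta *m x) 0 0)%:MP.
Proof.
rewrite sub_lin mulmxDl mul1mx linD; congr (_ + _).
rewrite -scalemxAl -mulmxA linZ /la -scalerAl; congr (_ *: _).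
rewrite [beta *m x]mx11_scalar mul_mx_scalar linZ mulrC mul_mpolyC.
by rewrite [in RHS]mxE eqxx mulr1n.
Qed.

Fact divided_difference_ex p : exists q, sub A p = p + la * q.
Proof.
elim/mpoly_ring_ind: p => [c|i|p q [p' Ep] [q' Eq]|p q [p' Ep] [q' Eq]].
- by exists 0; rewrite subC mulr0 addr0.
- by exists ((beta *m (delta_mx i 0 : 'cV_n)) 0 0)%:MP; rewrite -lin_delta sub_reflection.
- by exists (p' + q'); rewrite subD Ep Eq mulrDr addrACA.
by exists (p * q' + p' * (q + la * q')); rewrite subM Ep Eq; ring.
Qed.

(** A reflection fixes every polynomial modulo its root, here [la]. The quotient is unique because
    polynomials form a domain, and uniqueness reduces each property of D to a check of the equation
    that defines it. *)
Lemma divided_difference_exists : exists D : mp -> mp,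
  [/\ {morph D : p q / p + q}, forall p q, D (p * q) = p * D q + D p * sub A q,
      forall x, D (lin x) = ((beta *m x) 0 0)%:MP
    & forall p, sub A p = p -> D p = 0].
Proof.
have [D DP] := boolp.choice divided_difference_ex.
have uniqD p q : sub A p = p + la * q -> D p = q.
  by rewrite DP => /addrI/(mulfI la0).
exists D; split=> [p q|p q|x|p sp]; apply: uniqD.
- by rewrite subD !DP mulrDr addrACA.
- by rewrite subM !DP; ring.
- exact: sub_reflection.
by rewrite mulr0 addr0.
Qed.

End DividedDifference.

Section Vanishing.
Hypothesis C0 : [pchar C] =i pred0.

Lemma poly_vanish (Q : {poly C}) : (forall t, Q.[t] = 0) -> Q = 0.
Proof.
move=> Q0; apply/eqP; apply: contraT => nzQ.
pose rs := [seq i%:R | i <- iota 0 (size Q)] : seq C.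
have := @max_poly_roots _ Q rs nzQ; rewrite size_map size_iota ltnn; apply.
  by apply/allP => t _; apply/rootP.
rewrite map_inj_uniq ?iota_uniq // => i j; wlog ij : i j / (i <= j)%N.
  by case/orP: (leq_total i j) => ij H E; [|apply/esym]; apply: H.
move/eqP; rewrite eq_sym -subr_eq0 -natrB // (proj1 (pcharf0P C) C0) subn_eq0.
by move=> ji; apply/eqP; rewrite eqn_leq ij.
Qed.

(** The variables are peeled off one at a time. [S k] concerns the part of p whose exponents agree
    with those of m0 in the first k variables, these variables being removed. Treating the next
    variable as the indeterminate of [Q], all values of [Q] vanish, hence so does its coefficient of
    degree m0 k. *)
Lemma mpoly_vanish (p : mp) : (forall v, meval v p = 0) -> p = 0.
Proof.
move=> p0; apply/mpolyP => m0; rewrite mcoeff0.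
pose agree k (m : 'X_{1..n}) := [forall i : 'I_n, (i < k)%N ==> (m i == m0 i)].
have S k : (k <= n)%N -> forall v : 'I_n -> C,
    \sum_(m <- msupp p | agree k m)
       p@_m * \prod_(i < n | (k <= i)%N) v i ^+ m i = 0.
  elim: k => [_|k IH ltkn] v.
    rewrite -[RHS](p0 v) mevalE; apply: eq_big => [m|m _].
      by apply/forallP => i; rewrite ltn0.
    by [].
  pose k' := Ordinal ltkn.
  pose Q := \sum_(m <- msupp p | agree k m)
       (p@_m * \prod_(i < n | (k < i)%N) v i ^+ m i) *: 'X^(m k') : {poly C}.
  have Q0 : Q = 0.
    apply: poly_vanish => t.
    rewrite -(IH (ltnW ltkn) (fun i => if i == k' then t else v i)).
    rewrite /Q horner_sum; apply: eq_bigr => m _; rewrite hornerZ hornerXn -mulrA.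
    congr (_ * _); rewrite [RHS](bigD1 k') //= eqxx mulrC; congr (_ * _).
    apply: eq_big => i; first by rewrite ltn_neqAle eq_sym andbC.
    by rewrite -val_eqE /=; case: ltngtP.
  have := congr1 (fun q : {poly C} => q`_(m0 k')) Q0; rewrite coef0 /Q coef_sum => Q1; rewrite -[RHS]Q1.
  rewrite [RHS](bigID (fun m : 'X_{1..n} => m k' == m0 k')) /= [X in _ + X]big1 ?addr0.
    apply: eq_big => [m|m am]; last first.
      rewrite coefZ coefXn; have /implyP/(_ (ltnSn k))/eqP-> := forallP am k'.
      by rewrite eqxx mulr1.
    apply/forallP/andP=> [am|[/forallP am /eqP mk] i].
      split; last by apply: (implyP (am k')) => /=.
      by apply/forallP => i; apply/implyP => ik; apply: (implyP (am i)); apply: leqW.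
    rewrite ltnS leq_eqVlt; apply/implyP => /orP[/eqP ik|ik].
      have -> : i = k' by apply: val_inj.
      by rewrite mk.
    by apply: (implyP (am i)).
  by move=> m /andP[_ mk]; rewrite coefZ coefXn eq_sym (negPf mk) mulr0.
have := S n (leqnn n) (fun=> 1).
have [m0p|] := boolP (m0 \in msupp p); last by move/memN_msupp_eq0->.
rewrite big_mkcond (bigD1_seq m0) ?msupp_uniq //= ifT; last first.
  by apply/forallP => i; rewrite eqxx implybT.
rewrite big1 ?mulr1 => [|i]; last by rewrite leqNgt ltn_ord.
rewrite big1 ?addr0 // => m mm0; case: ifP => // /forallP am.
by case/eqP: mm0; apply/mnmP => i; have := am i; rewrite ltn_ord => /eqP.
Qed.

End Vanishing.
End Polynomials.

(** * Reflections and their roots *)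

Section Reflections.
Variables (C : fieldType) (gT : finGroupType) (G : {group gT}) (n : nat).
Variable rG : mx_representation C G n.
Hypothesis C0 : [pchar C] =i pred0.

(** The product of root and coroot, on which alone the relations depend: the multiple of s - 1 with
    trace 2. *)
Definition root_mx (s : gT) : 'M[C]_n := (2 / \tr (rG s - 1%:M)) *: (rG s - 1%:M).

Lemma natf_neq0 k : (k.+1%:R : C) != 0.
Proof. by rewrite (proj1 (pcharf0P C) C0). Qed.

Lemma rank1_mx (M : 'M[C]_n) : \rank M = 1%N ->
  exists (a : 'cV_n) (b : 'rV_n), M = a *m b.
Proof.
move=> rM; rewrite -(mulmx_base M); move: (col_base M) (row_base M).
by rewrite rM => a b; exists a, b.
Qed.

Lemma reflections_in s : s \in reflections rG -> s \in G.
Proof. by rewrite inE => /andP[]. Qed.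

Lemma reflection_rank s : s \in reflections rG -> \rank (rG s - 1%:M) = 1%N.
Proof.
move=> Rs; have Gs := reflections_in Rs; move: Rs; rewrite inE Gs mxrank_ker /=.
have -> : rG s - 1%:M = rG s *m (1%:M - rG s^-1%g).
  by rewrite mulmxBr mulmx1 -repr_mxM ?groupV // mulgV repr_mx1.
rewrite eqmxMfull ?row_full_unit ?repr_mx_unit //.
set r := \rank _; have : (r <= n)%N by exact: rank_leq_row.
by case: n => [|m]; lia.
Qed.

Lemma mul_scalar11 m k (a : 'M[C]_(m, 1)) (z : 'M[C]_1) (b : 'M[C]_(1, k)) :
  a *m z *m b = z 0 0 *: (a *m b).
Proof. by rewrite {1}[z]mx11_scalar mul_mx_scalar -scalemxAl. Qed.

Lemma reflection_factor s : s \in reflections rG ->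
  exists (k k' : C) (alpha : 'cV_n) (beta : 'rV_n),
    [/\ k != 0, k' != 0, alpha != 0 & root_mx s = alpha *m beta] /\
    [/\ rG s = 1%:M + k *: (alpha *m beta),
        rG s^-1%g = 1%:M + k' *: (alpha *m beta) & pairing beta alpha = 2%:R].
Proof.
move=> Rs; have Gs := reflections_in Rs; have rM := reflection_rank Rs.
have [a [b def_M]] := rank1_mx rM; set M := rG s - 1%:M in rM def_M.
have nzM : M != 0 by rewrite -mxrank_eq0 rM.
have rGs : rG s = 1%:M + M by rewrite addrC subrK.
pose t := (b *m a) 0 0.
have MM : M *m M = t *: M.
  by rewrite {1 2}def_M -mulmxA [b *m _]mulmxA mulmxA mul_scalar11 def_M.
have trM : \tr M = t.
  by rewrite def_M mxtrace_mulC [b *m a]mx11_scalar mxtrace_scalar mulr1n.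
(* If the trace vanished, s would be unipotent with s^m = 1 + mM for all m; the finite order of s
   would then force M = 0 in characteristic zero. *)
have t0 : t != 0.
  apply/eqP => t0; case/negP: nzM.
  have powM m : (m%:R *: M == rG (s ^+ m)%g - 1%:M).
    elim: m => [|m IH]; first by rewrite scale0r expg0 repr_mx1 subrr.
    rewrite expgSr repr_mxM ?groupX //.
    have -> : rG (s ^+ m)%g = m%:R *: M + 1%:M by rewrite (eqP IH) subrK.
    rewrite rGs mulmxDr mulmx1 mulmxDl mul1mx -scalemxAl MM t0 scale0r scaler0 add0r.
    by rewrite addrAC addrK -natr1 scalerDl scale1r.
  have := powM #[s]%g; rewrite expg_order repr_mx1 subrr scaler_eq0.
  by have := order_gt0 s; case: #[s]%g => // m _; rewrite (negPf (natf_neq0 m)).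
have two0 : 2 != 0 :> C by exact: natf_neq0 1%N.
pose k := t / 2; have k0 : k != 0 by rewrite mulf_neq0 ?invr_eq0.
pose beta := (2 / t) *: b.
have def_kM : k *: (a *m beta) = M.
  rewrite /k /beta -scalemxAr -def_M scalerA.
  rewrite (_ : t / 2 * (2 / t) = 1) ?scale1r //.
  by field; rewrite t0 two0.
have root_mxE : root_mx s = a *m beta.
  rewrite /root_mx -/M trM def_M /beta. by rewrite -scalemxAr.
have pair2 : pairing beta a = 2%:R.
  by rewrite /pairing /beta -scalemxAl mxE -/t divfK.
have rGa : rG s *m a = (1 + t) *: a.
  rewrite rGs mulmxDl mul1mx def_M scalerDl scale1r -mulmxA [b *m a]mx11_scalar.
  by rewrite mul_mx_scalar.
(* This is the eigenvalue of s on [a], nonzero because s is invertible; it gives the inverse of s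
   explicitly. *)
have t1 : 1 + t != 0.
  apply: contraNneq nzM => t1; rewrite def_M -(repr_mxK rG Gs (a *m b)).
  have : rG s *m (a *m b) = 0 by rewrite mulmxA rGa t1 scale0r mul0mx.
  move/(congr1 (mulmx (rG s^-1%g))); rewrite mulmx0 mulmxA -repr_mxM ?groupV //.
  by rewrite mulVg repr_mx1 mul1mx => ->; rewrite !mul0mx.
exists k, (- (k / (1 + t))), a, beta; split; split=> //.
- by rewrite oppr_eq0 mulf_neq0 ?invr_eq0.
- by apply: contraNneq nzM => a0; rewrite def_M a0 mul0mx.
- by rewrite def_kM.
rewrite scaleNr mulrC -scalerA def_kM.
have : rG s *m (1%:M - (1 + t)^-1 *: M) = 1%:M.
  rewrite mulmxBr mulmx1 -scalemxAr def_M mulmxA rGa -scalemxAl -def_M scalerA.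
  by rewrite mulVf // scale1r rGs addrK.
move/(congr1 (mulmx (rG s^-1%g))); rewrite mulmxA mulmx1 -repr_mxM ?groupV //.
by rewrite mulVg repr_mx1 mul1mx => ->.
Qed.

Lemma root_pair_exists s : s \in reflections rG ->
  exists (alpha : 'cV_n) (beta : 'rV_n), root_pair rG s alpha beta.
Proof.
move=> Rs; have [k [k' [a [b [[k0 k'0 a0 _] [rGs rGs' ab2]]]]]] := reflection_factor Rs.
have two0 : 2 != 0 :> C by exact: natf_neq0 1%N.
have bab : b *m a = 2%:M.
  by rewrite [b *m a]mx11_scalar -ab2.
exists a, b; split=> //.
  rewrite rGs [1%:M + _]addrC addrK; apply/andP; split; last first.
    by rewrite linearZ /= trmx_mul scalemx_sub // submxMl.
  apply/submxP; exists ((2 * k)^-1 *: a^T).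
  rewrite linearZ /= trmx_mul -scalemxAl -scalemxAr mulmxA -trmx_mul bab.
  rewrite tr_scalar_mx mul_scalar_mx !scalerA -{1}[a^T]scale1r; congr (_ *: _).
  by field; rewrite two0 k0.
rewrite rGs' [1%:M + _]addrC addrK; apply/andP; split; last first.
  by rewrite scalemx_sub // submxMl.
apply/submxP; exists ((2 * k')^-1 *: b).
rewrite -scalemxAl -scalemxAr mulmxA bab mul_scalar_mx !scalerA.
rewrite -{1}[b]scale1r; congr (_ *: _).
by field; rewrite two0 k'0.
Qed.

(** Root and coroot span fixed lines, and the pairing 2 makes their two scalings inverse to each
    other, so these cancel in the product. *)
Lemma root_pair_mx s alpha beta : s \in reflections rG ->
  root_pair rG s alpha beta -> alpha *m beta = root_mx s.
Proof.
move=> Rs; have [k [k' [a [b [[k0 k'0 a0 ->] [rGs rGs' ab2]]]]]] := reflection_factor Rs.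
case; rewrite rGs rGs' ![1%:M + _]addrC !addrK => /andP[sa _] /andP[sb _] ab'.
have [x def_a] : exists x, alpha = x *: a.
  have : (alpha^T <= a^T)%MS.
    by apply: (submx_trans sa); rewrite linearZ /= trmx_mul scalemx_sub // submxMl.
  case/submxP => z /(congr1 trmx); rewrite trmx_mul !trmxK => ->.
  by exists (z^T 0 0); rewrite {1}[z^T]mx11_scalar mul_mx_scalar.
have [y def_b] : exists y, beta = y *: b.
  have : (beta <= b)%MS.
    by apply: (submx_trans sb); rewrite scalemx_sub // submxMl.
  case/submxP => z ->.
  by exists (z 0 0); rewrite {1}[z]mx11_scalar mul_scalar_mx.
have two0 : 2 != 0 :> C by exact: natf_neq0 1%N.
have /eqP : y * x * 2 = 2.
  rewrite -[RHS]ab' def_a def_b /pairing -scalemxAl -!scalemxAr 2!mxE.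
  by rewrite -[(b *m a) 0 0]/(pairing b a) ab2 mulrA.
rewrite -subr_eq0 -{2}[2]mul1r -mulrBl mulf_eq0 (negPf two0) orbF subr_eq0.
by move/eqP => yx; rewrite def_a def_b -scalemxAl -scalemxAr scalerA mulrC yx scale1r.
Qed.

Lemma root_mx_conj s w : s \in G -> w \in G ->
  root_mx (s ^ w)%g = rG w^-1%g *m root_mx s *m rG w.
Proof.
move=> Gs Gw; have E : rG (s ^ w)%g - 1%:M = rG w^-1%g *m (rG s - 1%:M) *m rG w.
  rewrite conjgE !repr_mxM ?groupV ?groupM // mulmxBr mulmx1 mulmxBl mulmxA.
  by rewrite -[rG w^-1%g *m rG w]repr_mxM ?groupV // mulVg repr_mx1.
have trE : \tr (rG (s ^ w)%g - 1%:M) = \tr (rG s - 1%:M).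
  by rewrite E mxtrace_mulC mulmxA -repr_mxM ?groupV // mulgV repr_mx1 mul1mx.
by rewrite /root_mx trE E -scalemxAr -scalemxAl.
Qed.

Lemma reflections_conj s w : w \in G ->
  ((s ^ w)%g \in reflections rG) = (s \in reflections rG).
Proof.
move=> Gw; rewrite !inE groupJr //.
case Gs: (s \in G) => //=; congr (_.+1 == _).
rewrite !mxrank_ker -conjVg.
have -> : 1%:M - rG (s^-1 ^ w)%g = rG w^-1%g *m (1%:M - rG s^-1%g) *m rG w.
  rewrite conjgE !repr_mxM ?groupV ?groupM ?groupV // mulmxBr mulmx1 mulmxBl mulmxA.
  by rewrite -[rG w^-1%g *m rG w]repr_mxM ?groupV // mulVg repr_mx1.
rewrite mxrankMfree ?row_free_unit ?repr_mx_unit //.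
by rewrite eqmxMfull ?row_full_unit ?repr_mx_unit ?groupV.
Qed.

(* The operators y |-> (y, alpha_s) D_s with D_s the divided difference; only   *)
(* the product alpha_s alphav_s is independent of the choice of a root pair.    *)
Lemma demazure_exists :
  exists Del : gT -> 'rV[C]_n -> mpoly n C -> mpoly n C,
  forall s y, s \in reflections rG ->
  [/\ {morph Del s y : p q / p + q},
      forall p q, Del s y (p * q) = p * Del s y q + Del s y p * sub (rG s) q,
      forall x, Del s y (lin x) = (pairing y (root_mx s *m x))%:MP,
      forall p, sub (rG s) p = p -> Del s y p = 0
    & forall a y' p, Del s (a *: y + y') p = a *: Del s y p + Del s y' p].
Proof.
suff H s : exists D : 'rV[C]_n -> mpoly n C -> mpoly n C, forall y,
    s \in reflections rG ->
  [/\ {morph D y : p q / p + q},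
      forall p q, D y (p * q) = p * D y q + D y p * sub (rG s) q,
      forall x, D y (lin x) = (pairing y (root_mx s *m x))%:MP,
      forall p, sub (rG s) p = p -> D y p = 0
    & forall a y' p, D (a *: y + y') p = a *: D y p + D y' p].
  by have [Del DelP] := boolp.choice H; exists Del => s y; apply: DelP.
have [Rs|] := boolP (s \in reflections rG); last by exists (fun _ _ => 0).
have [k [k' [a [b [[k0 k'0 a0 ->] [rGs rGs' ab2]]]]]] := reflection_factor Rs.
have [D [DD DM DX DI]] := divided_difference_exists b k0 a0.
rewrite -rGs in DM DI; exists (fun y p => pairing y a *: D p) => y _; split.
- by move=> p q; rewrite DD scalerDr.
- by move=> p q; rewrite DM scalerDr scalerAr scalerAl.
- move=> x; rewrite DX -mul_mpolyC -mpolyCM; congr (_%:MP).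
  rewrite /pairing -mulmxA mulmxA [y *m a]mx11_scalar mul_scalar_mx [in RHS]mxE.
  by rewrite !mxE eqxx mulr1n.
- by move=> p /DI ->; rewrite scaler0.
move=> c y' p; rewrite scalerA -scalerDl; congr (_ *: _).
by rewrite /pairing mulmxDl -scalemxAl !mxE.
Qed.

End Reflections.

Section DualRepresentation.
Variables (C : fieldType) (gT : finGroupType) (G : {group gT}) (n : nat).
Variable rG : mx_representation C G n.

Definition dual_mx (g : gT) : 'M[C]_n := (rG g^-1%g)^T.

Lemma dual_mx_repr : mx_repr G dual_mx.
Proof.
split=> [|x y Gx Gy]; first by rewrite /dual_mx invg1 repr_mx1 trmx1.
by rewrite /dual_mx invMg repr_mxM ?groupV // trmx_mul.
Qed.
Definition dual_repr := MxRepresentation dual_mx_repr.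

Lemma invariant_dualE f : invariant_dual rG f <-> invariant_h dual_repr f.
Proof.
have E (u : 'rV[C]_n) : meval (fun i => u 0 i) f = meval (fun i => u^T i 0) f.
  by apply: meval_eq => i; rewrite mxE.
have A g u : (act_h dual_repr g u)^T = act_dual rG g u^T.
  by rewrite /act_h /act_dual /= /dual_mx invgK trmx_mul trmxK.
split=> invf g v Gg; first by rewrite !E A invf.
by have := invf g v^T Gg; rewrite !E A trmxK.
Qed.

End DualRepresentation.

(** * The ideal of positive degree invariants *)

Section Coinvariants.
Variables (C : fieldType) (gT : finGroupType) (G : {group gT}) (n : nat).
Variable rG : mx_representation C G n.
Local Notation mp := (mpoly n C).

Definition inv (f : mp) : Prop := forall g, g \in G -> sub (rG g) f = f.

(** Invariance as a function on h becomes invariance as a polynomial through [mpoly_vanish]. *)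
Lemma invP (C0 : [pchar C] =i pred0) f : invariant_h rG f <-> inv f.
Proof.
split=> [invf g Gg|invf g y Gg]; last first.
  by rewrite -[in RHS](invf g^-1%g) ?groupV // meval_sub.
apply/eqP; rewrite -subr_eq0; apply/eqP/(mpoly_vanish C0) => v.
pose y : 'rV[C]_n := \row_i v i.
have Ey q : meval v q = meval (fun i => y 0 i) q.
  by apply: meval_eq => i; rewrite mxE.
rewrite mevalB !Ey meval_sub -(invf g^-1%g y) ?groupV //; apply/eqP.
by rewrite subr_eq0; apply/eqP; rewrite /act_h invgK.
Qed.

Lemma invC c : inv c%:MP. Proof. by move=> g _; rewrite subC. Qed.
Lemma invD f g : inv f -> inv g -> inv (f + g).
Proof. by move=> If Ig x Gx; rewrite subD If ?Ig. Qed.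
Lemma invM f g : inv f -> inv g -> inv (f * g).
Proof. by move=> If Ig x Gx; rewrite subM If ?Ig. Qed.

(** Membership in the Hilbert ideal, by which C[h] is divided to form the coinvariant algebra. *)
Definition coinv (p : mp) : Prop := exists s : seq (mp * mp),
  (forall u, u \in s -> inv u.1 /\ constant_term u.1 = 0)
  /\ p = \sum_(u <- s) u.1 * u.2.

Lemma coinv0 : coinv 0.
Proof. by exists [::]; rewrite big_nil. Qed.

Lemma coinvD p q : coinv p -> coinv q -> coinv (p + q).
Proof.
move=> [s [Is ->]] [t [It ->]]; exists (s ++ t); split; last by rewrite big_cat.
by move=> u; rewrite mem_cat => /orP[/Is|/It].
Qed.

Lemma coinvMl p q : coinv p -> coinv (q * p).
Proof.
move=> [s [Is ->]]; exists [seq (u.1, q * u.2) | u <- s]; split.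
  by move=> u /mapP[v /Is Iv ->].
by rewrite big_map mulr_sumr; apply: eq_bigr => u _; rewrite mulrCA.
Qed.

Lemma coinvMr p q : coinv p -> coinv (p * q).
Proof. by rewrite mulrC; apply: coinvMl. Qed.

Lemma coinvZ a p : coinv p -> coinv (a *: p).
Proof. by rewrite -mul_mpolyC; apply: coinvMl. Qed.

Lemma coinvN p : coinv p -> coinv (- p).
Proof. by rewrite -mulN1r; apply: coinvMl. Qed.

Lemma coinvB p q : coinv p -> coinv q -> coinv (p - q).
Proof. by move=> Ip Iq; apply: coinvD => //; apply: coinvN. Qed.

Lemma coinv_sum (I : Type) (r : seq I) (P : pred I) (F : I -> mp) :
  (forall i, P i -> coinv (F i)) -> coinv (\sum_(i <- r | P i) F i).
Proof. by move=> IF; apply: (big_ind coinv) => //; [exact: coinv0|exact: coinvD]. Qed.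

Lemma coinv_inv p : inv p -> constant_term p = 0 -> coinv p.
Proof.
move=> Ip p0; exists [:: (p, 1)]; rewrite big_seq1 mulr1; split=> // u.
by rewrite inE => /eqP->.
Qed.

Lemma coinv_sub p A : (forall f, inv f -> inv (sub A f)) ->
  coinv p -> coinv (sub A p).
Proof.
move=> IA [s [Is ->]]; rewrite raddf_sum /=.
exists [seq (sub A u.1, sub A u.2) | u <- s]; split.
  move=> u /mapP[v /Is [Iv v0] ->] /=; split; first exact: IA.
  by rewrite constant_term_sub.
by rewrite big_map; apply: eq_bigr => u _; rewrite subM.
Qed.

Lemma coinv_subG g p : g \in G -> coinv p -> coinv (sub (rG g) p).
Proof. by move=> Gg; apply: coinv_sub => f If; rewrite If. Qed.

Lemma constant_term_coinv p : coinv p -> constant_term p = 0.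
Proof.
case=> s [Is ->]; rewrite /constant_term raddf_sum /= big_seq big1 // => u /Is[_ u0].
by rewrite -/(constant_term _) constant_termM u0 mul0r.
Qed.

(** The twisted Leibniz rule makes D linear over the invariants, which D kills. *)
Lemma coinv_demazure (D : mp -> mp) g : g \in G ->
  {morph D : p q / p + q} -> (forall p q, D (p * q) = p * D q + D p * sub (rG g) q) ->
  (forall p, sub (rG g) p = p -> D p = 0) -> forall p, coinv p -> coinv (D p).
Proof.
move=> Gg DD DM DI p [s [Is ->]].
have D0 : D 0 = 0 by apply: (addrI (D 0)); rewrite -DD !addr0.
rewrite (big_morph D DD D0) big_seq; apply: coinv_sum => u /Is[Iu u0].
rewrite DM (DI u.1) ?Iu // mul0r addr0.
by apply: coinvMr; apply: coinv_inv.
Qed.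

(* The monic polynomial prod_g (T - g X_i) kills X_i and has invariant coefficients. *)
Lemma coinv_expX i : coinv ('X_i ^+ #|G|).
Proof.
pose Q : {poly mp} := \prod_(g <- enum G) ('X - (sub (rG g) 'X_i)%:P).
have sQ : size Q = #|G|.+1 by rewrite size_prod_XsubC -cardE.
have Q_X : Q.['X_i] = 0.
  rewrite /Q (bigD1_seq 1%g) ?mem_enum ?enum_uniq //= repr_mx1 sub1.
  by rewrite hornerM hornerXsubC subrr mul0r.
have invQ j : inv Q`_j.
  move=> h Gh; rewrite -coef_map; suff -> : map_poly (sub (rG h)) Q = Q by [].
  rewrite rmorph_prod /= /Q !big_enum /= [RHS](reindex_inj (mulgI h)) /=.
  apply: eq_big => [g|g Gg]; first by rewrite groupMl.
  by rewrite rmorphB /= map_polyX map_polyC /= sub_mul repr_mxM.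
have Q0 j : (j < #|G|)%N -> constant_term Q`_j = 0.
  move=> jG; rewrite /constant_term -coef_map rmorph_prod /=.
  under eq_bigr do rewrite rmorphB /= map_polyX map_polyC /= -/(constant_term _)
    constant_term_sub -lin_delta constant_term_lin polyC0 subr0.
  rewrite big_enum prodr_const coefXn.
  by rewrite (ltn_eqF jG).
have Qtop : Q`_#|G| = 1.
  by have := monic_prod_XsubC (enum G) predT (fun g => sub (rG g) 'X_i); rewrite monicE lead_coefE -/Q sQ => /eqP.
move: Q_X; rewrite horner_coef sQ big_ord_recr /= Qtop mul1r => /eqP.
rewrite addrC addr_eq0 => /eqP->; apply/coinvN/coinv_sum => j _.
by apply/coinvMr/coinv_inv; [apply: invQ|apply: Q0].
Qed.

(** By the pigeonhole principle a monomial of degree above n |G| contains some variable to the power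
    |G|, and [coinv_expX] applies. All nilpotency bounds below come from this one. *)
Lemma coinv_order p : order_ge (n * #|G|).+1 p -> coinv p.
Proof.
move=> op; rewrite [p]mpolyE; apply: coinv_sum => m _.
have [mk|km] := ltnP (mdeg m) (n * #|G|).+1; first by rewrite op // scale0r; apply: coinv0.
apply: coinvZ; have [i Gmi] : exists i, (#|G| <= m i)%N.
  apply/existsP; apply: contraLR km; rewrite negb_exists -leqNgt => /forallP mi.
  rewrite mdegE -[X in (X * _)%N]card_ord -sum_nat_const leq_sum // => i _.
  by apply: ltnW; rewrite ltnNge; apply: mi.
have -> : m = (U_(i) *+ #|G| + (m - U_(i) *+ #|G|))%MM.
  rewrite addmC submK //; apply/mnm_lepP => j; rewrite mulmnE mnm1E.
  by case: eqP => [<-|_]; rewrite ?mul1n ?mul0n.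
by rewrite mpolyXD; apply: coinvMr; rewrite -mpolyXn; apply: coinv_expX.
Qed.

End Coinvariants.

(** * The Cherednik relations in an arbitrary ring *)

Section CherednikOps.
Variables (C : fieldType) (gT : finGroupType) (G : {group gT}) (n : nat).
Variable rG : mx_representation C G n.
Hypothesis C0 : [pchar C] =i pred0.
Local Notation mp := (mpoly n C).

(* Scalars are the EX a%:MP; the linear forms x of h* and y of h are EX (lin x) *)
(* and EY (lin y^T).                                                           *)
Record cherednik_ops (H : pzRingType) (c : gT -> C) (W : gT -> H)
    (EX EY : mp -> H) : Prop := CherednikOps {
  co_XD : {morph EX : p q / p + q};
  co_XM : {morph EX : p q / p * q};
  co_X1 : EX 1 = 1;
  co_YD : {morph EY : p q / p + q};
  co_YM : {morph EY : p q / p * q};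
  co_YC : forall a, EY a%:MP = EX a%:MP;
  co_sC : forall a h, EX a%:MP * h = h * EX a%:MP;
  co_W1 : W 1%g = 1;
  co_WM : {in G &, forall g h, W (g * h)%g = W g * W h};
  co_WX : forall g x, g \in G -> W g * EX (lin x) = EX (lin (rG g *m x)) * W g;
  co_WY : forall g x, g \in G ->
    W g * EY (lin x) = EY (lin (dual_repr rG g *m x)) * W g;
  co_YX : forall (y : 'rV_n) x, EY (lin y^T) * EX (lin x) - EX (lin x) * EY (lin y^T)
    = - \sum_(s in reflections rG) EX (c s * pairing y (root_mx rG s *m x))%:MP * W s
}.

Section Ops.
Variables (H : pzRingType) (c : gT -> C) (W : gT -> H) (EX EY : mp -> H).
Hypothesis ops : cherednik_ops c W EX EY.
Local Notation sc a := (EX a%:MP).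

Let XD := co_XD ops.
Let XM := co_XM ops.
Let YD := co_YD ops.
Let YM := co_YM ops.

Lemma co_X0 : EX 0 = 0.
Proof. by apply: (addrI (EX 0)); rewrite -XD !addr0. Qed.
Lemma co_Y0 : EY 0 = 0.
Proof. by apply: (addrI (EY 0)); rewrite -YD !addr0. Qed.
Lemma co_Y1 : EY 1 = 1.
Proof. by rewrite -mpolyC1 (co_YC ops) mpolyC1 (co_X1 ops). Qed.
Lemma co_XN p : EX (- p) = - EX p.
Proof. by apply/eqP; rewrite -addr_eq0 -XD addNr co_X0. Qed.
Lemma co_YN p : EY (- p) = - EY p.
Proof. by apply/eqP; rewrite -addr_eq0 -YD addNr co_Y0. Qed.

Lemma co_Xsum (I : Type) (r : seq I) (P : pred I) (F : I -> mp) :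
  EX (\sum_(i <- r | P i) F i) = \sum_(i <- r | P i) EX (F i).
Proof. exact: (big_morph _ XD co_X0). Qed.
Lemma co_Ysum (I : Type) (r : seq I) (P : pred I) (F : I -> mp) :
  EY (\sum_(i <- r | P i) F i) = \sum_(i <- r | P i) EY (F i).
Proof. exact: (big_morph _ YD co_Y0). Qed.

Lemma co_XZ a p : EX (a *: p) = sc a * EX p.
Proof. by rewrite -mul_mpolyC XM. Qed.

Lemma co_WXp g p : g \in G -> W g * EX p = EX (sub (rG g) p) * W g.
Proof.
move=> Gg; elim/mpoly_ring_ind: p => [a|i|p q Ep Eq|p q Ep Eq].
- by rewrite subC (co_sC ops).
- by rewrite -lin_delta sub_lin (co_WX ops).
- by rewrite subD !XD mulrDl mulrDr Ep Eq.
by rewrite subM !XM mulrA Ep -!mulrA Eq.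
Qed.

Lemma co_WYp g p : g \in G -> W g * EY p = EY (sub (dual_repr rG g) p) * W g.
Proof.
move=> Gg; elim/mpoly_ring_ind: p => [a|i|p q Ep Eq|p q Ep Eq].
- by rewrite subC (co_YC ops) (co_sC ops).
- by rewrite -lin_delta sub_lin (co_WY ops).
- by rewrite subD !YD mulrDl mulrDr Ep Eq.
by rewrite subM !YM mulrA Ep -!mulrA Eq.
Qed.

Section Demazure.
Variable Del : gT -> 'rV[C]_n -> mp -> mp.
Hypothesis DelP : forall s y, s \in reflections rG ->
  [/\ {morph Del s y : p q / p + q},
      forall p q, Del s y (p * q) = p * Del s y q + Del s y p * sub (rG s) q,
      forall x, Del s y (lin x) = (pairing y (root_mx rG s *m x))%:MP,
      forall p, sub (rG s) p = p -> Del s y p = 0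
    & forall a y' p, Del s (a *: y + y') p = a *: Del s y p + Del s y' p].

(** Both sides are twisted derivations in p, so the relation on linear forms propagates to products.
    Moving [W s] to the right of [EX q] produces the twist [sub (rG s) q] of the Leibniz rule. *)
Lemma co_YXp y p : EY (lin y^T) * EX p = EX p * EY (lin y^T)
  - \sum_(s in reflections rG) EX (c s *: Del s y p) * W s.
Proof.
elim/mpoly_ring_ind: p => [a|i|p q Ep Eq|p q Ep Eq].
- rewrite big1 ?subr0 => [|s Rs]; first by rewrite (co_sC ops).
  by have [_ _ _ DI _] := DelP y Rs; rewrite DI ?subC // scaler0 co_X0 mul0r.
- rewrite -lin_delta; apply/eqP; rewrite addrC -subr_eq (co_YX ops); apply/eqP.
  congr (- _); apply: eq_bigr => s Rs; have [_ _ -> _ _] := DelP y Rs.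
  by rewrite -mul_mpolyC -mpolyCM.
- rewrite !XD mulrDl mulrDr Ep Eq addrACA -opprD -big_split /=.
  congr (_ - _); apply: eq_bigr => s Rs; have [DD _ _ _ _] := DelP y Rs.
  by rewrite DD scalerDr XD mulrDl.
rewrite !XM mulrA Ep mulrBl -mulrA Eq mulrBr -!mulrA -addrA -opprD; congr (_ - _).
rewrite mulr_sumr mulr_suml -big_split /=; apply: eq_bigr => s Rs.
have [_ DM _ _ _] := DelP y Rs; rewrite DM scalerDr XD mulrDl; congr (_ + _).
  by rewrite mulrA -XM scalerAr.
by rewrite -mulrA co_WXp ?(reflections_in Rs) // mulrA -XM scalerAl.
Qed.

End Demazure.

(** A list stands for an element of C[h] (x) CG (x) C[h*]. The expression of an element of H in this
    form is not unique, so lists are kept and statements about them are compared. *)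
Definition tri (t : seq (mp * gT * mp)) : H :=
  \sum_(u <- t) EX u.1.1 * W u.1.2 * EY u.2.

Definition tri_in (t : seq (mp * gT * mp)) : bool := all (fun u => u.1.2 \in G) t.

Definition triangular (h : H) : Prop := exists2 t, tri_in t & h = tri t.

Lemma triangular0 : triangular 0.
Proof. by exists [::]; rewrite // /tri big_nil. Qed.

Lemma triangularD a b : triangular a -> triangular b -> triangular (a + b).
Proof.
move=> [s Gs ->] [t Gt ->]; exists (s ++ t); first by rewrite /tri_in all_cat; apply/andP.
by rewrite /tri big_cat.
Qed.

Lemma triangular_sum (I : Type) (r : seq I) (P : pred I) (F : I -> H) :
  (forall i, P i -> triangular (F i)) -> triangular (\sum_(i <- r | P i) F i).
Proof.
by move=> tF; apply: (big_ind triangular) => //; [exact: triangular0|exact: triangularD].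
Qed.

Lemma triangular_term p g q : g \in G -> triangular (EX p * W g * EY q).
Proof. by move=> Gg; exists [:: (p, g, q)]; rewrite /tri_in /= ?Gg // /tri big_seq1. Qed.

Lemma triangular_ind (P : H -> Prop) : P 0 -> (forall a b, P a -> P b -> P (a + b)) ->
  (forall p g q, g \in G -> P (EX p * W g * EY q)) -> forall h, triangular h -> P h.
Proof.
move=> P0 PD PT h [t /allP Gt ->]; rewrite /tri big_seq.
by apply: (big_ind P) => // u /Gt; apply: PT.
Qed.

Lemma triangularMX p h : triangular h -> triangular (EX p * h).
Proof.
move: h; apply: triangular_ind; first by rewrite mulr0; apply: triangular0.
  by move=> a b; rewrite mulrDr; apply: triangularD.
by move=> q g r Gg; rewrite !mulrA -XM; apply: triangular_term.
Qed.

Lemma triangularN h : triangular h -> triangular (- h).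
Proof.
by move=> th; rewrite -mulN1r -(co_X1 ops) -co_XN; apply: triangularMX.
Qed.

Lemma triangularMW g h : g \in G -> triangular h -> triangular (W g * h).
Proof.
move=> Gg; move: h; apply: triangular_ind; first by rewrite mulr0; apply: triangular0.
  by move=> a b; rewrite mulrDr; apply: triangularD.
move=> q h r Gh; rewrite !mulrA co_WXp // -(mulrA _ (W g)) -(co_WM ops) //.
by apply: triangular_term; rewrite groupM.
Qed.

(** Straightening: a linear form in Y crosses [EX p] at the cost of terms in which a divided
    difference of p is followed by a reflection. The form itself is then moved past [W g] and
    absorbed on the right. *)
Lemma triangularMY q h : triangular h -> triangular (EY q * h).
Proof.
have [Del DelP] := demazure_exists rG C0.
elim/mpoly_ring_ind: q h => [a|i|p q IHp IHq|p q IHp IHq] h th.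
- by rewrite (co_YC ops); apply: triangularMX.
- move: h th; apply: triangular_ind; first by rewrite mulr0; apply: triangular0.
    by move=> a b; rewrite mulrDr; apply: triangularD.
  move=> p g q Gg; rewrite !mulrA -lin_delta -[delta_mx i 0]trmxK (co_YXp DelP).
  rewrite mulrBl mulrBl; apply: triangularD.
    rewrite -!mulrA; apply: triangularMX; rewrite trmxK mulrA.
    have -> : EY (lin (delta_mx i 0)) * W g
        = W g * EY (lin (dual_repr rG g^-1%g *m delta_mx i 0)).
      by rewrite (co_WY ops) // mulmxA -repr_mxM ?groupV // mulgV repr_mx1 mul1mx.
    rewrite -mulrA -YM -[W g]mul1r -(co_X1 ops); exact: triangular_term.
  apply: triangularN; rewrite 2!mulr_suml; apply: triangular_sum => s Rs.
  rewrite -!mulrA; apply: triangularMX; apply: triangularMW; first exact: reflections_in Rs.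
  by rewrite -[W g]mul1r -(co_X1 ops); apply: triangular_term.
- by rewrite YD mulrDl; apply: triangularD; [apply: IHp|apply: IHq].
by rewrite YM -mulrA; apply: IHp; apply: IHq.
Qed.

Lemma triangular1 : triangular 1.
Proof.
have -> : 1 = EX 1 * W 1%g * EY 1 by rewrite (co_X1 ops) co_Y1 (co_W1 ops) !mulr1.
exact: triangular_term.
Qed.

Lemma triangularM a b : triangular a -> triangular b -> triangular (a * b).
Proof.
move=> ta tb; move: a ta; apply: triangular_ind.
- by rewrite mul0r; apply: triangular0.
- by move=> a a'; rewrite mulrDl; apply: triangularD.
move=> p g q Gg; rewrite -!mulrA.
by apply/triangularMX/triangularMW/triangularMY.
Qed.

Lemma triangularX p : triangular (EX p).
Proof. by rewrite -[EX p]mulr1; apply/triangularMX/triangular1. Qed.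
Lemma triangularY p : triangular (EY p).
Proof. by rewrite -[EY p]mulr1; apply/triangularMY/triangular1. Qed.
(** The divided differences kill an invariant, so the correction terms of [co_YXp] vanish. This is
    the centrality of invariants. *)
Lemma inv_commY f q : inv rG f -> EX f * EY q = EY q * EX f.
Proof.
move=> If; have [Del DelP] := demazure_exists rG C0.
elim/mpoly_ring_ind: q => [a|i|p q IHp IHq|p q IHp IHq].
- by rewrite (co_YC ops) (co_sC ops).
- rewrite -lin_delta -[delta_mx i 0]trmxK (co_YXp DelP) big1 ?subr0 // => s Rs.
  have [_ _ _ DI _] := DelP s (delta_mx i 0)^T Rs.
  by rewrite DI ?If ?(reflections_in Rs) // scaler0 co_X0 mul0r.
- by rewrite YD mulrDl mulrDr IHp IHq.
by rewrite YM mulrA IHp -!mulrA IHq.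
Qed.

Lemma inv_commX f p : EX f * EX p = EX p * EX f.
Proof. by rewrite -!XM mulrC. Qed.

Lemma inv_comm f h : inv rG f -> triangular h -> EX f * h = h * EX f.
Proof.
move=> If; move: h; apply: triangular_ind; first by rewrite mul0r mulr0.
  by move=> a b; rewrite mulrDl mulrDr => -> ->.
move=> p g q Gg; have Wf : W g * EX f = EX f * W g by rewrite co_WXp ?If.
by rewrite -!mulrA -inv_commY // (mulrA (W g)) Wf !mulrA inv_commX.
Qed.

End Ops.

Lemma dual_reflections : reflections (dual_repr rG) = reflections rG.
Proof.
apply/setP => s; rewrite !inE; case Gs: (s \in G) => //=; congr (_.+1 == _).
rewrite !mxrank_ker; congr (_ - _)%N.
have -> : 1%:M - dual_repr rG s^-1%g = (1%:M - rG s)^T.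
  by apply/matrixP => i j; rewrite /= /dual_mx invgK !mxE eq_sym.
rewrite mxrank_tr.
have -> : 1%:M - rG s = rG s *m - (1%:M - rG s^-1%g).
  by rewrite opprB mulmxBr mulmx1 -repr_mxM ?groupV // mulgV repr_mx1.
by rewrite eqmxMfull ?row_full_unit ?repr_mx_unit // eqmx_opp.
Qed.

Lemma dual_root_mx s : s \in reflections rG ->
  root_mx (dual_repr rG) s = (root_mx rG s)^T.
Proof.
move=> Rs; have [k [k' [a [b [[k0 k'0 a0 rE] [rGs rGs' ab2]]]]]] := reflection_factor C0 Rs.
rewrite rE /root_mx.
have -> : dual_repr rG s - 1%:M = k' *: (a *m b)^T.
  rewrite /= /dual_mx rGs'; apply/matrixP => i j.
  rewrite !mxE eq_sym. by rewrite addrAC subrr add0r.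
rewrite mxtraceZ mxtrace_tr mxtrace_mulC [b *m a]mx11_scalar mxtrace_scalar.
rewrite -[(b *m a) 0 0]/(pairing b a) ab2 mulr1n scalerA.
rewrite (_ : _ * k' = 1) ?scale1r //; field.
by rewrite (natf_neq0 C0 1) k'0.
Qed.

End CherednikOps.

(** Exchanging h with its dual reverses the commutator, whence the sign of c, and transposes the
    root matrices. Each statement about X thus yields one about Y. *)
Lemma dual_ops (C : fieldType) (gT : finGroupType) (G : {group gT}) (n : nat)
    (rG : mx_representation C G n) (H : pzRingType) c W (EX EY : mpoly n C -> H) :
  [pchar C] =i pred0 -> cherednik_ops rG c W EX EY ->
  cherednik_ops (dual_repr rG) (fun s => - c s) W EY EX.
Proof.
move=> C0 ops; have [XD XM X1 YD YM YC sC W1 WM WX WY YX] := ops.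
split=> //.
- by rewrite -mpolyC1 YC mpolyC1.
- by move=> a h; rewrite YC sC.
- by move=> g x Gg; rewrite WX //= /dual_mx /= /dual_mx invgK trmxK.
move=> y x; have := YX x^T y^T; rewrite trmxK => E.
rewrite -[LHS]opprB E dual_reflections //; congr (- _).
rewrite -sumrN; apply: eq_bigr => s Rs.
rewrite YC dual_root_mx // mulNr mpolyCN (co_XN ops) mulNr.
congr (- (EX (_ * _)%:MP * _)).
rewrite /pairing; set z := x^T *m _.
suff -> : y *m ((root_mx rG s)^T *m x) = z^T by rewrite [RHS]mxE.
by rewrite /z !trmx_mul !trmxK -mulmxA.
Qed.

(** * Universal property of the presented algebra *)

Section RingMaps.
Variables (A B : pzRingType) (f : A -> B).
Hypothesis fD : {morph f : a b / a + b}.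
Hypothesis fM : {morph f : a b / a * b}.

Lemma rmap0 : f 0 = 0.
Proof. by apply: (addrI (f 0)); rewrite -fD !addr0. Qed.
Lemma rmapN a : f (- a) = - f a.
Proof. by apply/eqP; rewrite -addr_eq0 -fD addNr rmap0. Qed.
Lemma rmapB a b : f (a - b) = f a - f b. Proof. by rewrite fD rmapN. Qed.
Lemma rmap_sum (I : Type) (r : seq I) (P : pred I) (F : I -> A) :
  f (\sum_(i <- r | P i) F i) = \sum_(i <- r | P i) f (F i).
Proof. exact: (big_morph _ fD rmap0). Qed.
Lemma rmap_eq a b : f (a - b) = 0 -> f a = f b.
Proof. by rewrite rmapB => /eqP; rewrite subr_eq0 => /eqP. Qed.

End RingMaps.

Section LalgMaps.
Variables (C : nzRingType) (A : lalgType C) (B : pzRingType) (f : A -> B).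
Hypothesis fD : {morph f : a b / a + b}.
Hypothesis fM : {morph f : a b / a * b}.

Lemma rmapZ a h : f (a *: h) = f a%:A * f h.
Proof. by rewrite -fM -scalerAl mul1r. Qed.
Lemma rmap_lin u a v w : f (u - (a *: v + w)) = 0 -> f u = f a%:A * f v + f w.
Proof. by move/(rmap_eq fD); rewrite fD rmapZ. Qed.
Lemma rmap_mul u v w : f (u - v * w) = 0 -> f u = f v * f w.
Proof. by move/(rmap_eq fD); rewrite fM. Qed.
Lemma rmap_mul2 s u v w : f (s * u - v * w) = 0 -> f s * f u = f v * f w.
Proof. by move/(rmap_eq fD); rewrite !fM. Qed.
Lemma rmap_comm s u v w (I : finType) (P : pred I) (F : I -> C) (g : I -> A) :
  f ((s * u - v * w) - (- \sum_(i | P i) F i *: g i)) = 0 ->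
  f s * f u - f v * f w = - \sum_(i | P i) f (F i)%:A * f (g i).
Proof.
move/(rmap_eq fD); rewrite (rmapB fD) !fM (rmapN fD) (rmap_sum fD) => ->.
by congr (- _); apply: eq_bigr => i _; rewrite rmapZ.
Qed.

End LalgMaps.

Section Evaluation.
Variables (C : fieldType) (A : lalgType C) (B : pzRingType) (f : A -> B).
Hypothesis fD : {morph f : a b / a + b}.
Hypothesis fM : {morph f : a b / a * b}.
Hypothesis f1 : f 1 = 1.
Hypothesis fC : forall a b, f a%:A * b = b * f a%:A.
Variables (n : nat) (h : 'I_n -> A).
Hypothesis hC : forall i j, f (h i) * f (h j) = f (h j) * f (h i).

Definition evaluation (p : mpoly n C) : A := mmap (fun a => a%:A) h p.
Local Notation E := (fun p => f (evaluation p)).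

Let evE p : evaluation p = mmap (GRing.in_alg A) h p. Proof. by []. Qed.

Lemma evaluationD : {morph E : p q / p + q}.
Proof. by move=> p q /=; rewrite !evE mmapD fD. Qed.

Lemma evaluationC a : E a%:MP = f a%:A.
Proof. by rewrite /= evE mmapC. Qed.

Lemma evaluationZ a p : E (a *: p) = f a%:A * E p.
Proof. by rewrite /= !evE mmapZ fM. Qed.

Definition mon_ev (m : 'X_{1..n}) : B := \prod_(i < n) f (h i) ^+ m i.

Let fX u k : f (u ^+ k) = f u ^+ k.
Proof. by elim: k => [|k IH]; rewrite ?expr0 // !exprS fM IH. Qed.

Lemma evaluationX m : E 'X_[m] = mon_ev m.
Proof.
rewrite /= evE mmapX /mmap1 /mon_ev (big_morph f fM f1).
by apply: eq_bigr => i _; rewrite fX.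
Qed.

Lemma evaluationXU i : E 'X_i = f (h i).
Proof. by rewrite /= evE mmapX mmap1U. Qed.

Lemma mon_evM m1 m2 : mon_ev (m1 + m2)%MM = mon_ev m1 * mon_ev m2.
Proof.
have comm i m k (r : seq 'I_n) :
    GRing.comm (f (h i) ^+ k) (\prod_(j <- r) f (h j) ^+ (m : 'X_{1..n}) j).
  apply: commr_prod => j _; apply: commrX; apply/commr_sym/commrX.
  exact: hC.
rewrite /mon_ev; elim: (index_enum _) => [|i r IH]; first by rewrite !big_nil mulr1.
rewrite !big_cons IH mnmDE exprD -!mulrA; congr (_ * _).
by rewrite mulrA comm -mulrA.
Qed.

(** The values [h i] lie in a noncommutative algebra and commute only after f is applied, so
    multiplicativity holds for the composite with f and is proved on monomials. *)
Lemma evaluationM : {morph E : p q / p * q}.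
Proof.
move=> p q; elim/mpolyind: p => [|a m p _ _ IH].
  by rewrite mul0r evE mmap0 rmap0 ?mul0r.
rewrite mulrDl !evaluationD mulrDl IH; congr (_ + _).
rewrite -scalerAl !evaluationZ -mulrA; congr (_ * _); rewrite evaluationX.
elim/mpolyind: q {IH} => [|b m' q _ _ IH].
  by rewrite mulr0 evE mmap0 rmap0 ?mulr0.
rewrite mulrDr !evaluationD mulrDr IH; congr (_ + _).
by rewrite -scalerAr !evaluationZ !mulrA -fC -mulrA -mpolyXD !evaluationX mon_evM.
Qed.

End Evaluation.

Lemma subg_one (gT : finGroupType) (G : {group gT}) : subg G 1%g = 1%g.
Proof. by apply: val_inj; rewrite /= subgK ?group1. Qed.

Lemma subg_mulG (gT : finGroupType) (G : {group gT}) :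
  {in G &, {morph subg G : g h / (g * h)%g}}.
Proof. by move=> g h Gg Gh; apply: val_inj; rewrite /= !subgK ?groupM. Qed.

Lemma root_pairs_exist (C : fieldType) (gT : finGroupType) (G : {group gT})
    (n : nat) (rG : mx_representation C G n) : [pchar C] =i pred0 ->
  exists al : gT -> 'cV[C]_n * 'rV[C]_n, forall s,
    s \in reflections rG -> root_pair rG s (al s).1 (al s).2.
Proof.
move=> C0; have H s : exists u : 'cV[C]_n * 'rV[C]_n,
    s \in reflections rG -> root_pair rG s u.1 u.2.
  have [Rs|nRs] := boolP (s \in reflections rG); last by exists (0, 0).
  by have [a [b rab]] := root_pair_exists C0 Rs; exists (a, b).
by have [al alP] := boolp.choice H; exists al.
Qed.

Lemma sum_subg (gT : finGroupType) (G : {group gT}) (B : zmodType)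
    (F : gT -> B) (R : {set gT}) : R \subset G ->
  \sum_(s : subg_of G | sgval s \in R) F (sgval s) = \sum_(s in R) F s.
Proof.
move=> RG; rewrite [RHS](reindex (@sgval _ G)) //.
exists (subg G) => s; first by rewrite sgvalK.
by move=> /(subsetP RG) Gs; rewrite subgK.
Qed.

Section Presentation.
Variables (C : fieldType) (gT : finGroupType) (G : {group gT}) (n : nat).
Variable rG : mx_representation C G n.
Hypothesis C0 : [pchar C] =i pred0.
Local Notation mp := (mpoly n C).
Local Notation A := (ch_free C G n).
Variable c : gT -> C.

Section FromFree.
Variables (B : pzRingType) (f : A -> B).
Hypothesis fD : {morph f : a b / a + b}.
Hypothesis fM : {morph f : a b / a * b}.
Hypothesis f1 : f 1 = 1.
Hypothesis fC : forall a b, f a%:A * b = b * f a%:A.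
Hypothesis fS : forall r, smash_rel rG r -> f r = 0.
Hypothesis fR : forall r, cherednik_rel rG c r -> f r = 0.

Lemma free_X_lin a x x' : f (Defs.gX G (a *: x + x')) = f a%:A * f (Defs.gX G x) + f (Defs.gX G x').
Proof. by apply: (rmap_lin fD fM); apply: fS; apply: smash_linX. Qed.

Lemma free_Y_lin a x x' : f (Defs.gY G (a *: x + x')) = f a%:A * f (Defs.gY G x) + f (Defs.gY G x').
Proof. by apply: (rmap_lin fD fM); apply: fS; apply: smash_linY. Qed.

Lemma free_XX x x' : f (Defs.gX G x) * f (Defs.gX G x') = f (Defs.gX G x') * f (Defs.gX G x).
Proof. by apply: (rmap_mul2 fD fM); apply: fR; apply: ch_XX. Qed.

Lemma free_YY x x' : f (Defs.gY G x) * f (Defs.gY G x') = f (Defs.gY G x') * f (Defs.gY G x).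
Proof. by apply: (rmap_mul2 fD fM); apply: fR; apply: ch_YY. Qed.

Lemma free_EX_lin x : f (eval_X G (lin x)) = f (Defs.gX G x).
Proof.
have ED := evaluationD fD (fun i : 'I_n => Defs.gX G (delta_mx i 0)).
have EZ := evaluationZ fM (fun i : 'I_n => Defs.gX G (delta_mx i 0)).
have EX := evaluationXU f (fun i : 'I_n => Defs.gX G (delta_mx i 0)).
have fX0 : f (Defs.gX G 0) = 0.
  by have := free_X_lin 1 0 0; rewrite scale1r addr0 scale1r f1 mul1r => /eqP;
     rewrite -subr_eq subrr => /eqP.
have E0 : f (evaluation (fun i : 'I_n => Defs.gX G (delta_mx i 0)) 0) = 0.
  by apply: (addrI (f (evaluation (fun i => Defs.gX G (delta_mx i 0)) 0))); rewrite -ED !addr0.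
have {2}-> : x = \sum_i x i 0 *: (delta_mx i 0 : 'cV_n).
  by rewrite {1}[x]matrix_sum_delta; apply: eq_bigr => i _; rewrite big_ord1.
rewrite /lin; elim: (index_enum _) => [|i r IH]; first by rewrite !big_nil fX0; apply: E0.
rewrite !big_cons free_X_lin -IH; etransitivity; first exact: ED.
by congr (_ + _); etransitivity; first exact: EZ; rewrite EX.
Qed.

Lemma free_EY_lin x : f (eval_Y G (lin x)) = f (Defs.gY G x^T).
Proof.
have ED := evaluationD fD (fun i : 'I_n => Defs.gY G (delta_mx 0 i)).
have EZ := evaluationZ fM (fun i : 'I_n => Defs.gY G (delta_mx 0 i)).
have EX := evaluationXU f (fun i : 'I_n => Defs.gY G (delta_mx 0 i)).
have fX0 : f (Defs.gY G 0) = 0.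
  by have := free_Y_lin 1 0 0; rewrite scale1r addr0 scale1r f1 mul1r => /eqP;
     rewrite -subr_eq subrr => /eqP.
have E0 : f (evaluation (fun i : 'I_n => Defs.gY G (delta_mx 0 i)) 0) = 0.
  by apply: (addrI (f (evaluation (fun i => Defs.gY G (delta_mx 0 i)) 0))); rewrite -ED !addr0.
have -> : x^T = \sum_i x i 0 *: (delta_mx 0 i : 'rV_n).
  rewrite {1}[x^T]matrix_sum_delta big_ord1; apply: eq_bigr => i _.
  by rewrite mxE.
rewrite /lin; elim: (index_enum _) => [|i r IH]; first by rewrite !big_nil fX0; apply: E0.
rewrite !big_cons free_Y_lin -IH; etransitivity; first exact: ED.
by congr (_ + _); etransitivity; first exact: EZ; rewrite EX.
Qed.

Definition free_W (g : gT) : B := f (Defs.gW C n (subg G g)).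

Let reflections_sub : reflections rG \subset G.
Proof. by apply/subsetP => s /reflections_in. Qed.

Lemma free_ops :
  cherednik_ops rG c free_W (fun p => f (eval_X G p)) (fun q => f (eval_Y G q)).
Proof.
pose hX (i : 'I_n) := Defs.gX (C := C) G (delta_mx i 0 : 'cV_n).
pose hY (i : 'I_n) := Defs.gY (C := C) G (delta_mx 0 i : 'rV_n).
have EXC a : f (eval_X G a%:MP) = f a%:A by exact: (evaluationC f hX).
have f11 : f 1%:A = 1 by rewrite scale1r.
have EYC a : f (eval_Y G a%:MP) = f a%:A by exact: (evaluationC f hY).
split.
- exact: (evaluationD fD hX).
- by apply: (evaluationM fD fM f1 fC (h := hX)) => i j; apply: free_XX.
- have E1 := congr1 (fun p => f (eval_X G p)) (mpolyC1 n C).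
  exact: (etrans (esym E1) (etrans (EXC 1) f11)).
- exact: (evaluationD fD hY).
- by apply: (evaluationM fD fM f1 fC (h := hY)) => i j; apply: free_YY.
- move=> a; exact: (etrans (EYC a) (esym (EXC a))).
- move=> a b; have E := EXC a.
  exact: (etrans (congr1 (fun z => z * b) E) (etrans (fC a b) (congr1 (fun z => b * z) (esym E)))).
- have sub1 := subg_one G.
  have W1 := etrans (rmap_eq fD (fS (smash_one rG))) f1.
  exact: (etrans (congr1 (fun w => f (Defs.gW C n w)) sub1) W1).
- move=> g h Gg Gh.
  have subM := subg_mulG Gg Gh.
  have WM := rmap_mul fD fM (fS (smash_mul rG (subg G g) (subg G h))).
  exact: (etrans (congr1 (fun w => f (Defs.gW C n w)) subM) WM).
- move=> g x Gg; have R := rmap_mul2 fD fM (fS (smash_actX rG (subg G g) x)).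
  have E : act_dual rG (sgval (subg G g)) x = rG g *m x by rewrite subgK.
  rewrite E in R.
  exact: (etrans (congr1 (fun z => free_W g * z) (free_EX_lin x))
           (etrans R (congr1 (fun z => z * free_W g) (esym (free_EX_lin _))))).
- move=> g x Gg; have R := rmap_mul2 fD fM (fS (smash_actY rG (subg G g) x^T)).
  have E : act_h rG (sgval (subg G g)) x^T = (dual_repr rG g *m x)^T.
    by rewrite subgK // /act_h trmx_mul /= /dual_mx trmxK.
  rewrite E in R.
  exact: (etrans (congr1 (fun z => free_W g * z) (free_EY_lin x))
           (etrans R (congr1 (fun z => z * free_W g) (esym (free_EY_lin _))))).
move=> y x.
have [al alP] := root_pairs_exist rG C0.
have R := rmap_comm fD fM (fR (ch_YX c y x alP)).
have EY : f (eval_Y G (lin y^T)) = f (Defs.gY G y) by exact: (etrans (free_EY_lin _) (congr1 (fun z => f (Defs.gY G z)) (trmxK y))).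
have E : f (Defs.gY G y) * f (Defs.gX G x) - f (Defs.gX G x) * f (Defs.gY G y) =
    f (eval_Y G (lin y^T)) * f (eval_X G (lin x))
      - f (eval_X G (lin x)) * f (eval_Y G (lin y^T)).
  exact: (esym (f_equal2 (fun a b : B => a * b - b * a) EY (free_EX_lin x))).
have Ec (s : subg_of G) : sgval s \in reflections rG ->
    c (sgval s) * pairing y (al (sgval s)).1 * pairing (al (sgval s)).2 x
    = c (sgval s) * pairing y (root_mx rG (sgval s) *m x).
  move=> Rs; rewrite -mulrA; congr (_ * _); rewrite -(root_pair_mx C0 Rs (alP _ Rs)).
  rewrite /pairing -mulmxA mulmxA {2}[y *m _]mx11_scalar mul_scalar_mx.
  by rewrite [in RHS]mxE.
have E1 := sum_subg (fun s => f (eval_X G (c s * pairing y (root_mx rG s *m x))%:MP) * free_W s) reflections_sub.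
apply: (etrans (esym E) (etrans R (congr1 (fun z => - z) (etrans _ E1)))).
apply: eq_bigr => s Rs.
have E2 := etrans (congr1 (fun a : C => f a%:A) (Ec s Rs)) (esym (EXC _)).
have E3 := congr1 (fun w => f (Defs.gW C n w)) (esym (sgvalK s)).
exact: (f_equal2 *%R E2 E3).
Qed.

End FromFree.
End Presentation.

Section FreeScalars.
Variables (C : comNzRingType) (I : choiceType).
Local Notation A := {malg C[{fmonom I}]}.

Lemma malg_scalarC a (h : A) : a%:A * h = h * a%:A.
Proof.
rewrite malg_scalar !malgM_def fgmulUg fgmulgU; apply: eq_bigr => k _.
by rewrite mulrC mul1m mulm1.
Qed.
End FreeScalars.

Section LalgMapsConverse.
Variables (C : nzRingType) (A : lalgType C) (B : pzRingType) (f : A -> B).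
Hypothesis fD : {morph f : a b / a + b}.
Hypothesis fM : {morph f : a b / a * b}.

Lemma rmap_lin0 u a v w : f u = f a%:A * f v + f w -> f (u - (a *: v + w)) = 0.
Proof. by move=> E; rewrite (rmapB fD) E fD (rmapZ fM) subrr. Qed.
Lemma rmap_eq0 u v : f u = f v -> f (u - v) = 0.
Proof. by move=> E; rewrite (rmapB fD) E subrr. Qed.
Lemma rmap_mul0 u v w : f u = f v * f w -> f (u - v * w) = 0.
Proof. by move=> E; rewrite (rmapB fD) E fM subrr. Qed.
Lemma rmap_mul20 s u v w : f s * f u = f v * f w -> f (s * u - v * w) = 0.
Proof. by move=> E; rewrite (rmapB fD) !fM E subrr. Qed.
Lemma rmap_comm0 s u v w (I : finType) (P : pred I) (F : I -> C) (g : I -> A) :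
  f s * f u - f v * f w = - \sum_(i | P i) f (F i)%:A * f (g i) ->
  f ((s * u - v * w) - (- \sum_(i | P i) F i *: g i)) = 0.
Proof.
move=> E; rewrite (rmapB fD) (rmapB fD) !fM (rmapN fD) (rmap_sum fD) E.
apply/eqP; rewrite subr_eq0; apply/eqP.
by congr (- _); apply: eq_bigr => i _; exact: (esym (rmapZ fM _ _)).
Qed.

End LalgMapsConverse.

Lemma eval_unique (C : fieldType) (n : nat) (B : pzRingType) (E1 E2 : mpoly n C -> B) :
  {morph E1 : p q / p + q} -> {morph E1 : p q / p * q} ->
  {morph E2 : p q / p + q} -> {morph E2 : p q / p * q} ->
  (forall a, E1 a%:MP = E2 a%:MP) -> (forall x, E1 (lin x) = E2 (lin x)) -> E1 =1 E2.
Proof.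
move=> D1 M1 D2 M2 EC EX; apply: mpoly_ring_ind => // [i|p q Ep Eq|p q Ep Eq].
- by rewrite -lin_delta.
- by rewrite D1 D2 Ep Eq.
by rewrite M1 M2 Ep Eq.
Qed.

Section Universal.
Variables (C : fieldType) (gT : finGroupType) (G : {group gT}) (n : nat).
Variable rG : mx_representation C G n.
Hypothesis C0 : [pchar C] =i pred0.
Local Notation mp := (mpoly n C).
Local Notation A := (ch_free C G n).

Section Lift.
Variables (c : gT -> C) (B : pzRingType) (W : gT -> B) (EX EY : mp -> B).
Hypothesis ops : cherednik_ops rG c W EX EY.

Definition ops_gen (z : ch_gen C G n) : B :=
  match z with
  | inl (inl y) => EY (lin y^T)
  | inl (inr x) => EX (lin x)
  | inr w => W (sgval w)
  end.

Definition ops_lift : A -> B := free_lift (fun a => EX a%:MP) ops_gen.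

Let sD : {morph (fun a => EX a%:MP) : a b / a + b}.
Proof. by move=> a b; rewrite mpolyCD (co_XD ops). Qed.
Let sM : {morph (fun a => EX a%:MP) : a b / a * b}.
Proof. by move=> a b; rewrite mpolyCM (co_XM ops). Qed.
Let s1 : EX 1%:MP = 1. Proof. by rewrite mpolyC1 (co_X1 ops). Qed.

Lemma ops_liftD : {morph ops_lift : a b / a + b}.
Proof. exact: (free_liftD ops_gen sD). Qed.
Lemma ops_liftM : {morph ops_lift : a b / a * b}.
Proof. exact: (free_liftM ops_gen sD sM (co_sC ops)). Qed.
Lemma ops_lift1 : ops_lift 1 = 1.
Proof. exact: (free_lift1 ops_gen sD s1). Qed.
Lemma ops_lift_scalar a : ops_lift a%:A = EX a%:MP.
Proof. exact: (free_lift_scalar ops_gen sD). Qed.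
Lemma ops_lift_gen z : ops_lift (gen z) = ops_gen z.
Proof. exact: (free_lift_gen ops_gen sD s1). Qed.
Lemma ops_liftC a b : ops_lift a%:A * b = b * ops_lift a%:A.
Proof.
have E := ops_lift_scalar a.
exact: (etrans (congr1 (fun z => z * b) E)
  (etrans (co_sC ops a b) (congr1 (fun z => b * z) (esym E)))).
Qed.

Lemma ops_liftX x : ops_lift (Defs.gX G x) = EX (lin x).
Proof. exact: ops_lift_gen. Qed.
Lemma ops_liftY y : ops_lift (Defs.gY G y) = EY (lin y^T).
Proof. exact: ops_lift_gen. Qed.
Lemma ops_liftW w : ops_lift (Defs.gW C n w) = W (sgval w).
Proof. exact: ops_lift_gen. Qed.

Let linX a x x' : EX (lin (a *: x + x')) = EX a%:MP * EX (lin x) + EX (lin x').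
Proof. by rewrite linD (co_XD ops) linZ (co_XZ ops). Qed.

Let linY a (y y' : 'rV[C]_n) :
  EY (lin (a *: y + y')^T) = EX a%:MP * EY (lin y^T) + EY (lin y'^T).
Proof.
have -> : (a *: y + y')^T = a *: y^T + y'^T by apply/matrixP => i j; rewrite !mxE.
by rewrite linD (co_YD ops) linZ -mul_mpolyC (co_YM ops) (co_YC ops).
Qed.

Lemma ops_lift_smash r : smash_rel rG r -> ops_lift r = 0.
Proof.
case=> [a y y'|a x x'||w w'|w y|w x].
- apply: (rmap_lin0 ops_liftD ops_liftM).
  have E := f_equal2 (fun u v => EX a%:MP * u + v) (ops_liftY y) (ops_liftY y').
  have E2 := congr1 (fun u => u * ops_lift (Defs.gY G y) + ops_lift (Defs.gY G y')) (ops_lift_scalar a).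
  exact: (etrans (ops_liftY _) (etrans (linY a y y') (etrans (esym E) (esym E2)))).
- apply: (rmap_lin0 ops_liftD ops_liftM).
  have E := f_equal2 (fun u v => EX a%:MP * u + v) (ops_liftX x) (ops_liftX x').
  have E2 := congr1 (fun u => u * ops_lift (Defs.gX G x) + ops_lift (Defs.gX G x')) (ops_lift_scalar a).
  exact: (etrans (ops_liftX _) (etrans (linX a x x') (etrans (esym E) (esym E2)))).
- apply: (rmap_eq0 ops_liftD).
  have e1 : sgval (1%g : subg_of G) = 1%g by [].
  have E : W (sgval (1%g : subg_of G)) = 1 by rewrite e1 (co_W1 ops).
  exact: (etrans (ops_liftW _) (etrans E (esym ops_lift1))).
- apply: (rmap_mul0 ops_liftD ops_liftM).
  have E := co_WM ops (subgP w) (subgP w').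
  have e2 : sgval (w * w')%g = (sgval w * sgval w')%g by [].
  have E2 : W (sgval (w * w')%g) = W (sgval w) * W (sgval w') by rewrite e2 E.
  have E3 := f_equal2 (fun a b : B => a * b) (ops_liftW w) (ops_liftW w').
  exact: (etrans (ops_liftW _) (etrans E2 (esym E3))).
- apply: (rmap_mul20 ops_liftD ops_liftM).
  have E : W (sgval w) * EY (lin y^T) = EY (lin (act_h rG (sgval w) y)^T) * W (sgval w).
    by rewrite (co_WY ops) ?subgP // /act_h trmx_mul.
  exact: (etrans (f_equal2 (fun a b : B => a * b) (ops_liftW _) (ops_liftY _))
    (etrans E (esym (f_equal2 (fun a b : B => a * b) (ops_liftY _) (ops_liftW _))))).
apply: (rmap_mul20 ops_liftD ops_liftM).
have E := co_WX ops x (subgP w).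
exact: (etrans (f_equal2 (fun a b : B => a * b) (ops_liftW _) (ops_liftX _))
  (etrans E (esym (f_equal2 (fun a b : B => a * b) (ops_liftX _) (ops_liftW _))))).
Qed.

Lemma ops_lift_cherednik r : cherednik_rel rG c r -> ops_lift r = 0.
Proof.
case=> [x x'|y y'|y x al alv alP].
- apply: (rmap_mul20 ops_liftD ops_liftM).
  have E : EX (lin x) * EX (lin x') = EX (lin x') * EX (lin x).
    by rewrite -!(co_XM ops) mulrC.
  exact: (etrans (f_equal2 (fun a b : B => a * b) (ops_liftX _) (ops_liftX _))
    (etrans E (esym (f_equal2 (fun a b : B => a * b) (ops_liftX _) (ops_liftX _))))).
- apply: (rmap_mul20 ops_liftD ops_liftM).
  have E : EY (lin y^T) * EY (lin y'^T) = EY (lin y'^T) * EY (lin y^T).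
    by rewrite -!(co_YM ops) mulrC.
  exact: (etrans (f_equal2 (fun a b : B => a * b) (ops_liftY _) (ops_liftY _))
    (etrans E (esym (f_equal2 (fun a b : B => a * b) (ops_liftY _) (ops_liftY _))))).
apply: (rmap_comm0 ops_liftD ops_liftM).
have E := f_equal2 (fun a b : B => a * b - b * a) (ops_liftY y) (ops_liftX x).
apply: (etrans E); rewrite (co_YX ops).
have RG : reflections rG \subset G by apply/subsetP => s /reflections_in.
have E1 := sum_subg (fun s => EX (c s * pairing y (root_mx rG s *m x))%:MP * W s) RG.
apply: (congr1 (fun z => - z)); apply: (etrans (esym E1)); apply: eq_bigr => s Rs.
have Ec : c (sgval s) * pairing y (root_mx rG (sgval s) *m x)
    = c (sgval s) * pairing y (al (sgval s)) * pairing (alv (sgval s)) x.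
  rewrite -mulrA; congr (_ * _); rewrite -(root_pair_mx C0 Rs (alP _ Rs)).
  rewrite /pairing -mulmxA mulmxA {1}[y *m _]mx11_scalar mul_scalar_mx.
  by rewrite [in LHS]mxE.
rewrite Ec; exact: (esym (f_equal2 (fun a b : B => a * b) (ops_lift_scalar _) (ops_liftW _))).
Qed.

Lemma ops_lift_free_ops :
  cherednik_ops rG c (free_W ops_lift) (fun p => ops_lift (eval_X G p))
    (fun q => ops_lift (eval_Y G q)).
Proof.
exact: (free_ops C0 ops_liftD ops_liftM ops_lift1 ops_liftC ops_lift_smash ops_lift_cherednik).
Qed.

Lemma ops_lift_evalX p : ops_lift (eval_X G p) = EX p.
Proof.
have o := ops_lift_free_ops.
apply: (eval_unique (co_XD o) (co_XM o) (co_XD ops) (co_XM ops)) => [a|x].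
  have E := @evaluationC _ A B ops_lift n (fun i : 'I_n => Defs.gX G (delta_mx i 0)) a.
  exact: (etrans E (ops_lift_scalar a)).
exact: (etrans (free_EX_lin ops_liftD ops_liftM ops_lift1 ops_lift_smash x) (ops_liftX x)).
Qed.

Lemma ops_lift_evalY p : ops_lift (eval_Y G p) = EY p.
Proof.
have o := ops_lift_free_ops.
apply: (eval_unique (co_YD o) (co_YM o) (co_YD ops) (co_YM ops)) => [a|x].
  have E := @evaluationC _ A B ops_lift n (fun i : 'I_n => Defs.gY G (delta_mx 0 i)) a.
  exact: (etrans E (etrans (ops_lift_scalar a) (esym (co_YC ops a)))).
have E := etrans (free_EY_lin ops_liftD ops_liftM ops_lift1 ops_lift_smash x) (ops_liftY x^T).
exact: (etrans E (congr1 (fun z => EY (lin z)) (trmxK x))).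
Qed.

End Lift.
End Universal.

Lemma quot2_ideal (A : pzRingType) (S : A -> Prop) (D : ring_quot S -> Prop)
    (I : A -> Prop) a b : two_sided_ideal I -> (forall s, S s -> I s) ->
  (forall a, D (ring_proj S a) -> I a) ->
  ring_proj D (ring_proj S a) = ring_proj D (ring_proj S b) -> I (a - b).
Proof.
move=> idI SI DI; have [I0 IB IM] := idI.
have IN x : I x -> I (- x) by move=> Ix; rewrite -[- x]add0r; apply: IB.
have ID x y : I x -> I y -> I (x + y).
  by move=> Ix Iy; rewrite -[y]opprK; apply: IB => //; apply: IN.
have kerI x y : ring_proj S x = ring_proj S y -> I y -> I x.
  move/ring_projP/ideal_genP=> /(_ I idI SI) Ixy Iy.
  by rewrite -(subrK y x); apply: ID.
have pB x y : ring_proj S (x - y) = ring_proj S x - ring_proj S y.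
  exact: (rmapB (@ring_projD _ S)).
have p0 : ring_proj S 0 = 0 by exact: (rmap0 (@ring_projD _ S)).
move/ring_projP/ideal_genP=> /(_ (fun q => forall h, ring_proj S h = q -> I h)).
apply; last by rewrite pB.
  split=> [h|q r Iq Ir h|q x r Ix h].
  - by rewrite -p0 => /kerI; apply.
  - rewrite -[q]ring_projK -[r]ring_projK -pB => /kerI; apply.
    by apply: IB; [apply: Iq|apply: Ir]; exact: ring_projK.
  rewrite -[q]ring_projK -[r]ring_projK -[x]ring_projK -!ring_projM => /kerI; apply.
  by apply: IM; apply: Ix; rewrite !ring_projK.
by move=> q Dq h hq; apply: DI; rewrite hq.
Qed.

(** * The restricted algebra as a quotient of the free algebra *)

Section FreeTriangular.
Variables (C : fieldType) (gT : finGroupType) (G : {group gT}) (n : nat).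
Variable rG : mx_representation C G n.
Hypothesis C0 : [pchar C] =i pred0.
Variable c : gT -> C.
Local Notation mp := (mpoly n C).
Local Notation A := (ch_free C G n).

Section FreeMap.
Variables (B : pzRingType) (f : A -> B).
Hypothesis fD : {morph f : a b / a + b}.
Hypothesis fM : {morph f : a b / a * b}.
Hypothesis f1 : f 1 = 1.
Hypothesis fC : forall a b, f a%:A * b = b * f a%:A.
Hypothesis fS : forall r, smash_rel rG r -> f r = 0.
Hypothesis fR : forall r, cherednik_rel rG c r -> f r = 0.
Local Notation EX := (fun p => f (eval_X G p)).
Local Notation EY := (fun p => f (eval_Y G p)).
Let ops := free_ops C0 fD fM f1 fC fS fR.

Lemma free_scalarX a : f (eval_X G a%:MP) = f a%:A.
Proof. exact: (@evaluationC _ A B f n (fun i : 'I_n => Defs.gX G (delta_mx i 0)) a). Qed.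

Lemma free_triangular h : triangular G (free_W f) EX EY (f h).
Proof.
elim/free_ind: h => [|a b ta tb|a h th||z h th].
- have E := rmap0 fD; rewrite E; exact: triangular0.
- have E := fD a b; rewrite E; exact: triangularD.
- have E := rmapZ fM a h.
  have E2 := congr1 (fun z => z * f h) (esym (free_scalarX a)).
  rewrite E E2; exact: (triangularMX ops _ th).
- rewrite f1; exact: (triangular1 ops).
have E := fM (gen z) h; rewrite E.
case: z {E} => [[y|x]|w].
- have E := etrans (free_EY_lin fD fM f1 fS y^T) (congr1 (fun z => f (Defs.gY G z)) (trmxK y)).
  have E2 := congr1 (fun z => z * f h) E.
  exact: (eq_rect _ _ (triangularMY C0 ops _ th) _ E2).
- have E2 := congr1 (fun z => z * f h) (free_EX_lin fD fM f1 fS x).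
  exact: (eq_rect _ _ (triangularMX ops _ th) _ E2).
have E2 := congr1 (fun w => f (Defs.gW C n w) * f h) (sgvalK w).
exact: (eq_rect _ _ (triangularMW ops (subgP w) th) _ E2).
Qed.

Definition tri_free (t : seq (mp * gT * mp)) : A :=
  \sum_(u <- t) eval_X G u.1.1 * Defs.gW C n (subg G u.1.2) * eval_Y G u.2.

Lemma free_triE t : f (tri_free t) = tri (free_W f) EX EY t.
Proof.
have E := rmap_sum fD t predT (fun u : mp * gT * mp =>
  eval_X G u.1.1 * Defs.gW C n (subg G u.1.2) * eval_Y G u.2).
apply: (etrans E); apply: eq_bigr => u _.
exact: (etrans (fM _ _) (congr1 (fun z => z * f (eval_Y G u.2)) (fM _ _))).
Qed.

End FreeMap.

Lemma tri_congr (H : pzRingType) (W W' : gT -> H) (EX EX' EY EY' : mp -> H) t :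
  tri_in G t -> {in G, W =1 W'} -> EX =1 EX' -> EY =1 EY' ->
  tri W EX EY t = tri W' EX' EY' t.
Proof.
move=> /allP Gt eW eX eY; rewrite /tri !big_seq; apply: eq_bigr => u /Gt Gu.
by rewrite eW // eX eY.
Qed.

Lemma ops_lift_triE (B : pzRingType) W EX EY (ops : @cherednik_ops _ _ G _ rG B c W EX EY) t :
  tri_in G t -> ops_lift W EX EY (tri_free t) = tri W EX EY t.
Proof.
move=> Gt; have E := free_triE (ops_liftD ops) (ops_liftM ops) t.
apply: (etrans E); apply: tri_congr => // [g Gg|p|p].
- have E1 := ops_liftW ops (subg G g); have E2 : W (sgval (subg G g)) = W g by rewrite subgK.
  exact: (etrans E1 E2).
- exact: (ops_lift_evalX C0 ops).
exact: (ops_lift_evalY C0 ops).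
Qed.

Section Restricted.
Local Notation Hb := (restricted_cherednik rG c).

Definition to_hbar (a : A) : Hb := to_restricted rG c a.

Lemma to_hbarD : {morph to_hbar : a b / a + b}.
Proof.
move=> a b; have E := @ring_projD _ (fun a : A => smash_rel rG a \/ cherednik_rel rG c a) a b.
exact: (etrans (congr1 (@ring_proj _ (@D_plus _ _ _ _ rG c)) E) (ring_projD _ _ _)).
Qed.

Lemma to_hbarM : {morph to_hbar : a b / a * b}.
Proof.
move=> a b; have E := @ring_projM _ (fun a : A => smash_rel rG a \/ cherednik_rel rG c a) a b.
exact: (etrans (congr1 (@ring_proj _ (@D_plus _ _ _ _ rG c)) E) (ring_projM _ _ _)).
Qed.

Lemma to_hbar1 : to_hbar 1 = 1. Proof. by []. Qed.

Lemma to_hbar_surj q : exists a, to_hbar a = q.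
Proof.
exists (generic_quotient.repr (generic_quotient.repr q)).
have E := ring_projK (generic_quotient.repr q).
exact: (etrans (congr1 (@ring_proj _ (@D_plus _ _ _ _ rG c)) E) (ring_projK q)).
Qed.

Lemma to_hbarC a b : to_hbar a%:A * b = b * to_hbar a%:A.
Proof.
have [h <-] := to_hbar_surj b.
exact: (etrans (esym (to_hbarM _ _)) (etrans (congr1 to_hbar (malg_scalarC a h)) (to_hbarM _ _))).
Qed.

Lemma to_hbar_rel r : smash_rel rG r \/ cherednik_rel rG c r -> to_hbar r = 0.
Proof.
move=> Sr; have E := @ring_proj_rel _ (fun a : A => smash_rel rG a \/ cherednik_rel rG c a) r Sr.
exact: (etrans (congr1 (@ring_proj _ (@D_plus _ _ _ _ rG c)) E) (rmap0 (@ring_projD _ _))).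
Qed.

Definition hX (p : mp) : Hb := to_hbar (eval_X G p).
Definition hY (p : mp) : Hb := to_hbar (eval_Y G p).
Definition hW : gT -> Hb := free_W to_hbar.

Lemma to_hbar_smash r : smash_rel rG r -> to_hbar r = 0.
Proof. by move=> Sr; apply: to_hbar_rel; left. Qed.
Lemma to_hbar_cherednik r : cherednik_rel rG c r -> to_hbar r = 0.
Proof. by move=> Sr; apply: to_hbar_rel; right. Qed.

Lemma hbar_ops : cherednik_ops rG c hW hX hY.
Proof.
exact: (free_ops C0 to_hbarD to_hbarM to_hbar1 to_hbarC to_hbar_smash to_hbar_cherednik).
Qed.

Lemma hbar_triangular q : triangular G hW hX hY q.
Proof.
have [h <-] := to_hbar_surj q.
exact: (free_triangular to_hbarD to_hbarM to_hbar1 to_hbarC to_hbar_smash to_hbar_cherednik h).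
Qed.

Definition D_seq (s : seq (mp * mp)) : Prop :=
  (forall u, u \in s -> inv rG u.1 /\ inv (dual_repr rG) u.2) /\
  \sum_(u <- s) constant_term u.1 * constant_term u.2 = 0.

Lemma D_plusP d : D_plus (c := c) d <->
  exists2 s, D_seq s & d = \sum_(u <- s) to_cherednik rG c (eval_X G u.1 * eval_Y G u.2).
Proof.
split=> [[s [Is s0 ->]]|[s [Is s0] ->]]; exists s => //.
  split=> // u /Is[I1 I2]; split; first by apply/(invP rG C0).
  by apply/(invP _ C0)/invariant_dualE.
split=> // u /Is[I1 I2]; split; first by apply/(invP rG C0).
by apply/invariant_dualE/(invP _ C0).
Qed.

Lemma hbar_D s : D_seq s -> \sum_(u <- s) hX u.1 * hY u.2 = 0.
Proof.
move=> Ds; pose d := \sum_(u <- s) to_cherednik rG c (eval_X G u.1 * eval_Y G u.2).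
have Dd : D_plus (c := c) d by apply/D_plusP; exists s.
have E := @ring_proj_rel _ (@D_plus _ _ _ _ rG c) d Dd.
apply: (etrans _ E); rewrite /d (rmap_sum (@ring_projD _ _)); apply: eq_bigr => u _.
exact: (esym (to_hbarM _ _)).
Qed.

Section Ideal.
Variables (B : pzRingType) (W : gT -> B) (EX EY : mp -> B).
Hypothesis ops : cherednik_ops rG c W EX EY.
Variable I : B -> Prop.
Hypothesis I0 : I 0.
Hypothesis IB : forall a b, I a -> I b -> I (a - b).
Hypothesis IM : forall a x b, triangular G W EX EY a -> triangular G W EX EY b ->
  I x -> I (a * x * b).
Hypothesis ID : forall s, D_seq s -> I (\sum_(u <- s) EX u.1 * EY u.2).

Lemma ops_lift_triangular h : triangular G W EX EY (ops_lift (G := G) W EX EY h).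
Proof.
have [t Gt E] := free_triangular (ops_liftD ops) (ops_liftM ops) (ops_lift1 ops)
  (ops_liftC ops) (ops_lift_smash ops) (ops_lift_cherednik C0 ops) h.
exists t => //; apply: (etrans E); apply: tri_congr => // [g Gg|p|p].
- have E1 := ops_liftW ops (subg G g); have E2 : W (sgval (subg G g)) = W g by rewrite subgK.
  exact: (etrans E1 E2).
- exact: (ops_lift_evalX C0 ops).
exact: (ops_lift_evalY C0 ops).
Qed.

(** Stated for a predicate [I] instead of a ring map, since the target may satisfy the restricted
    relations only modulo [I]; besides zero, [I] will be the operators with image in the Hilbert
    ideal, and [inv_ideal 1]. As the image of the free algebra is triangular, [I] has to absorb
    triangular factors only. *)
Lemma hbar_ideal a b : to_hbar a = to_hbar b ->
  I (ops_lift W EX EY a - ops_lift W EX EY b).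
Proof.
have fD := ops_liftD ops; have fM := ops_liftM ops.
pose f : A -> B := ops_lift W EX EY.
have idI : two_sided_ideal (fun h => I (f h)).
  split=> [|x y Ix Iy|x y z Iy].
  - exact: (eq_rect_r I I0 (rmap0 fD)).
  - exact: (eq_rect_r I (IB Ix Iy) (rmapB fD x y)).
  have E : f (x * y * z) = f x * f y * f z.
    exact: (etrans (fM _ _) (congr1 (fun u => u * f z) (fM _ _))).
  exact: (eq_rect_r I (IM (ops_lift_triangular x) (ops_lift_triangular z) Iy) E).
move=> Eab; suff E3 : I (f (a - b)) by exact: (eq_rect _ I E3 _ (rmapB fD a b)).
apply: (quot2_ideal idI _ _ Eab).
  move=> r [Sr|Sr].
    exact: (eq_rect_r I I0 (ops_lift_smash ops Sr)).
  exact: (eq_rect_r I I0 (ops_lift_cherednik C0 ops Sr)).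
move=> h /D_plusP[s Ds Es].
pose h' : A := \sum_(u <- s) eval_X G u.1 * eval_Y G u.2.
have pE : ring_proj (fun a : A => smash_rel rG a \/ cherednik_rel rG c a) h'
    = \sum_(u <- s) to_cherednik rG c (eval_X G u.1 * eval_Y G u.2).
  exact: (rmap_sum (@ring_projD _ _)).
have kf r : smash_rel rG r \/ cherednik_rel rG c r -> f r = 0.
  by case=> Sr; [apply: (ops_lift_smash ops)|apply: (ops_lift_cherednik C0 ops)].
have E := quot_kill fD fM kf (etrans Es (esym pE)).
have E2 : f h' = \sum_(u <- s) EX u.1 * EY u.2.
  apply: (etrans (rmap_sum fD s predT _)); apply: eq_bigr => u _.
  exact: (etrans (fM _ _) (f_equal2 (fun a b : B => a * b)
    (ops_lift_evalX C0 ops u.1) (ops_lift_evalY C0 ops u.2))).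
exact: (eq_rect_r I (ID Ds) (etrans E E2)).
Qed.

Lemma hbar_tri_ideal t : tri_in G t -> tri hW hX hY t = 0 -> I (tri W EX EY t).
Proof.
move=> Gt t0.
have E : to_hbar (tri_free t) = to_hbar 0.
  exact: (etrans (free_triE to_hbarD to_hbarM t) (etrans t0 (esym (rmap0 to_hbarD)))).
have IE := hbar_ideal E.
have E1 := ops_lift_triE ops Gt.
have E2 := rmap0 (ops_liftD ops).
exact: (eq_rect _ I IE _ (etrans (f_equal2 (fun a b : B => a - b) E1 E2) (subr0 _))).
Qed.

End Ideal.

Lemma hbar_lift (B : pzRingType) (W : gT -> B) (EX EY : mp -> B) :
  cherednik_ops rG c W EX EY ->
  (forall s, D_seq s -> \sum_(u <- s) EX u.1 * EY u.2 = 0) ->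
  exists F : Hb -> B, [/\ {morph F : a b / a + b}, {morph F : a b / a * b}, F 1 = 1
    & [/\ forall p, F (hX p) = EX p, forall p, F (hY p) = EY p & {in G, forall g, F (hW g) = W g}]].
Proof.
move=> ops ID; pose f : A -> B := ops_lift W EX EY.
have fD : {morph f : a b / a + b} := ops_liftD ops.
have fM : {morph f : a b / a * b} := ops_liftM ops.
have kf a b : to_hbar a = to_hbar b -> f a = f b.
  move=> E; apply/eqP; rewrite -subr_eq0; apply/eqP.
  have I0 : (0 : B) = 0 by [].
  have IB (u v : B) : u = 0 -> v = 0 -> u - v = 0 by move=> -> ->; rewrite subr0.
  have IM (u x v : B) : triangular G W EX EY u -> triangular G W EX EY v -> x = 0 -> u * x * v = 0.
    by move=> _ _ ->; rewrite mulr0 mul0r.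
  exact: (hbar_ideal ops I0 IB IM ID E).
pose F (q : Hb) : B := f (generic_quotient.repr (generic_quotient.repr q)).
have FE a : F (to_hbar a) = f a.
  apply: kf; have E := ring_projK (generic_quotient.repr (to_hbar a)).
  exact: (etrans (congr1 (@ring_proj _ (@D_plus _ _ _ _ rG c)) E) (ring_projK _)).
exists F; split; last 1 first.
- split=> [p|p|g Gg].
  + exact: (etrans (FE _) (ops_lift_evalX C0 ops p)).
  + exact: (etrans (FE _) (ops_lift_evalY C0 ops p)).
  have E1 := ops_liftW ops (subg G g); have E2 : W (sgval (subg G g)) = W g by rewrite subgK.
  exact: (etrans (FE _) (etrans E1 E2)).
- move=> x y; have [a <-] := to_hbar_surj x; have [b <-] := to_hbar_surj y.
  have E := f_equal2 (fun u v : B => u + v) (FE a) (FE b).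
  exact: (etrans (congr1 F (esym (to_hbarD a b))) (etrans (FE (a + b)) (etrans (fD a b) (esym E)))).
- move=> x y; have [a <-] := to_hbar_surj x; have [b <-] := to_hbar_surj y.
  have E := f_equal2 (fun u v : B => u * v) (FE a) (FE b).
  exact: (etrans (congr1 F (esym (to_hbarM a b))) (etrans (FE (a * b)) (etrans (fM a b) (esym E)))).
exact: (etrans (congr1 F (esym to_hbar1)) (etrans (FE _) (ops_lift1 ops))).
Qed.

End Restricted.
End FreeTriangular.

(** * A model: Dunkl operators without derivative term *)

Section Model.
Variables (C : fieldType) (gT : finGroupType) (G : {group gT}) (n : nat).
Variable rG : mx_representation C G n.
Hypothesis C0 : [pchar C] =i pred0.
Variable c : gT -> C.
Hypothesis cG : forall s w, s \in reflections rG -> w \in G -> c (s ^ w)%g = c s.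
Local Notation mp := (mpoly n C).
Local Notation V := {ffun gT -> mp}.

Variable Del : gT -> 'rV[C]_n -> mp -> mp.
Hypothesis DelP : forall s y, s \in reflections rG ->
  [/\ {morph Del s y : p q / p + q},
      forall p q, Del s y (p * q) = p * Del s y q + Del s y p * sub (rG s) q,
      forall x, Del s y (lin x) = (pairing y (root_mx rG s *m x))%:MP,
      forall p, sub (rG s) p = p -> Del s y p = 0
    & forall a y' p, Del s (a *: y + y') p = a *: Del s y p + Del s y' p].

Lemma DelC s y a : s \in reflections rG -> Del s y a%:MP = 0.
Proof. by move=> Rs; have [_ _ _ DI _] := DelP y Rs; rewrite DI // subC. Qed.

Lemma DelZ s y a p : s \in reflections rG -> Del s y (a *: p) = a *: Del s y p.
Proof.
move=> Rs; have [_ DM _ _ _] := DelP y Rs.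
by rewrite -!mul_mpolyC DM DelC // mul0r addr0.
Qed.

Fact model_scaleD a : {morph (fun v : V => [ffun x => a *: v x]) : u v / u + v}.
Proof. by move=> u v; apply/ffunP => x; rewrite !ffunE scalerDr. Qed.
Definition model_scale a := Addmap (model_scaleD a).
Local Notation B := (aend model_scale).

Fact model_XD p : {morph (fun v : V => [ffun x => p * v x]) : u v / u + v}.
Proof. by move=> u v; apply/ffunP => x; rewrite !ffunE mulrDr. Qed.
Fact model_XS p a u :
  (fun v : V => [ffun x => p * v x]) (model_scale a u) = model_scale a [ffun x => p * u x].
Proof. by apply/ffunP => x; rewrite !ffunE scalerAr. Qed.
Definition mX p : B := Aend (model_XD p) (model_XS p).

Fact model_WD g : {morph (fun v : V => [ffun x => sub (rG g) (v (g^-1 * x)%g)]) : u v / u + v}.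
Proof. by move=> u v; apply/ffunP => x; rewrite !ffunE subD. Qed.
Fact model_WS g a u :
  (fun v : V => [ffun x => sub (rG g) (v (g^-1 * x)%g)]) (model_scale a u)
  = model_scale a [ffun x => sub (rG g) (u (g^-1 * x)%g)].
Proof. by apply/ffunP => x; rewrite !ffunE subZ. Qed.
(** V is C[h] tensored with functions on the group, with g acting on both factors. The second factor
    separates the contributions of different group elements. *)
Definition mW g : B := Aend (model_WD g) (model_WS g).

Fact model_TD y : {morph (fun v : V =>
  [ffun x => - \sum_(s in reflections rG) c s *: Del s y (v (s^-1 * x)%g)]) : u v / u + v}.
Proof.
move=> u v; apply/ffunP => x; rewrite !ffunE -opprD -big_split /=; congr (- _).
by apply: eq_bigr => s Rs; have [DD _ _ _ _] := DelP y Rs; rewrite ffunE DD scalerDr.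
Qed.
Fact model_TS y a u : (fun v : V =>
  [ffun x => - \sum_(s in reflections rG) c s *: Del s y (v (s^-1 * x)%g)]) (model_scale a u)
  = model_scale a [ffun x => - \sum_(s in reflections rG) c s *: Del s y (u (s^-1 * x)%g)].
Proof.
apply/ffunP => x; rewrite !ffunE scalerN scaler_sumr; congr (- _).
by apply: eq_bigr => s Rs; rewrite ffunE DelZ // !scalerA mulrC.
Qed.
(** The Dunkl operator of y at parameter t = 0: the sum over reflections of divided differences,
    composed with the translation by s on the group factor. *)
Definition mT y : B := Aend (model_TD y) (model_TS y).

Lemma mXE p v x : mX p v x = p * v x. Proof. by rewrite ffunE. Qed.
Lemma mWE g v x : mW g v x = sub (rG g) (v (g^-1 * x)%g). Proof. by rewrite ffunE. Qed.
Lemma mTE y v x :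
  mT y v x = - \sum_(s in reflections rG) c s *: Del s y (v (s^-1 * x)%g).
Proof. by rewrite ffunE. Qed.

Lemma mXD : {morph mX : p q / p + q}.
Proof. by move=> p q; apply: aend_eq => v; apply/ffunP => x; rewrite !ffunE mulrDl. Qed.
Lemma mXM : {morph mX : p q / p * q}.
Proof. by move=> p q; apply: aend_eq => v; apply/ffunP => x; rewrite !ffunE mulrA. Qed.
Lemma mXN p : mX (- p) = - mX p.
Proof. by apply: aend_eq => v; apply/ffunP => x; rewrite !ffunE mulNr. Qed.
Lemma mX1 : mX 1 = 1.
Proof. by apply: aend_eq => v; apply/ffunP => x; rewrite !ffunE mul1r. Qed.

Lemma mX_scale a v : mX a%:MP v = model_scale a v.
Proof. by apply/ffunP => x; rewrite !ffunE mul_mpolyC. Qed.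

Lemma mX_scalar a h : mX a%:MP * h = h * mX a%:MP.
Proof. by apply: aend_eq => v; rewrite /= -[LHS]/(mX _ _) -[X in _ = h X]/(mX _ _) !mX_scale aendS. Qed.

Definition delta_fun (z : gT) : V := [ffun x => (x == z)%:R].

(** V is free over C[h] on the delta functions, so an operator that commutes with C[h] up to a
    substitution is determined by its values there. Relations among the operators then follow by
    studying how their defect commutes with linear forms. *)
Lemma model_ext (phi : B) A : (forall x, phi * mX (lin x) = mX (lin (A *m x)) * phi) ->
  (forall z, phi (delta_fun z) = 0) -> phi = 0.
Proof.
move=> phiX phi0; apply: aend_eq => v.
have phiXp p : phi * mX p = mX (sub A p) * phi.
  elim/mpoly_ring_ind: p => [a|i|p q Ep Eq|p q Ep Eq].
  - by rewrite subC mX_scalar.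
  - by rewrite -lin_delta sub_lin phiX.
  - by rewrite subD !mXD mulrDl mulrDr Ep Eq.
  by rewrite subM !mXM mulrA Ep -!mulrA Eq.
have -> : v = \sum_z mX (v z) (delta_fun z).
  apply/ffunP => x; rewrite sum_ffunE (bigD1 x) //= !ffunE eqxx mulr1.
  by rewrite big1 ?addr0 // => z zx; rewrite !ffunE eq_sym (negPf zx) mulr0.
have phiD : {morph phi : u w / u + w} := aendD phi.
have phi00 : phi 0 = 0 by apply: (addrI (phi 0)); rewrite -phiD !addr0.
rewrite (big_morph phi phiD phi00) big1 // => z _.
rewrite -[phi _]/((phi * mX (v z)) _) phiXp aend_mulE phi0.
by apply/ffunP => x; rewrite !ffunE mulr0.
Qed.

Lemma mT_delta y z : mT y (delta_fun z) = 0.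
Proof.
apply/ffunP => x; rewrite mTE big1 ?oppr0 ?ffunE // => s Rs.
by rewrite ffunE -mpolyC_nat DelC // scaler0.
Qed.

Lemma mW_delta g z : mW g (delta_fun z) = delta_fun (g * z)%g.
Proof.
apply/ffunP => x; rewrite mWE !ffunE -mpolyC_nat subC mpolyC_nat.
by rewrite -(inj_eq (mulgI g)) mulKVg.
Qed.

Lemma mWM : {in G &, forall g h, mW (g * h)%g = mW g * mW h}.
Proof.
move=> g h Gg Gh; apply: aend_eq => v; apply/ffunP => x.
by rewrite !ffunE sub_mul -repr_mxM // invMg mulgA.
Qed.

Lemma mW1 : mW 1%g = 1.
Proof.
by apply: aend_eq => v; apply/ffunP => x; rewrite !ffunE repr_mx1 sub1 invg1 mul1g.
Qed.

Lemma mWX g x : mW g * mX (lin x) = mX (lin (rG g *m x)) * mW g.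
Proof.
by apply: aend_eq => v; apply/ffunP => z; rewrite !ffunE subM sub_lin.
Qed.

Definition mS (y : 'rV[C]_n) x : B := \sum_(s in reflections rG)
  mX (c s * pairing y (root_mx rG s *m x))%:MP * mW s.

Lemma mTX y x : mT y * mX (lin x) = mX (lin x) * mT y - mS y x.
Proof.
apply: aend_eq => v; rewrite aend_addE aend_oppE aend_sumE.
apply/ffunP => z; rewrite !ffunE sum_ffunE mulrN -opprD; congr (- _).
rewrite mulr_sumr -big_split /=; apply: eq_bigr => s Rs.
have [_ DM DX _ _] := DelP y Rs.
rewrite !ffunE DM DX scalerDr -scalerAr; congr (_ + _).
by rewrite mpolyCM -mulrA [RHS]mul_mpolyC.
Qed.

Lemma mT_lin a y y' : mT (a *: y + y') = mX a%:MP * mT y + mT y'.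
Proof.
apply: aend_eq => v; apply/ffunP => z; rewrite !ffunE mul_mpolyC scalerN scaler_sumr -opprD.
congr (- _); rewrite -big_split; apply: eq_bigr => s Rs /=.
by have [_ _ _ _ ->] := DelP y Rs; rewrite scalerDr !scalerA mulrC.
Qed.

Lemma mT0 : mT 0 = 0.
Proof.
have := mT_lin 1 0 0; rewrite scale1r addr0 mpolyC1 mX1 mul1r => /eqP.
by rewrite -subr_eq subrr eq_sym => /eqP.
Qed.

Lemma mWT g y : g \in G -> mW g * mT y = mT (y *m rG g^-1%g) * mW g.
Proof.
move=> Gg; apply/eqP; rewrite -subr_eq0; apply/eqP; apply: (model_ext (A := rG g)) => [x|z].
  set y' := y *m _; set x' := rG g *m x.
  have E1 : mW g * mT y * mX (lin x) = mX (lin x') * (mW g * mT y) - mW g * mS y x.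
    by rewrite -mulrA mTX mulrBr !mulrA mWX.
  have E2 : mT y' * mW g * mX (lin x) = mX (lin x') * (mT y' * mW g) - mS y' x' * mW g.
    by rewrite -mulrA mWX mulrA mTX mulrBl !mulrA.
  have E3 : mW g * mS y x = mS y' x' * mW g.
    rewrite /mS mulr_suml mulr_sumr [RHS](reindex_inj (conjg_inj g^-1%g)) /=.
    apply: eq_big => [s|s Rs]; first by rewrite reflections_conj ?groupV.
    have Gs := reflections_in Rs.
    rewrite cG ?groupV // root_mx_conj ?groupV // invgK.
    rewrite -mulrA -mWM ?groupJ ?groupV // conjgE invgK -!mulgA mulVg mulg1 mWM //.
    rewrite mulrA -mX_scalar -!mulrA; congr (mX (_ * _)%:MP * _).
    rewrite /pairing /y' /x' !mulmxA.
    by rewrite !repr_mxKV.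
  by rewrite mulrBl E1 E2 E3 mulrBr opprB addrA subrK.
have W0 : mW g 0 = 0 by apply/ffunP => x; rewrite !ffunE raddf0.
by rewrite aend_addE aend_oppE !aend_mulE mW_delta !mT_delta W0 subr0.
Qed.

Lemma mT_comm y y' : mT y * mT y' = mT y' * mT y.
Proof.
apply/eqP; rewrite -subr_eq0; apply/eqP; apply: (model_ext (A := 1%:M)) => [x|z]; last first.
  have T0 u : mT u 0 = 0 by apply: (addrI (mT u 0)); rewrite -aendD !addr0.
  by rewrite aend_addE aend_oppE !aend_mulE !mT_delta !T0 subr0.
(* The contribution of s to either side is proportional to the product of the pairings of y and y'
   with its root, which is symmetric in y and y'. *)
have K : mS y' x * mT y - mT y * mS y' x = mS y x * mT y' - mT y' * mS y x.
  have F u u' : mS u x * mT u' - mT u' * mS u x = \sum_(s in reflections rG)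
     mX (c s * pairing u (root_mx rG s *m x))%:MP * (mT (u' *m rG s^-1%g - u') * mW s).
    rewrite /mS mulr_suml mulr_sumr -sumrB; apply: eq_bigr => s Rs.
    have Gs := reflections_in Rs.
    rewrite -mulrA mWT // [mT u' * _]mulrA -mX_scalar -[mX _ * mT u' * _]mulrA -mulrBr; congr (_ * _).
    rewrite -mulrBl; congr (_ * _); have := mT_lin (-1) u' (u' *m rG s^-1%g).
    by rewrite scaleN1r addrC => ->; rewrite mpolyCN mpolyC1 mXN mX1 mulN1r addrC.
  rewrite !F; apply: eq_bigr => s Rs.
  have [k [k' [a [b [[k0 k'0 a0 ->] [_ -> _]]]]]] := reflection_factor C0 Rs.
  rewrite !mulmxDr !mulmx1 ![_ + _ - _]addrAC !subrr !add0r -!scalemxAr !mulmxA.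
  have pE u : pairing u (a *m b *m x) = (u *m a) 0 0 * (b *m x) 0 0.
    by rewrite /pairing -mulmxA mulmxA {1}[u *m a]mx11_scalar mul_scalar_mx mxE.
  have uE u : u *m a *m b = (u *m a) 0 0 *: b.
    by rewrite {1}[u *m a]mx11_scalar mul_scalar_mx.
  have TZ e u : mT (e *: u) = mX e%:MP * mT u.
    by rewrite -[e *: u]addr0 mT_lin mT0 addr0.
  rewrite !pE !uE !TZ !mulrA -!mXM -!mpolyCM.
  by congr (mX (_%:MP) * _ * _); ring.
have E u u' : mT u * mT u' * mX (lin x)
    = mX (lin x) * (mT u * mT u') - mS u x * mT u' - mT u * mS u' x.
  by rewrite -mulrA mTX mulrBr !mulrA mTX mulrBl.
rewrite mul1mx mulrBl !E mulrBr.
have K' : mS y x * mT y' + mT y * mS y' x = mS y' x * mT y + mT y' * mS y x.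
  by move/eqP: K; rewrite subr_eq => /eqP->; rewrite addrAC subrK.
have fin (p q a b a' b' : B) : a + b = a' + b' -> p - a - b - (q - a' - b') = p - q.
  by move=> ab; rewrite -(addrA p) -opprD -(addrA q) -opprD ab opprB addrA subrK.
exact: fin.
Qed.

End Model.

Section ModelOps.
Variables (C : fieldType) (gT : finGroupType) (G : {group gT}) (n : nat).
Variable rG : mx_representation C G n.
Hypothesis C0 : [pchar C] =i pred0.
Variable c : gT -> C.
Hypothesis cG : forall s w, s \in reflections rG -> w \in G -> c (s ^ w)%g = c s.
Local Notation mp := (mpoly n C).
Local Notation V := {ffun gT -> mp}.

Variable Del : gT -> 'rV[C]_n -> mp -> mp.
Hypothesis DelP : forall s y, s \in reflections rG ->
  [/\ {morph Del s y : p q / p + q},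
      forall p q, Del s y (p * q) = p * Del s y q + Del s y p * sub (rG s) q,
      forall x, Del s y (lin x) = (pairing y (root_mx rG s *m x))%:MP,
      forall p, sub (rG s) p = p -> Del s y p = 0
    & forall a y' p, Del s (a *: y + y') p = a *: Del s y p + Del s y' p].

Local Notation B := (aend (@model_scale C gT n)).
Local Notation mX := (@mX C gT n).
Local Notation mW := (mW rG).
Local Notation mT := (mT c DelP).
Local Notation F := {malg C[{fmonom 'I_n}]}.

Let sc (a : C) : B := mX a%:MP.
Let f : F -> B := free_lift sc (fun i => mT (delta_mx 0 i)).
Let h (i : 'I_n) : F := mkmalgU (fmu i) 1.

Let sD : {morph sc : a b / a + b}. Proof. by move=> a b; rewrite /sc mpolyCD mXD. Qed.
Let sM : {morph sc : a b / a * b}. Proof. by move=> a b; rewrite /sc mpolyCM mXM. Qed.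
Let s1 : sc 1 = 1. Proof. by rewrite /sc mpolyC1 mX1. Qed.
Let sC a b : sc a * b = b * sc a. Proof. exact: mX_scalar. Qed.

Let fD : {morph f : a b / a + b} := free_liftD _ sD.
Let fM : {morph f : a b / a * b} := free_liftM _ sD sM sC.
Let f1 : f 1 = 1 := free_lift1 _ sD s1.
Let fsc a : f a%:A = sc a := free_lift_scalar _ sD a.
Let fC a b : f a%:A * b = b * f a%:A. Proof. by rewrite fsc sC. Qed.
Let fh i : f (h i) = mT (delta_mx 0 i) := free_lift_gen _ sD s1 i.

(** The polynomial is first evaluated in a free algebra over C and then mapped to operators, since
    [evaluation] takes values in an [lalgType] and [aend] carries only a ring structure. *)
Definition mY (q : mp) : B := f (evaluation h q).

Lemma mYD : {morph mY : p q / p + q}.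
Proof. exact: (evaluationD fD h). Qed.
Lemma mYM : {morph mY : p q / p * q}.
Proof.
by apply: (evaluationM fD fM f1 fC (h := h)) => i j; rewrite !fh; apply: mT_comm.
Qed.
Lemma mYC a : mY a%:MP = mX a%:MP.
Proof. exact: (etrans (evaluationC f h a) (fsc a)). Qed.

Lemma mY_lin x : mY (lin x) = mT x^T.
Proof.
have EX i : mY 'X_i = mT (delta_mx 0 i) by exact: (etrans (evaluationXU f h i) (fh i)).
have EZ a p : mY (a *: p) = mX a%:MP * mY p by rewrite -mul_mpolyC mYM mYC.
have E0 : mY 0 = 0 by apply: (addrI (mY 0)); rewrite -mYD !addr0.
have -> : x^T = \sum_i x i 0 *: (delta_mx 0 i : 'rV_n).
  rewrite {1}[x^T]matrix_sum_delta big_ord1; apply: eq_bigr => i _.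
  by rewrite mxE.
rewrite /lin; elim: (index_enum _) => [|i r IH]; first by rewrite !big_nil E0 mT0.
by rewrite !big_cons mYD EZ EX IH mT_lin.
Qed.

Lemma model_Y_exists : exists Y : mp -> B,
  [/\ {morph Y : p q / p + q}, {morph Y : p q / p * q},
      forall a, Y a%:MP = mX a%:MP & forall x, Y (lin x) = mT x^T].
Proof. by exists mY; split; [exact: mYD|exact: mYM|exact: mYC|exact: mY_lin]. Qed.

End ModelOps.

Section ModelIndependence.
Variables (C : fieldType) (gT : finGroupType) (G : {group gT}) (n : nat).
Variable rG : mx_representation C G n.
Hypothesis C0 : [pchar C] =i pred0.
Variable c : gT -> C.
Hypothesis cG : forall s w, s \in reflections rG -> w \in G -> c (s ^ w)%g = c s.
Local Notation mp := (mpoly n C).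
Local Notation V := {ffun gT -> mp}.

Variable Del : gT -> 'rV[C]_n -> mp -> mp.
Hypothesis DelP : forall s y, s \in reflections rG ->
  [/\ {morph Del s y : p q / p + q},
      forall p q, Del s y (p * q) = p * Del s y q + Del s y p * sub (rG s) q,
      forall x, Del s y (lin x) = (pairing y (root_mx rG s *m x))%:MP,
      forall p, sub (rG s) p = p -> Del s y p = 0
    & forall a y' p, Del s (a *: y + y') p = a *: Del s y p + Del s y' p].

Local Notation B := (aend (@model_scale C gT n)).
Local Notation mX := (@mX C gT n).
Local Notation mW := (mW rG).
Local Notation mT := (mT c DelP).

Variable mY : mp -> B.
Hypothesis mYD : {morph mY : p q / p + q}.
Hypothesis mYM : {morph mY : p q / p * q}.
Hypothesis mYC : forall a, mY a%:MP = mX a%:MP.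
Hypothesis mY_lin : forall x, mY (lin x) = mT x^T.

Lemma model_ops : cherednik_ops rG c mW mX mY.
Proof.
split.
- exact: mXD.
- exact: mXM.
- exact: mX1.
- exact: mYD.
- exact: mYM.
- exact: mYC.
- exact: mX_scalar.
- exact: mW1.
- exact: mWM.
- by move=> g x _; apply: mWX.
- move=> g x Gg; rewrite !mY_lin; have := mWT cG DelP x^T Gg.
  by rewrite trmx_mul /= /dual_mx trmxK.
by move=> y x; rewrite mY_lin trmxK mTX addrC addKr.
Qed.

Lemma mY_delta q z : mY q (delta_fun C n z) = mX (constant_term q)%:MP (delta_fun C n z).
Proof.
elim/mpoly_ring_ind: q => [a|i|p q Ep Eq|p q Ep Eq].
- by rewrite mYC constant_termC.
- rewrite -lin_delta mY_lin mT_delta constant_term_lin mpolyC0.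
  by apply/ffunP => x; rewrite !ffunE mul0r.
- by rewrite (mYD p q) (aend_addE (mY p)) Ep Eq (constant_termD p q) mpolyCD (mXD _ _%:MP).
rewrite (mYM p q) (aend_mulE (mY p)) Eq -aend_mulE -mX_scalar aend_mulE Ep.
by rewrite (constant_termM p q) mulrC mpolyCM (mXM _ _%:MP).
Qed.

Definition in_coinv (v : V) : Prop := forall x, coinv rG (v x).

Lemma in_coinvD u v : in_coinv u -> in_coinv v -> in_coinv (u + v).
Proof. by move=> Iu Iv x; rewrite ffunE; apply: coinvD. Qed.

Lemma in_coinvX p v : in_coinv v -> in_coinv (mX p v).
Proof. by move=> Iv x; rewrite mXE; apply: coinvMl. Qed.

Lemma in_coinvW g v : g \in G -> in_coinv v -> in_coinv (mW g v).
Proof. by move=> Gg Iv x; rewrite mWE; apply: coinv_subG. Qed.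

Lemma in_coinvY q v : in_coinv v -> in_coinv (mY q v).
Proof.
elim/mpoly_ring_ind: q v => [a|i|p q Ep Eq|p q Ep Eq] v Iv.
- by rewrite mYC; apply: in_coinvX.
- rewrite -lin_delta mY_lin => x; rewrite mTE; apply/coinvN/coinv_sum => s Rs.
  have [DD DM _ DI _] := DelP (delta_mx i 0)^T Rs.
  by apply: coinvZ; apply: (coinv_demazure (reflections_in Rs) DD DM DI).
- by rewrite (mYD p q) (aend_addE (mY p)); apply: in_coinvD; [apply: Ep|apply: Eq].
by rewrite (mYM p q) (aend_mulE (mY p)); apply: Ep; apply: Eq.
Qed.

Lemma in_coinv_triangular phi v : triangular G mW mX mY phi -> in_coinv v -> in_coinv (phi v).
Proof.
move=> tphi Iv; move: phi tphi; apply: triangular_ind => [x|a b Ia Ib|p g q Gg].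
- by rewrite aend_zeroE ffunE; apply: coinv0.
- by rewrite aend_addE; apply: in_coinvD.
by rewrite !aend_mulE; apply/in_coinvX/in_coinvW/in_coinvY.
Qed.

(** By [inv_commY] for the dual relations, an invariant in Y commutes with C[h], and on delta
    functions it acts by its constant term; [model_ext] concludes. *)
Lemma mY_inv q : inv (dual_repr rG) q -> mY q = mX (constant_term q)%:MP.
Proof.
move=> Iq; apply/eqP; rewrite -subr_eq0; apply/eqP.
apply: (model_ext (A := 1%:M)) => [x|z].
  have dops := dual_ops C0 model_ops.
  by rewrite mul1mx mulrBl mulrBr (inv_commY C0 dops _ Iq) mX_scalar.
by rewrite aend_addE aend_oppE mY_delta subrr.
Qed.

(** The part of the PBW theorem on which [eps] rests: modulo h on the right, the coefficient of g is
    well defined in the coinvariant algebra. *)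
Lemma hbar_indep t g : tri_in G t ->
  tri (hW rG c) (hX rG c) (hY rG c) t = 0 ->
  coinv rG (\sum_(u <- t | u.1.2 == g) constant_term u.2 *: u.1.1).
Proof.
(* Relations of the restricted algebra do not vanish in the model; they only send V into the
   functions with values in the Hilbert ideal. *)
move=> Gt t0; pose I (phi : B) := forall v, in_coinv (phi v).
have : I (tri mW mX mY t).
  apply: (hbar_tri_ideal C0 model_ops _ _ _ _ Gt t0).
  - by move=> v x; rewrite aend_zeroE ffunE; apply: coinv0.
  - move=> a b Ia Ib v; rewrite aend_addE aend_oppE.
    apply: in_coinvD; first exact: Ia.
    by move=> x; rewrite ffunE; apply/coinvN/Ib.
  - move=> a x b ta tb Ix v; rewrite !aend_mulE.
    by apply: in_coinv_triangular => //; apply: Ix.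
  (* By [mY_inv] an element of D(G)_+ acts as multiplication by an invariant polynomial, whose
     constant term is zero. *)
  move=> s [Is s0] v x; rewrite aend_sumE sum_ffunE.
  rewrite big_seq (eq_bigr (fun u => (constant_term u.2 *: u.1) * v x)) => [|u /Is[_ Iu2]].
    rewrite -mulr_suml -big_seq; apply: coinvMr; apply: coinv_inv.
      rewrite big_seq; apply: (big_ind (inv rG)) => [|p q|u /Is[Iu _]].
      - by rewrite -mpolyC0; apply: invC.
      - exact: invD.
      by rewrite -mul_mpolyC; apply: invM => //; apply: invC.
    rewrite /constant_term raddf_sum /= -[RHS]s0; apply: eq_bigr => u _.
    by rewrite mevalZ mulrC.
  by rewrite aend_mulE mY_inv // !mXE -mul_mpolyC mulrCA mulrA.
(* On the delta function at 1, the term of (p, k, q) takes the value q(0)p at k and 0 elsewhere. *)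
move=> /(_ (delta_fun C n 1%g) g); rewrite /tri aend_sumE sum_ffunE => It.
rewrite big_mkcond; apply: (eq_rect _ (coinv rG) It); apply: eq_bigr => u _.
rewrite 2!aend_mulE mY_delta.
rewrite mXE mWE mXE ffunE -eq_mulVg1 subM subC.
case: eqP => _; last by rewrite raddf0 !mulr0.
by rewrite rmorph1 mulr1 mulrC mul_mpolyC.
Qed.

End ModelIndependence.

(** What the sequel retains of a restricted algebra: the relations, a triangular expression for
    every element, the vanishing of D(G)_+, and independence of the coefficients. *)
Record restricted_ops (C : fieldType) (gT : finGroupType) (G : {group gT}) (n : nat)
    (rG : mx_representation C G n) (H : pzRingType) (c : gT -> C)
    (W : gT -> H) (EX EY : mpoly n C -> H) : Prop := RestrictedOps {
  ro_ops : cherednik_ops rG c W EX EY;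
  ro_tri : forall h, triangular G W EX EY h;
  ro_D : forall s, D_seq rG s -> \sum_(u <- s) EX u.1 * EY u.2 = 0;
  ro_indep : forall t g, tri_in G t -> tri W EX EY t = 0 ->
    coinv rG (\sum_(u <- t | u.1.2 == g) constant_term u.2 *: u.1.1)
}.

Lemma hbar_restricted_ops (C : fieldType) (gT : finGroupType) (G : {group gT}) (n : nat)
    (rG : mx_representation C G n) (c : gT -> C) : [pchar C] =i pred0 ->
  (forall s w, s \in reflections rG -> w \in G -> c (s ^ w)%g = c s) ->
  restricted_ops rG c (hW rG c) (hX rG c) (hY rG c).
Proof.
move=> C0 cG; split; [exact: hbar_ops|exact: hbar_triangular|exact: hbar_D|].
have [Del DelP] := demazure_exists rG C0.
have [mY [mYD mYM mYC mY_lin]] := model_Y_exists C0 cG DelP.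
exact: (hbar_indep C0 cG mYD mYM mYC mY_lin).
Qed.

(** The group algebra element with coefficients a is the sum of its products with the Wedderburn
    identities. The representation i is injective on the i-th ideal, so each product vanishes, and
    the coefficients are read off in the regular representation. *)
Lemma irr_repr_faithful (C : fieldType) (gT : finGroupType) (G : {group gT})
    (sG : irrType C G) (a : gT -> C) : [pchar C]^'.-group G ->
  (forall i : sG, \sum_(g in G) a g *: irr_repr i g = 0) ->
  forall g, g \in G -> a g = 0.
Proof.
move=> C'G a0 g Gg; pose aG := regular_repr C G.
pose A := \sum_(x in G) a x *: aG x.
have opA m (rE : mx_representation C G m) :
    gring_op rE A = \sum_(x in G) a x *: rE x.
  rewrite /A linear_sum; apply: eq_bigr => x Gx.
  by rewrite linearZ /= gring_opG.
have RA : (A \in group_ring C G)%MS.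
  by apply/envelop_mxP; exists a.
suff A0 : A = 0.
  have := congr1 (gring_proj g) A0; rewrite linear0 /A linear_sum (bigD1 g) //=.
  rewrite linearZ /= gring_projE // eqxx big1 ?addr0 => [/rowP/(_ 0)|x /andP[Gx xg]].
    by rewrite !mxE eqxx mulr1.
  by rewrite linearZ /= gring_projE // eq_sym (negPf xg) scaler0.
rewrite -[A]mulmx1 -(Wedderburn_sum_id_pchar sG C'G) mulmx_sumr big1 // => i _.
have irri : mx_irreducible (irr_repr i) by exact: socle_irr.
apply: (regular_op_inj_pchar (sG := sG) C'G irri).
- rewrite inE irr_reprK_pchar //.
  have /andP[Ri _] := Wedderburn_ideal i.
  apply: (submx_trans _ Ri); exact: mem_mulsmx RA (Wedderburn_id_mem i).
- by rewrite inE linear0 sub0mx.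
have Re : (Wedderburn_id i \in group_ring C G)%MS.
  by rewrite -(Wedderburn_sum_pchar sG C'G) (sumsmx_sup i) ?Wedderburn_id_mem.
by rewrite -(gring_rowK Re) gring_opJ opA a0 mul0mx linear0.
Qed.

(** * Coefficients at group elements and nilpotency of central elements *)

Section RestrictedAlgebra.
Variables (C : fieldType) (gT : finGroupType) (G : {group gT}) (n : nat).
Variable rG : mx_representation C G n.
Hypothesis C0 : [pchar C] =i pred0.
Local Notation mp := (mpoly n C).
Variables (H : pzRingType) (c : gT -> C) (W : gT -> H) (EX EY : mp -> H).
Hypothesis ro : restricted_ops rG c W EX EY.
Let ops := ro_ops ro.
Local Notation triH := (tri W EX EY).
Local Notation T := (seq (mp * gT * mp)).

Lemma coinvX0 p : coinv rG p -> EX p = 0.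
Proof.
case=> s [Is ->]; rewrite (co_Xsum ops) big_seq big1 // => u /Is[Iu u0].
rewrite (co_XM ops); have := ro_D ro (s := [:: (u.1, 1)]).
rewrite !big_seq1 /= (co_Y1 ops) mulr1 => -> //; first by rewrite mul0r.
split=> [v|]; rewrite ?inE ?big_seq1 /= ?u0 ?mul0r // => /eqP-> /=.
by split=> //; rewrite -mpolyC1; apply: invC.
Qed.

Lemma coinvY0 q : coinv (dual_repr rG) q -> EY q = 0.
Proof.
case=> s [Is ->]; rewrite (co_Ysum ops) big_seq big1 // => u /Is[Iu u0].
rewrite (co_YM ops); have := ro_D ro (s := [:: (1, u.1)]).
rewrite !big_seq1 /= (co_X1 ops) mul1r => -> //; first by rewrite mul0r.
split=> [v|]; rewrite ?inE ?big_seq1 /= ?u0 ?mulr0 // => /eqP-> /=.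
by split=> //; rewrite -mpolyC1; apply: invC.
Qed.

Lemma tri_cat s t : triH (s ++ t) = triH s + triH t.
Proof. by rewrite /tri big_cat. Qed.

Definition tri_coef (t : T) (g : gT) : C :=
  \sum_(u <- t | u.1.2 == g) constant_term u.1.1 * constant_term u.2.

Definition mapX (p : mp) (t : T) : T := [seq (p * u.1.1, u.1.2, u.2) | u <- t].

Lemma tri_mapX p t : triH (mapX p t) = EX p * triH t.
Proof.
rewrite /tri big_map mulr_sumr; apply: eq_bigr => u _ /=.
by rewrite (co_XM ops) !mulrA.
Qed.

Lemma mapX_in p t : tri_in G t -> tri_in G (mapX p t).
Proof. by rewrite /tri_in all_map. Qed.

Lemma tri_coef_mapX p t g : tri_coef (mapX p t) g = constant_term p * tri_coef t g.
Proof.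
rewrite /tri_coef big_map mulr_sumr; apply: eq_bigr => u _ /=.
by rewrite constant_termM mulrA.
Qed.

Lemma tri_coef_cat s t g : tri_coef (s ++ t) g = tri_coef s g + tri_coef t g.
Proof. by rewrite /tri_coef big_cat. Qed.

Lemma tri_coef0 t g : tri_in G t -> triH t = 0 -> tri_coef t g = 0.
Proof.
move=> Gt t0; have := constant_term_coinv (ro_indep ro g Gt t0).
rewrite /constant_term raddf_sum /= => E; rewrite -[RHS]E.
by apply: eq_bigr => u _; rewrite mevalZ mulrC.
Qed.

(** Makes [eps] independent of the expression selected by [tri_of]. *)
Lemma tri_coef_eq s t g : tri_in G s -> tri_in G t -> triH s = triH t ->
  tri_coef s g = tri_coef t g.
Proof.
move=> Gs Gt st; pose s' := s ++ mapX (-1) t.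
have Gs' : tri_in G s' by rewrite /tri_in all_cat; apply/andP; split=> //; exact: mapX_in.
have s'0 : triH s' = 0.
  by rewrite tri_cat tri_mapX (co_XN ops) (co_X1 ops) mulN1r st subrr.
have /eqP := tri_coef0 g Gs' s'0; rewrite tri_coef_cat tri_coef_mapX.
rewrite -mpolyC1 -mpolyCN constant_termC mulN1r.
by rewrite subr_eq0 => /eqP.
Qed.

Fact tri_witness h : exists t : T, tri_in G t && (h == triH t).
Proof. by have [t Gt ->] := ro_tri ro h; exists t; rewrite Gt eqxx. Qed.

Definition tri_of h : T := xchoose (tri_witness h).

Lemma tri_ofP h : tri_in G (tri_of h) /\ triH (tri_of h) = h.
Proof. by have /andP[Gt /eqP tE] := xchooseP (tri_witness h). Qed.

(* The coefficient of g in H / (X_+ H + H Y_+), the group algebra of G. *)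
Definition eps (h : H) (g : gT) : C := tri_coef (tri_of h) g.

Lemma eps_tri t g : tri_in G t -> eps (triH t) g = tri_coef t g.
Proof.
by move=> Gt; have [Gs sE] := tri_ofP (triH t); apply: tri_coef_eq.
Qed.

Lemma epsD a b g : eps (a + b) g = eps a g + eps b g.
Proof.
have [Gs {1}<-] := tri_ofP a; have [Gt {1}<-] := tri_ofP b.
rewrite -tri_cat eps_tri ?tri_coef_cat //.
by rewrite /tri_in all_cat; apply/andP.
Qed.

Lemma epsX p h g : eps (EX p * h) g = constant_term p * eps h g.
Proof.
have [Gt {1}<-] := tri_ofP h.
by rewrite -tri_mapX eps_tri ?mapX_in // tri_coef_mapX.
Qed.

Lemma epsN a g : eps (- a) g = - eps a g.
Proof.
rewrite -mulN1r -(co_X1 ops) -(co_XN ops) epsX -mpolyC1 -mpolyCN constant_termC.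
by rewrite mulN1r.
Qed.

Lemma eps0 g : eps 0 g = 0.
Proof. by apply: (addrI (eps 0 g)); rewrite -epsD !addr0. Qed.

Lemma eps_term p k q g : k \in G ->
  eps (EX p * W k * EY q) g = (k == g)%:R * (constant_term p * constant_term q).
Proof.
move=> Gk; have -> : EX p * W k * EY q = triH [:: (p, k, q)] by rewrite /tri big_seq1.
rewrite eps_tri /tri_in /= ?Gk // /tri_coef big_cons big_nil /=.
by case: eqP => _; rewrite ?addr0 ?mul1r ?mul0r.
Qed.

Lemma eps_ind (P : H -> Prop) : P 0 -> (forall a b, P a -> P b -> P (a + b)) ->
  (forall p g q, g \in G -> P (EX p * W g * EY q)) -> forall h, P h.
Proof. by move=> P0 PD PT h; apply: (triangular_ind P0 PD PT (ro_tri ro h)). Qed.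

Lemma epsY h q g : eps (h * EY q) g = constant_term q * eps h g.
Proof.
elim/eps_ind: h => [|a b Ea Eb|p k r Gk]; first by rewrite mul0r eps0 mulr0.
  by rewrite mulrDl !epsD Ea Eb mulrDr.
rewrite -mulrA -(co_YM ops) !eps_term // constant_termM.
by ring.
Qed.

Lemma co_YW q k : k \in G -> EY q * W k = W k * EY (sub (dual_repr rG k^-1%g) q).
Proof.
by move=> Gk; rewrite (co_WYp ops) // sub_mul -repr_mxM ?groupV // mulgV repr_mx1 sub1.
Qed.

Lemma epsWr h k g : k \in G -> eps (h * W k) g = eps h (g * k^-1)%g.
Proof.
move=> Gk; elim/eps_ind: h => [|a b Ea Eb|p x q Gx]; first by rewrite mul0r !eps0.
  by rewrite mulrDl !epsD Ea Eb.
rewrite -mulrA co_YW //.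
rewrite mulrA -(mulrA _ (W x)) -(co_WM ops) // !eps_term ?groupM //.
by rewrite constant_term_sub -(inj_eq (mulIg k) x) mulgKV.
Qed.

Lemma epsWl h k g : k \in G -> eps (W k * h) g = eps h (k^-1 * g)%g.
Proof.
move=> Gk; elim/eps_ind: h => [|a b Ea Eb|p x q Gx]; first by rewrite mulr0 !eps0.
  by rewrite mulrDr !epsD Ea Eb.
rewrite !mulrA (co_WXp ops) // -(mulrA _ (W k)) -(co_WM ops) // !eps_term ?groupM //.
by rewrite constant_term_sub -(inj_eq (mulgI k) x) mulKVg.
Qed.

Lemma eps_out h g : g \notin G -> eps h g = 0.
Proof.
move=> nGg; elim/eps_ind: h => [|a b Ea Eb|p x q Gx]; first exact: eps0.
  by rewrite epsD Ea Eb addr0.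
rewrite eps_term //; have [xg|_] := eqVneq x g; last by rewrite mul0r.
by rewrite -xg Gx in nGg.
Qed.

Lemma eps1 g : eps 1 g = (1%g == g)%:R.
Proof.
have -> : 1 = EX 1 * W 1%g * EY 1 :> H.
  by rewrite (co_X1 ops) (co_Y1 ops) (co_W1 ops) !mulr1.
by rewrite eps_term // -mpolyC1 constant_termC !mulr1.
Qed.

(** What [eps] kills is a right ideal plus a left ideal, so [eps] is not multiplicative in general.
    A central z can be placed between [EX p] and [W x], and there it only meets the group. *)
Lemma eps_central z h g : (forall a, z * a = a * z) ->
  eps (z * h) g = \sum_(k in G) eps h k * eps z (g * k^-1)%g.
Proof.
move=> zC; elim/eps_ind: h => [|a b Ea Eb|p x q Gx].
- by rewrite mulr0 eps0 big1 // => k _; rewrite eps0 mul0r.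
- rewrite mulrDr epsD Ea Eb -big_split; apply: eq_bigr => k _ /=.
  by rewrite epsD mulrDl.
rewrite !mulrA epsY zC -mulrA epsX epsWr //.
rewrite (bigD1 x) //= eps_term // eqxx mul1r big1 ?addr0 => [|k /andP[_ kx]].
  by ring.
by rewrite eps_term // eq_sym (negPf kx) !mul0r.
Qed.

Definition order_list (k : nat) (t : T) : Prop :=
  forall u, u \in t -> exists ij : nat * nat,
    [/\ (k <= ij.1 + ij.2)%N, order_ge ij.1 u.1.1 & order_ge ij.2 u.2].

(** Elements with an expression whose terms have total order at least k in X and Y. This is not
    multiplicative, because straightening yx lowers the order by two. *)
Definition fil (k : nat) (h : H) : Prop :=
  exists t, [/\ tri_in G t, order_list k t & h = triH t].

Lemma fil0 k : fil k 0.
Proof. by exists [::]; split=> //; rewrite /tri big_nil. Qed.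

Lemma filD k a b : fil k a -> fil k b -> fil k (a + b).
Proof.
move=> [s [Gs os ->]] [t [Gt ot ->]]; exists (s ++ t); split; rewrite ?tri_cat //.
  by rewrite /tri_in all_cat; apply/andP.
by move=> u; rewrite mem_cat => /orP[/os|/ot].
Qed.

Lemma fil_sum k (I : Type) (r : seq I) (P : pred I) (F : I -> H) :
  (forall i, P i -> fil k (F i)) -> fil k (\sum_(i <- r | P i) F i).
Proof. by move=> fF; apply: (big_ind (fil k)) => //; [exact: fil0|exact: filD]. Qed.

Lemma fil_term k i j p g q : g \in G -> order_ge i p -> order_ge j q -> (k <= i + j)%N ->
  fil k (EX p * W g * EY q).
Proof.
move=> Gg op oq kij; exists [:: (p, g, q)]; split; rewrite /tri_in /= ?Gg //.
  by move=> u; rewrite inE => /eqP->; exists (i, j).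
by rewrite /tri big_seq1.
Qed.

(** Inserting the central z between [EX p] and [W g] avoids straightening: its X part joins p, its Y
    part joins q, and the orders add. *)
Lemma fil_central z k h : (forall a, z * a = a * z) -> fil 1 z -> fil k h -> fil k.+1 (z * h).
Proof.
move=> zC [s [/allP Gs os zE]] [t [/allP Gt ot ->]]; rewrite /tri mulr_sumr big_seq.
apply: fil_sum => u tu; have [[i j] /= [kij op oq]] := ot u tu; have Gu := Gt u tu.
have -> : z * (EX u.1.1 * W u.1.2 * EY u.2) = \sum_(v <- s)
    EX (u.1.1 * v.1.1) * W (v.1.2 * u.1.2)%g * EY (sub (dual_repr rG u.1.2^-1%g) v.2 * u.2).
  rewrite !mulrA (zC (EX _)) -!mulrA zE /tri mulr_suml mulr_sumr !big_seq.
  apply: eq_bigr => v sv; have Gv := Gs v sv.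
  rewrite (co_XM ops) (co_WM ops) // (co_YM ops) !mulrA; congr (_ * _).
  by rewrite -!mulrA -co_YW // !mulrA.
rewrite big_seq; apply: fil_sum => v sv; have Gv := Gs v sv.
have [[i' j'] /= [kij' op' oq']] := os v sv.
apply: (fil_term (i := (i + i')%N) (j := (j' + j)%N)); first exact: groupM.
- exact: order_geM.
- by apply: order_geM => //; apply: order_sub.
by lia.
Qed.

Local Notation N := (n * #|G|).+1.

(** Total order at least 2N leaves order at least N to one of the two factors, which then lies in
    its Hilbert ideal. *)
Lemma fil_eq0 h : fil (N + N) h -> h = 0.
Proof.
case=> t [_ ot ->]; rewrite /tri big_seq big1 // => u /ot[[i j] /= [kij op oq]].
have [Ni|iN] := leqP N i.
  by rewrite coinvX0 ?mul0r //; apply/coinv_order/(order_geW Ni).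
have Nj : (N <= j)%N.
  by rewrite -(leq_add2l N); apply: leq_trans kij _; rewrite leq_add2r ltnW.
by rewrite [EY _]coinvY0 ?mulr0 //; apply/coinv_order/(order_geW Nj).
Qed.

(** Splitting off the constants of p and q leaves terms of order at least 1 and a combination of
    group elements, whose coefficients are those of [eps z]. *)
Lemma eps0_fil z : (forall g, eps z g = 0) -> fil 1 z.
Proof.
move=> z0; have [/allP Gt tE] := tri_ofP z; rewrite -tE /tri.
pose ct (p : mp) : mp := (constant_term p)%:MP.
have o1 p : order_ge 1 (p - ct p).
  by apply/order_ge1; rewrite constant_termD /ct -mpolyCN constant_termC subrr.
have split3 u : EX u.1.1 * W u.1.2 * EY u.2 =
    EX (u.1.1 - ct u.1.1) * W u.1.2 * EY u.2 + EX (ct u.1.1) * W u.1.2 * EY (u.2 - ct u.2)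
    + EX (constant_term u.1.1 * constant_term u.2)%:MP * W u.1.2.
  rewrite (co_XD ops) (co_YD ops) (co_XN ops) (co_YN ops) !mulrDl mulrDr -!addrA.
  rewrite -[LHS]addr0; congr (_ + _); rewrite mulNr mulNr addKr mulrN.
  rewrite /ct (co_YC ops) -(co_sC ops) mpolyCM (co_XM ops) !mulrA -!(co_XM ops).
  by rewrite -!mpolyCM mulrC addNr.
rewrite (eq_bigr _ (fun u _ => split3 u)) big_split big_split /= [X in _ + X](_ : _ = 0).
  rewrite addr0; apply: filD; rewrite big_seq; apply: fil_sum => u tu.
    exact: (fil_term (i := 1) (j := 0) (Gt u tu)).
  exact: (fil_term (i := 0) (j := 1) (Gt u tu)).
rewrite (partition_big (fun u : mp * gT * mp => u.1.2) predT) //= big1 // => g _.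
rewrite (eq_bigr (fun u : mp * gT * mp =>
  EX (constant_term u.1.1 * constant_term u.2)%:MP * W g)) => [|u /eqP-> //].
rewrite -mulr_suml -(co_Xsum ops) -raddf_sum /=.
by rewrite -[X in X%:MP]/(eps z g) z0 mpolyC0 (co_X0 ops) mul0r.
Qed.

Lemma eps0_nilpotent z : (forall a, z * a = a * z) -> (forall g, eps z g = 0) ->
  z ^+ (N + N) = 0.
Proof.
move=> zC z0; apply: fil_eq0; elim: (N + N)%N => [|k IH].
  rewrite expr0; have -> : 1 = EX 1 * W 1%g * EY 1 :> H.
    by rewrite (co_X1 ops) (co_Y1 ops) (co_W1 ops) !mulr1.
  exact: (fil_term (i := 0) (j := 0)).
by rewrite exprS; apply: fil_central => //; apply: eps0_fil.
Qed.

Lemma idempotent_exp (e : H) k : e * e = e -> e ^+ k.+1 = e.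
Proof. by move=> ee; elim: k => [|k IH]; rewrite ?expr1 // exprS IH. Qed.

(** The difference e - ef is a central idempotent with vanishing [eps], hence nilpotent, hence
    zero. *)
Lemma central_idempotent_eps_le e f : central_idempotent e -> central_idempotent f ->
  (forall g, eps e g = eps f g) -> e = e * f.
Proof.
move=> [ee eC] [ff fC] ef; apply/eqP; rewrite -subr_eq0; apply/eqP.
set z := e - e * f; have zC a : z * a = a * z.
  by rewrite /z mulrBl mulrBr eC -mulrA fC !mulrA eC.
have zz : z * z = z.
  have efe : e * f * e = e * f by rewrite -mulrA fC mulrA ee.
  rewrite /z mulrBl !mulrBr ee mulrA ee efe -!mulrA [f * _]mulrA [f * e]fC.
  by rewrite -!mulrA ff !mulrA ee subrr subr0.
have z0 g : eps z g = 0.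
  rewrite /z epsD epsN -{1}ee !eps_central //; apply/eqP; rewrite subr_eq0.
  by apply/eqP; apply: eq_bigr => k _; rewrite ef.
rewrite -(idempotent_exp (N + n * #|G|) zz).
by have := eps0_nilpotent zC z0; rewrite addnS.
Qed.

Lemma central_idempotent_eps e f : central_idempotent e -> central_idempotent f ->
  (forall g, eps e g = eps f g) -> e = f.
Proof.
move=> ce cf ef; rewrite (central_idempotent_eps_le ce cf ef).
by have [_ fC] := cf; rewrite -fC; apply/esym/central_idempotent_eps_le.
Qed.

Section Representation.
Variables (d : nat) (rE : mx_representation C G d).

(* 'rV_d is a left G-module through v |-> v *m rE g^-1. *)
Definition eps_mx (h : H) : 'M[C]_d := \sum_(g in G) eps h g *: rE g^-1%g.

Lemma eps_mxD a b : eps_mx (a + b) = eps_mx a + eps_mx b.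
Proof.
by rewrite /eps_mx -big_split; apply: eq_bigr => g _ /=; rewrite epsD scalerDl.
Qed.
Lemma eps_mxN a : eps_mx (- a) = - eps_mx a.
Proof. by rewrite /eps_mx -sumrN; apply: eq_bigr => g _; rewrite epsN scaleNr. Qed.
Lemma eps_mx0 : eps_mx 0 = 0.
Proof. by rewrite /eps_mx big1 // => g _; rewrite eps0 scale0r. Qed.
Lemma eps_mx1 : eps_mx 1 = 1%:M.
Proof.
rewrite /eps_mx (bigD1 1%g) //= eps1 eqxx scale1r invg1 repr_mx1 big1 ?addr0 // => g.
by case/andP=> _ g1; rewrite eps1 eq_sym (negPf g1) scale0r.
Qed.
Lemma eps_mxX p h : eps_mx (EX p * h) = constant_term p *: eps_mx h.
Proof.
by rewrite /eps_mx scaler_sumr; apply: eq_bigr => g _; rewrite epsX scalerA.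
Qed.
Lemma eps_mxY h q : eps_mx (h * EY q) = constant_term q *: eps_mx h.
Proof.
by rewrite /eps_mx scaler_sumr; apply: eq_bigr => g _; rewrite epsY scalerA.
Qed.
Lemma eps_mxWr h k : k \in G -> eps_mx (h * W k) = rE k^-1%g *m eps_mx h.
Proof.
move=> Gk; rewrite /eps_mx [LHS](reindex_inj (mulIg k)) /= mulmx_sumr.
apply: eq_big => [g|g]; first by rewrite groupMr.
rewrite groupMr // => Gg; rewrite epsWr // mulgK -scalemxAr invMg.
by rewrite repr_mxM ?groupV.
Qed.
Lemma eps_mxWl h k : k \in G -> eps_mx (W k * h) = eps_mx h *m rE k^-1%g.
Proof.
move=> Gk; rewrite /eps_mx [LHS](reindex_inj (mulgI k)) /= mulmx_suml.
apply: eq_big => [g|g]; first by rewrite groupMl.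
rewrite groupMl // => Gg; rewrite epsWl // mulKg -scalemxAl invMg.
by rewrite repr_mxM ?groupV.
Qed.

Lemma eps_mx_central z h : (forall a, z * a = a * z) ->
  eps_mx (z * h) = eps_mx h *m eps_mx z.
Proof.
move=> zC; elim/eps_ind: h => [|a b Ea Eb|p k q Gk].
- by rewrite mulr0 eps_mx0 mul0mx.
- by rewrite mulrDr !eps_mxD Ea Eb mulmxDl.
have EW : eps_mx (W k) = rE k^-1%g by rewrite -[W k]mul1r eps_mxWr // eps_mx1 mulmx1.
by rewrite !mulrA !eps_mxY zC -!mulrA !eps_mxX eps_mxWr // EW -!scalemxAl.
Qed.

(** The matrix is an idempotent intertwiner and its row space a submodule, hence zero or everything;
    an invertible idempotent is 1. *)
Lemma central_idempotent_mx e : mx_irreducible rE -> central_idempotent e ->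
  eps_mx e = 0 \/ eps_mx e = 1%:M.
Proof.
move=> /mx_irrP[_ irrE] [ee eC].
have M2 : eps_mx e *m eps_mx e = eps_mx e by rewrite -eps_mx_central // ee.
have [->|nz] := eqVneq (eps_mx e) 0; [by left|right].
have modM : mxmodule rE (eps_mx e).
  apply/mxmoduleP => k Gk; rewrite -[k]invgK -eps_mxWl ?groupV // -eC.
  by rewrite eps_mxWr ?groupV // submxMl.
have u : eps_mx e \in unitmx by rewrite -row_full_unit; apply: irrE.
by rewrite -[LHS](mulKmx u) M2 mulVmx.
Qed.

End Representation.

Lemma eps_mx_faithful (sG : irrType C G) h h' : [pchar C]^'.-group G ->
  (forall l : sG, eps_mx (irr_repr l) h = eps_mx (irr_repr l) h') ->
  forall g, eps h g = eps h' g.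
Proof.
move=> C'G E g; apply/eqP; rewrite -subr_eq0; apply/eqP.
have [Gg|nGg] := boolP (g \in G); last by rewrite !eps_out // subrr.
rewrite -[g]invgK; apply: (irr_repr_faithful (sG := sG) (a := fun x => eps h x^-1%g - eps h' x^-1%g) C'G); last by rewrite groupV.
move=> i; have := E i; move/eqP; rewrite -subr_eq0 => /eqP E0; rewrite -[RHS]E0.
rewrite /eps_mx -sumrB [RHS](reindex_inj invg_inj) /=.
apply: eq_big => [x|x Gx]; first by rewrite groupV.
by rewrite invgK scalerBl.
Qed.

End RestrictedAlgebra.

(** * Baby Verma modules and their heads *)

Section Verma.
Variables (C : fieldType) (gT : finGroupType) (G : {group gT}) (n : nat).
Variable rG : mx_representation C G n.
Hypothesis C0 : [pchar C] =i pred0.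
Local Notation mp := (mpoly n C).
Variables (H : pzRingType) (c : gT -> C) (W : gT -> H) (EX EY : mp -> H).
Hypothesis ro : restricted_ops rG c W EX EY.
Let ops := ro_ops ro.
Variables (d : nat) (rE : mx_representation C G d).
Local Notation N := (n * #|G|).+1.
Local Notation em := (eps_mx ro rE).

Definition vtens (h : H) (v : 'rV[C]_d) : 'rV[H]_d := \row_i (h * EX (v 0 i)%:MP).

Definition vrel (m : 'rV[H]_d) : Prop :=
  exists h f g v, g \in G /\
    m = vtens (h * (EY f * W g)) v - vtens h (constant_term f *: (v *m rE g^-1%g)).

Local Notation M := (mod_quot vrel).

Lemma vtensDl h h' v : vtens (h + h') v = vtens h v + vtens h' v.
Proof. by apply/rowP => i; rewrite !mxE mulrDl. Qed.
Lemma vtensDr h v v' : vtens h (v + v') = vtens h v + vtens h v'.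
Proof. by apply/rowP => i; rewrite !mxE mpolyCD (co_XD ops) mulrDr. Qed.
Lemma vtens0 h : vtens h 0 = 0.
Proof. by apply/rowP => i; rewrite !mxE mpolyC0 (co_X0 ops) mulr0. Qed.
Lemma vtens0l v : vtens 0 v = 0.
Proof. by apply/rowP => i; rewrite !mxE mul0r. Qed.
Lemma vtensZ h a v : vtens h (a *: v) = vtens (h * EX a%:MP) v.
Proof. by apply/rowP => i; rewrite !mxE mpolyCM (co_XM ops) mulrA. Qed.
Lemma vtens_scale a h v : a *: vtens h v = vtens (a * h) v.
Proof. by apply/rowP => i; rewrite !mxE mulrA. Qed.
Lemma vtens_row (r : 'rV[H]_d) : r = \sum_i vtens (r 0 i) (delta_mx 0 i).
Proof.
apply/rowP => j; rewrite summxE (bigD1 j) //= !mxE !eqxx mpolyC1 (co_X1 ops) mulr1.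
rewrite big1 ?addr0 // => i ij; rewrite !mxE eqxx eq_sym (negPf ij).
by rewrite mpolyC0 (co_X0 ops) mulr0.
Qed.

(** Projection of the baby Verma module to its bottom part E, all positive degree polynomials in X
    being sent to zero. *)
Definition ev (r : 'rV[H]_d) : 'rV[C]_d := \sum_i delta_mx 0 i *m em (r 0 i).

Lemma evD r r' : ev (r + r') = ev r + ev r'.
Proof.
by rewrite /ev -big_split; apply: eq_bigr => i _; rewrite mxE eps_mxD mulmxDr.
Qed.
Lemma evN r : ev (- r) = - ev r.
Proof. by rewrite /ev -sumrN; apply: eq_bigr => i _; rewrite mxE eps_mxN mulmxN. Qed.

Lemma ev_tens h v : ev (vtens h v) = v *m em h.
Proof.
rewrite /ev {2}(row_sum_delta v) mulmx_suml; apply: eq_bigr => i _.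
by rewrite mxE -(co_sC ops) eps_mxX constant_termC -scalemxAl scalemxAr.
Qed.

Lemma evX p r : ev (EX p *: r) = constant_term p *: ev r.
Proof.
by rewrite /ev scaler_sumr; apply: eq_bigr => i _; rewrite mxE eps_mxX scalemxAr.
Qed.

Lemma evW g r : g \in G -> ev (W g *: r) = ev r *m rE g^-1%g.
Proof.
move=> Gg; rewrite /ev mulmx_suml; apply: eq_bigr => i _.
by rewrite mxE eps_mxWl // mulmxA.
Qed.

(** The largest submodule inside the kernel of [ev]; its image in the baby Verma module is a maximal
    submodule. *)
Definition ev_null (r : 'rV[H]_d) : Prop := forall a, ev (a *: r) = 0.

Lemma ev_null_submod : submodule ev_null.
Proof.
split=> [a|u v u0 v0 a|a v v0 b]; first by rewrite scaler0 /ev big1 // => i _; rewrite mxE eps_mx0 mulmx0.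
  by rewrite scalerBr evD evN u0 v0 subr0.
by rewrite scalerA.
Qed.

Lemma vrel_null r : vrel r -> ev_null r.
Proof.
move=> [h [f [g [v [Gg ->]]]]] a; rewrite scalerBr evD evN !vtens_scale !ev_tens !mulrA.
by rewrite eps_mxWr // eps_mxY -!scalemxAr -scalemxAl mulmxA subrr.
Qed.

Lemma mod_proj_ev r r' : mod_proj vrel r = mod_proj vrel r' ->
  forall a, ev (a *: r) = ev (a *: r').
Proof.
move/mod_projP/submod_genP=> /(_ _ ev_null_submod vrel_null) E a.
by apply/eqP; rewrite -subr_eq0 -evN -evD -scalerN -scalerDr E.
Qed.

Definition bt (h : H) (v : 'rV[C]_d) : M := mod_proj vrel (vtens h v).

Lemma btDl h h' v : bt (h + h') v = bt h v + bt h' v.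
Proof. by rewrite /bt vtensDl mod_projD. Qed.
Lemma btDr h v v' : bt h (v + v') = bt h v + bt h v'.
Proof. by rewrite /bt vtensDr mod_projD. Qed.
Lemma mod_proj0 : mod_proj vrel 0 = 0.
Proof. by apply: (addrI (mod_proj vrel 0)); rewrite -mod_projD !addr0. Qed.
Lemma bt0 h : bt h 0 = 0. Proof. by rewrite /bt vtens0 mod_proj0. Qed.
Lemma bt0l v : bt 0 v = 0. Proof. by rewrite /bt vtens0l mod_proj0. Qed.
Lemma bt_scale a h v : a *: bt h v = bt (a * h) v.
Proof. by rewrite /bt -mod_projZ vtens_scale. Qed.
Lemma btZ h a v : bt h (a *: v) = bt (h * EX a%:MP) v.
Proof. by rewrite /bt vtensZ. Qed.

Lemma bt_rel h f g v : g \in G ->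
  bt (h * (EY f * W g)) v = bt h (constant_term f *: (v *m rE g^-1%g)).
Proof.
move=> Gg; apply/mod_projP/submod_genP => L _; apply.
by exists h, f, g, v.
Qed.

Lemma bt_term p g q v : g \in G ->
  bt (EX p * W g * EY q) v = EX p *: bt 1 (constant_term q *: (v *m rE g^-1%g)).
Proof.
move=> Gg; rewrite -mulrA (co_WYp ops) // bt_rel // constant_term_sub.
by rewrite bt_scale mulr1.
Qed.

Lemma em_term p g q : g \in G ->
  em (EX p * W g * EY q) = (constant_term p * constant_term q) *: rE g^-1%g.
Proof.
move=> Gg; rewrite eps_mxY -[W g]mul1r mulrA eps_mxWr // mulr1 -[EX p]mulr1 eps_mxX.
by rewrite eps_mx1 -scalemxAr mulmx1 scalerA mulrC.
Qed.

Definition Xfil (k : nat) (m : M) : Prop := exists s : seq (mp * 'rV[C]_d),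
  (forall u, u \in s -> order_ge k u.1) /\ m = \sum_(u <- s) EX u.1 *: bt 1 u.2.

Lemma Xfil0 k : Xfil k 0. Proof. by exists [::]; rewrite big_nil. Qed.
Lemma XfilD k a b : Xfil k a -> Xfil k b -> Xfil k (a + b).
Proof.
move=> [s [os ->]] [t [ot ->]]; exists (s ++ t); rewrite big_cat; split=> // u.
by rewrite mem_cat => /orP[/os|/ot].
Qed.
Lemma Xfil_sum k (I : Type) (r : seq I) (P : pred I) (F : I -> M) :
  (forall i, P i -> Xfil k (F i)) -> Xfil k (\sum_(i <- r | P i) F i).
Proof. by move=> FF; apply: (big_ind (Xfil k)) => //; [exact: Xfil0|exact: XfilD]. Qed.
Lemma XfilX j k p m : order_ge j p -> Xfil k m -> Xfil (j + k) (EX p *: m).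
Proof.
move=> op [s [os ->]]; exists [seq (p * u.1, u.2) | u <- s]; split.
  by move=> u /mapP[v /os ov ->] /=; apply: order_geM.
rewrite big_map scaler_sumr; apply: eq_bigr => u _ /=.
by rewrite scalerA (co_XM ops).
Qed.
Lemma Xfil_eq0 m : Xfil N m -> m = 0.
Proof.
case=> s [os ->]; rewrite big_seq big1 // => u /os ou.
by rewrite (coinvX0 ro) ?scale0r //; apply: coinv_order.
Qed.

Lemma Xfil_term k p v : order_ge k p -> Xfil k (EX p *: bt 1 v).
Proof. by move=> op; exists [:: (p, v)]; rewrite big_seq1; split=> // u; rewrite inE => /eqP->. Qed.

Lemma bt_split h v : exists2 m, Xfil 1 m & bt h v = bt 1 (v *m em h) + m.
Proof.
elim/(eps_ind ro): h => [|a b [ma Xa Ea] [mb Xb Eb]|p g q Gg].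
- by exists 0; [exact: Xfil0|rewrite bt0l eps_mx0 mulmx0 bt0 addr0].
- exists (ma + mb); first exact: XfilD.
  by rewrite btDl Ea Eb eps_mxD mulmxDr btDr addrACA.
set u := constant_term q *: (v *m rE g^-1%g).
exists (EX (p - (constant_term p)%:MP) *: bt 1 u).
  by apply/Xfil_term/order_ge1; rewrite constant_termD -mpolyCN constant_termC subrr.
rewrite bt_term // -/u em_term // -scalemxAr -scalerA -/u; clearbody u; rewrite btZ mul1r.
have -> : bt (EX (constant_term p)%:MP) u = EX (constant_term p)%:MP *: bt 1 u.
  by rewrite bt_scale mulr1.
by rewrite -scalerDl -(co_XD ops) addrC subrK.
Qed.

(** With zero matrix, f pushes the bottom part into positive X order. As f is idempotent and
    commutes with X, applying it again raises the order each time, up to where everything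
    vanishes. *)
Lemma bt_kill f v : central_idempotent f -> em f = 0 -> bt f v = 0.
Proof.
move=> [ff fC] f0; have X1 u : Xfil 1 (bt f u).
  by have [m Xm ->] := bt_split f u; rewrite f0 mulmx0 bt0 add0r.
suff Xk k : Xfil k.+1 (bt f v) by apply: Xfil_eq0; apply: Xk.
elim: k => [|k [s [os Es]]]; first exact: X1.
rewrite -ff -bt_scale Es scaler_sumr big_seq -[k.+2]addn1; apply: Xfil_sum => u su.
rewrite scalerA fC -scalerA bt_scale mulr1.
by apply: XfilX => //; apply: os.
Qed.

Lemma mod_proj_sum (I : Type) (r : seq I) (P : pred I) (F : I -> 'rV[H]_d) :
  mod_proj vrel (\sum_(i <- r | P i) F i) = \sum_(i <- r | P i) mod_proj vrel (F i).
Proof. exact: (big_morph _ (@mod_projD _ _ _) mod_proj0). Qed.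

Lemma mod_proj_bt r : mod_proj vrel r = \sum_i r 0 i *: bt 1 (delta_mx 0 i).
Proof.
rewrite {1}[r]vtens_row mod_proj_sum; apply: eq_bigr => i _.
by rewrite bt_scale mulr1.
Qed.

Lemma verma_kill f (q : M) : central_idempotent f -> em f = 0 -> f *: q = 0.
Proof.
move=> cf f0; have [ff fC] := cf; rewrite -[q]mod_projK mod_proj_bt scaler_sumr.
rewrite big1 // => i _; rewrite scalerA fC -scalerA bt_scale mulr1 bt_kill ?scaler0 //.
Qed.

Hypothesis irrE : mx_irreducible rE.

Definition verma_rad (q : M) : Prop := forall r, mod_proj vrel r = q -> ev_null r.

Lemma verma_radE r : verma_rad (mod_proj vrel r) <-> ev_null r.
Proof.
split=> [|r0 r' E a]; first exact.
by rewrite (mod_proj_ev E).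
Qed.

Lemma mod_projN r : mod_proj vrel (- r) = - mod_proj vrel r.
Proof. by apply/eqP; rewrite -addr_eq0 -mod_projD addNr mod_proj0. Qed.

Lemma verma_rad_submod : submodule verma_rad.
Proof.
have [I0 IB IZ] := ev_null_submod.
split=> [|u v|a v]; first by rewrite -mod_proj0; apply/verma_radE.
  rewrite -[u]mod_projK -[v]mod_projK => /verma_radE u0 /verma_radE v0.
  by rewrite -mod_projN -mod_projD; apply/verma_radE/IB.
by rewrite -[v]mod_projK => /verma_radE v0; rewrite -mod_projZ; apply/verma_radE/IZ.
Qed.

Lemma bt_not_rad v : v != 0 -> ~ verma_rad (bt 1 v).
Proof.
move=> v0 /verma_radE/(_ 1); rewrite scale1r ev_tens eps_mx1 mulmx1 => v1.
by rewrite v1 eqxx in v0.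
Qed.

Lemma verma_nonzero_vec : exists v : 'rV[C]_d, v != 0.
Proof.
have [d0 _] := proj1 (mx_irrP rE) irrE; exists (delta_mx 0 (Ordinal d0)).
by apply/eqP => /rowP/(_ (Ordinal d0)); rewrite !mxE !eqxx => /eqP; rewrite oner_eq0.
Qed.

(** A larger submodule L has an element with nonzero [ev]. By irreducibility of E every v is then
    the bottom part of an element of L, and correcting the error repeatedly pushes it to an X order
    where it vanishes; so L contains the generators. *)
Lemma verma_rad_max : maximal_submodule verma_rad.
Proof.
split; first exact: verma_rad_submod.
  by have [v v0] := verma_nonzero_vec; exists (bt 1 v); apply: bt_not_rad.
move=> L [L0 LB LZ] radL.
have LN u : L u -> L (- u) by move=> Lu; rewrite -[- u]add0r; apply: LB.
have LD u v : L u -> L v -> L (u + v).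
  by move=> Lu Lv; rewrite -[v]opprK; apply: LB => //; apply: LN.
have Lsum (I : eqType) (s : seq I) (F : I -> M) :
    (forall i, i \in s -> L (F i)) -> L (\sum_(i <- s) F i).
  by move=> LF; rewrite big_seq; apply: (big_ind L).
have [Lrad|nLrad] := pselect (forall v, L v -> verma_rad v); [by left|right].
have [r [Lr nr]] : exists r, L (mod_proj vrel r) /\ ~ ev_null r.
  apply: contrapT => nex; apply: nLrad => v; rewrite -[v]mod_projK => Lv.
  by apply/verma_radE; apply: contrapT => nv; apply: nex; exists (generic_quotient.repr v).
have [a a0] : exists a, ev (a *: r) != 0.
  by apply: contrapT => nex; apply: nr => a; apply/eqP; apply: contrapT => /negP ra; apply: nex; exists a.
have LE v : exists2 m, L m & exists2 x, Xfil 1 x & bt 1 v = m + x.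
  have [d0 minE] := proj1 (mx_irrP rE) irrE.
  have := minE _ (cyclic_mx_module rE (ev (a *: r))); rewrite cyclic_mx_eq0 => /(_ a0) full.
  have /cyclic_mxP[A /envelop_mxP[k ->] def_v] := submx_full v full.
  (* The combination of group elements that carries [ev (a *: r)] to v in E, applied to r itself so
     as to stay in L. *)
  pose w := \sum_(g in G) EX (k g)%:MP *: (W g^-1%g *: (a *: r)).
  have Lw : L (mod_proj vrel w).
    rewrite /w mod_proj_sum; apply: (big_ind L) => // g _.
    by rewrite !mod_projZ; do 3!apply: (LZ).
  have ev_w : ev w = v.
    have ev0 : ev 0 = 0 by rewrite /ev big1 // => i _; rewrite mxE eps_mx0 mulmx0.
    rewrite def_v /w (big_morph ev evD ev0) mulmx_sumr; apply: eq_bigr => g Gg.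
    by rewrite evX constant_termC evW ?groupV // invgK scalemxAr.
  have [x Xx Ex] : exists2 x, Xfil 1 x & mod_proj vrel w = bt 1 (ev w) + x.
    rewrite {1}[w]vtens_row mod_proj_sum /ev.
    elim/big_rec2: _ => [|i u m _ [x Xx ->]]; first by exists 0; [exact: Xfil0|rewrite bt0 addr0].
    have [y Xy Ey] := bt_split (w 0 i) (delta_mx 0 i).
    exists (y + x); first exact: XfilD.
    by rewrite -[mod_proj _ _]/(bt _ _) Ey btDr addrACA.
  exists (mod_proj vrel w) => //; exists (- x).
    rewrite -scaleN1r -(co_X1 ops) -(co_XN ops); exact: (XfilX (j := 0)).
  by rewrite Ex ev_w addrK.
have LEk k v : exists2 m, L m & exists2 x, Xfil k.+1 x & bt 1 v = m + x.
  elim: k v => [|k IH] v; first exact: LE.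
  have [m Lm [x [s [os ->]] ->]] := IH v.
  suff [m' Lm' [x' Xx' ->]] : exists2 m', L m' & exists2 x', Xfil k.+2 x'
      & \sum_(u <- s) EX u.1 *: bt 1 u.2 = m' + x'.
    by exists (m + m'); [apply: LD|exists x' => //; rewrite addrA].
  elim: s os => [|u s IHs] os.
    by exists 0 => //; exists 0; [exact: Xfil0|rewrite big_nil addr0].
  have [m1 Lm1 [x1 X1 E1]] := IHs (fun v sv => os v (mem_behead (s := u :: s) sv)).
  have [m2 Lm2 [x2 X2 E2]] := LE u.2.
  exists (EX u.1 *: m2 + m1); first by apply: LD => //; apply: LZ.
  exists (EX u.1 *: x2 + x1).
    apply: XfilD => //; rewrite -[k.+2]addn1; apply: XfilX => //.
    by apply: os; rewrite mem_head.
  by rewrite big_cons E1 E2 scalerDr addrACA.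
have L1 v : L (bt 1 v).
  by have [m Lm [x Xx ->]] := LEk (n * #|G|)%N v; rewrite (Xfil_eq0 Xx) addr0.
by move=> q; rewrite -[q]mod_projK mod_proj_bt; apply: (big_ind L) => // i _; apply: LZ.
Qed.

(** An idempotent with zero matrix kills the whole baby Verma module, which settles e or 1 - e.
    Conversely the head is not zero, because the maximal submodule [verma_rad] misses [bt 1 v]. *)
Lemma head_block e : central_idempotent e ->
  in_block e (Defs.head M) <-> em e = 1%:M.
Proof.
move=> ce; have [ee eC] := ce; split=> [be|e1 v].
  have [e0|//] := central_idempotent_mx ro irrE ce.
  have [v v0] := verma_nonzero_vec.
  have /mod_projP : mod_proj (@radical _ M) (bt 1 v) = mod_proj (@radical _ M) 0.
    rewrite -[LHS]be -mod_projZ (verma_kill _ ce e0).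
    by [].
  rewrite subr0 => /submod_genP/(_ _ verma_rad_submod) bad.
  by case: (bt_not_rad v0); apply: bad => q; apply; apply: verma_rad_max.
rewrite -[v]mod_projK -mod_projZ; congr mod_proj; move: (generic_quotient.repr v) => q.
have c1 : central_idempotent (1 - e).
  split=> [|a]; last by rewrite mulrBl mulrBr mul1r mulr1 eC.
  by rewrite mulrBl !mulrBr !mul1r !mulr1 ee subrr subr0.
have := verma_kill q c1; rewrite eps_mxD eps_mxN eps_mx1 e1 subrr => /(_ erefl).
by rewrite scalerBl scale1r => /eqP; rewrite subr_eq0 eq_sym => /eqP.
Qed.

End Verma.

Section BabyVerma.
Variables (C : fieldType) (gT : finGroupType) (G : {group gT}) (n : nat).
Variable rG : mx_representation C G n.
Hypothesis C0 : [pchar C] =i pred0.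
Variable c : gT -> C.
Hypothesis cG : forall s w, s \in reflections rG -> w \in G -> c (s ^ w)%g = c s.
Variables (d : nat) (rE : mx_representation C G d).
Let ro := hbar_restricted_ops C0 cG.

Lemma to_hbar_scalar a : to_hbar rG c a%:A = hX rG c a%:MP.
Proof.
exact: (esym (free_scalarX (G := G) (n := n) (to_hbar rG c) a)).
Qed.

Lemma tens_vtens h (v : 'rV[C]_d) : tens h v = vtens (hX rG c) h v.
Proof.
apply/rowP => i; rewrite [LHS]mxE [RHS]mxE.
exact: (congr1 (fun z => h * z) (to_hbar_scalar (v 0 i))).
Qed.

Lemma to_restricted_YW f (g : subg_of G) :
  to_restricted rG c (eval_Y G f * Defs.gW C n g) = hY rG c f * hW rG c (sgval g).
Proof.
have E := congr1 (fun w => to_hbar rG c (Defs.gW C n w)) (esym (sgvalK g)).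
exact: (etrans (to_hbarM _ _ _ _) (congr1 (fun z => hY rG c f * z) E)).
Qed.

Lemma verma_gen_eq h f (g : subg_of G) (v u : 'rV[C]_d) :
  tens (h * to_restricted rG c (eval_Y G f * Defs.gW C n g)) v - tens h u
  = vtens (hX rG c) (h * (hY rG c f * hW rG c (sgval g))) v - vtens (hX rG c) h u.
Proof.
have E := congr1 (fun z => vtens (hX rG c) (h * z) v) (to_restricted_YW f g).
exact: (f_equal2 (fun a b => a - b) (etrans (tens_vtens _ v) E) (tens_vtens h u)).
Qed.

Lemma verma_relE : verma_rel (rG := rG) (c := c) rE
  = vrel (hW rG c) (hX rG c) (hY rG c) rE.
Proof.
apply/funext => m; apply/propext; split=> [[h [f [g [v mE]]]]|[h [f [g [v [Gg mE]]]]]].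
  exists h, f, (sgval g), v; split; first exact: subgP.
  exact: (etrans mE (verma_gen_eq h f g v _)).
have E := verma_gen_eq h f (subg G g) v (constant_term f *: (v *m rE g^-1%g)).
have gK : sgval (subg G g) = g by rewrite subgK.
exists h, f, (subg G g), v.
by rewrite gK; rewrite gK in E; exact: (etrans mE (esym E)).
Qed.

End BabyVerma.

Lemma in_block_head (C : fieldType) (gT : finGroupType) (G : {group gT}) (n : nat)
    (rG : mx_representation C G n) (C0 : [pchar C] =i pred0) (c : gT -> C)
    (cG : forall s w, s \in reflections rG -> w \in G -> c (s ^ w)%g = c s)
    (sG : irrType C G) (l : sG) e :
  [pchar C]^'.-group G -> central_idempotent e ->
  in_block e (simple_head rG c l)
    <-> eps_mx (hbar_restricted_ops C0 cG) (irr_repr l) e = 1%:M.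
Proof.
move=> C'G ce; rewrite /simple_head /baby_verma verma_relE.
exact: (head_block (hbar_restricted_ops C0 cG) (socle_irr l) ce).
Qed.

(** * Families as atoms of a Boolean algebra *)

Section BlockSets.
Variables (C : fieldType) (gT : finGroupType) (G : {group gT}) (n : nat).
Variable rG : mx_representation C G n.
Hypothesis C0 : [pchar C] =i pred0.
Variables (H : pzRingType) (c : gT -> C) (W : gT -> H) (EX EY : mpoly n C -> H).
Hypothesis ro : restricted_ops rG c W EX EY.
Variable sG : irrType C G.
Local Notation em l := (eps_mx ro (irr_repr l)).

Definition represents (S : {set sG}) (e : H) : Prop :=
  central_idempotent e /\ forall l : sG, em l e = (l \in S)%:R%:M.

Definition block_set (S : {set sG}) : Prop := exists e, represents S e.

Lemma irr_one_neq0 (l : sG) : (1%:M : 'M[C]_(irr_degree l)) != 0.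
Proof.
have [d0 _] := proj1 (mx_irrP (irr_repr l)) (socle_irr l).
by apply/eqP => /matrixP/(_ (Ordinal d0) (Ordinal d0)); rewrite !mxE eqxx => /eqP; rewrite oner_eq0.
Qed.

Lemma central_idempotent1 : central_idempotent (1 : H).
Proof. by split=> [|a]; rewrite ?mulr1 ?mul1r. Qed.

Lemma central_idempotentC (e : H) : central_idempotent e -> central_idempotent (1 - e).
Proof.
move=> [ee eC]; split=> [|a]; last by rewrite mulrBl mulrBr mul1r mulr1 eC.
by rewrite mulrBl !mulrBr !mul1r !mulr1 ee subrr subr0.
Qed.

Lemma central_idempotentM (e f : H) :
  central_idempotent e -> central_idempotent f -> central_idempotent (e * f).
Proof.
move=> [ee eC] [ff fC]; split=> [|a]; last by rewrite -mulrA fC !mulrA eC.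
by rewrite -mulrA (mulrA f) fC -!mulrA ff mulrA ee.
Qed.

Lemma represents_of e : central_idempotent e -> represents [set l | em l e == 1%:M] e.
Proof.
move=> ce; split=> // l; rewrite inE.
have [->|->] := central_idempotent_mx ro (socle_irr l) ce; last by rewrite eqxx.
by rewrite eq_sym (negPf (irr_one_neq0 l)); apply/matrixP => i j; rewrite !mxE mul0rn.
Qed.

(** The scalars on all irreducible representations determine [eps], and [eps] determines a central
    idempotent. *)
Lemma represents_inj S e f : [pchar C]^'.-group G ->
  represents S e -> represents S f -> e = f.
Proof.
move=> C'G [ce Ee] [cf Ef]; apply: (central_idempotent_eps (ro := ro) ce cf).
by apply: (eps_mx_faithful (ro := ro) (sG := sG) C'G) => l; rewrite Ee Ef.
Qed.

Lemma representsT : represents setT 1.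
Proof. by split=> [|l]; [exact: central_idempotent1|rewrite inE eps_mx1]. Qed.

Lemma representsC S e : represents S e -> represents (~: S) (1 - e).
Proof.
move=> [ce Ee]; split=> [|l]; first exact: central_idempotentC.
rewrite eps_mxD eps_mxN eps_mx1 Ee inE; apply/matrixP => i j; rewrite !mxE.
by case: (l \in S); rewrite /= ?subrr ?mul0rn ?subr0.
Qed.

Lemma representsI S T e f : represents S e -> represents T f -> represents (S :&: T) (e * f).
Proof.
move=> [ce Ee] [cf Ef]; split=> [|l]; first exact: central_idempotentM.
rewrite eps_mx_central ?Ee ?Ef -?scalar_mxM ?inE; last exact: ce.2.
by case: (l \in S); case: (l \in T); rewrite /= ?mulr0 ?mul0r ?mulr1.
Qed.

Lemma block_setT : block_set setT. Proof. by exists 1; apply: representsT. Qed.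
Lemma block_setC S : block_set S -> block_set (~: S).
Proof. by move=> [e Se]; exists (1 - e); apply: representsC. Qed.
Lemma block_setI S T : block_set S -> block_set T -> block_set (S :&: T).
Proof. by move=> [e Se] [f Tf]; exists (e * f); apply: representsI. Qed.

End BlockSets.

Section BooleanAtoms.
Variables (X : finType) (B : {set X} -> Prop).
Hypothesis BT : B setT.
Hypothesis BC : forall S, B S -> B (~: S).
Hypothesis BI : forall S T, B S -> B T -> B (S :&: T).

Definition atom (x : X) : {set X} := \bigcap_(S : {set X} | `[< B S >] && (x \in S)) S.

Lemma atom_mem x : x \in atom x.
Proof. by apply/bigcapP => S /andP[]. Qed.

Lemma atom_set x : B (atom x).
Proof.
apply: (big_ind B) => [|S T|S /andP[/asboolP]] //; exact: BI.
Qed.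

Lemma atom_sub x S : B S -> x \in S -> atom x \subset S.
Proof. by move=> BS xS; apply: bigcap_inf; rewrite xS andbT; apply/asboolP. Qed.

Lemma atomP x y : reflect (forall S, B S -> (x \in S) = (y \in S)) (y \in atom x).
Proof.
apply: (iffP idP) => [yx S BS|E]; last first.
  by rewrite -(E _ (atom_set x)) atom_mem.
have [xS|nxS] := boolP (x \in S); first by rewrite (subsetP (atom_sub BS xS)).
have xC : x \in ~: S by rewrite inE.
by have := subsetP (atom_sub (BC BS) xC) y yx; rewrite inE => /negPf->.
Qed.

Lemma atom_eq x y : y \in atom x -> atom y = atom x.
Proof.
move/atomP => E; apply/setP => z; apply/atomP/atomP => Ez S BS.
  by rewrite E ?Ez.
by rewrite -E ?Ez.
Qed.

Lemma setU_closed S T : B S -> B T -> B (S :|: T).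
Proof. by move=> BS BU; rewrite -[_ :|: _]setCK setCU; apply/BC/BI; apply: BC. Qed.

Lemma set0_closed : B set0. Proof. by rewrite -setCT; apply: BC. Qed.
End BooleanAtoms.

Section BlockEquivalence.
Variables (C : fieldType) (gT : finGroupType) (G : {group gT}) (n : nat).
Variable rG : mx_representation C G n.
Hypothesis C0 : [pchar C] =i pred0.
Variables (H : pzRingType) (c : gT -> C) (W : gT -> H) (EX EY : mpoly n C -> H).
Hypothesis ro : restricted_ops rG c W EX EY.
Variable sG : irrType C G.
Hypothesis C'G : [pchar C]^'.-group G.
Local Notation em l := (eps_mx ro (irr_repr l)).
Local Notation B := (block_set ro (sG := sG)).

Lemma block_equivP (l m : sG) :
  (exists b : H, [/\ block_idempotent b, em l b = 1%:M & em m b = 1%:M])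
  <-> forall S, B S -> (l \in S) = (m \in S).
Proof.
have em10 (x : sG) : (1%:M : 'M[C]_(irr_degree x)) <> 0 by apply/eqP/irr_one_neq0.
split=> [[b [[cb b0 prim] bl bm]] S [e [ce Ee]]|E].
  have cbe := central_idempotentM cb ce.
  have cbe' := central_idempotentM cb (central_idempotentC ce).
  have dec : b = b * e + b * (1 - e) by rewrite -mulrDr addrC subrK mulr1.
  have orth : (b * e) * (b * (1 - e)) = 0.
    rewrite -mulrA (mulrA e) ce.2 -!mulrA mulrBr mulr1 ce.1 subrr !mulr0 //.
  have val (x : sG) : em x b = 1%:M -> em x (b * e) = (x \in S)%:R%:M /\ em x (b * (1 - e)) = (x \notin S)%:R%:M.
    move=> bx; have [_ Ee'] := representsC (conj ce Ee).
    by rewrite !eps_mx_central ?bx ?mulmx1 ?Ee ?Ee' ?inE //; apply: cb.2.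
  have [l1 l2] := val l bl; have [m1 m2] := val m bm.
  have [be0|be0] := prim _ _ cbe cbe' orth dec.
    move: l1 m1; rewrite be0 !eps_mx0.
    case: (l \in S) => [E0|_]; first by case: (em10 l (esym E0)).
    by case: (m \in S) => [E0|//]; case: (em10 m (esym E0)).
  move: l2 m2; rewrite be0 !eps_mx0.
  case: (l \in S) => [_|E0]; last by case: (em10 l (esym E0)).
  by case: (m \in S) => [//|E0]; case: (em10 m (esym E0)).
have BT : B setT := block_setT ro sG.
have BC := @block_setC _ _ _ _ _ _ _ _ _ _ ro sG.
have BI := @block_setI _ _ _ _ _ _ _ _ _ _ ro sG.
have [b [cb Eb]] := atom_set BT BI l.
have lA := atom_mem B l; have mA : m \in atom B l by apply/(atomP BT BC BI).
exists b; split; last 2 first.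
- by rewrite Eb lA.
- by rewrite Eb mA.
split=> // [b0|e f ce cf ef0 bE]; first by apply: (em10 l); have := Eb l; rewrite b0 eps_mx0 lA.
have Re := represents_of ro sG ce; have Rf := represents_of ro sG cf.
set S := [set _ | _] in Re; set T := [set _ | _] in Rf.
have ST : S :|: T = atom B l /\ S :&: T = set0.
  have disj : S :&: T = set0.
    apply/setP => x; have [_ E1] := representsI Re Rf; have := E1 x.
    rewrite ef0 eps_mx0 in_set0; case: (x \in S :&: T) => [E2|//].
    by case: (em10 x (esym E2)).
  split=> //; apply/setP => x; have := Eb x; rewrite bE eps_mxD Re.2 Rf.2 in_setU.
  move/setP/(_ x): disj; rewrite in_set0 in_setI.
  have n1 : (1%:M : 'M[C]_(irr_degree x)) != 0 by apply: irr_one_neq0.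
  have z0 : ((0 : C)%:M : 'M[C]_(irr_degree x)) = 0 by rewrite raddf0.
  case: (x \in S); case: (x \in T) => // _; case: (x \in atom B l) => //;
    rewrite /= ?mulr0n ?mulr1n ?z0 ?addr0 ?add0r => /eqP;
    by rewrite ?(eq_sym 0) (negPf n1).
have [SU SI] := ST.
(* An idempotent that represents the empty set has the same scalars as 0, hence equals 0. *)
have zero (g : H) (U : {set sG}) : represents ro U g -> U = set0 -> g = 0.
  move=> Rg U0; apply: (represents_inj C'G Rg); rewrite U0.
  split; first by split=> [|a]; rewrite ?mulr0 ?mul0r.
  by move=> x; rewrite eps_mx0 inE; apply/matrixP => i j; rewrite !mxE mul0rn.
have : l \in S :|: T by rewrite SU.
case/setUP=> lS; [right|left].
  apply: (zero _ _ Rf); apply/eqP; rewrite -subset0 -SI subsetI subxx andbT.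
  by apply: subset_trans (atom_sub (B := B) (ex_intro _ e Re) lS); rewrite -SU subsetUr.
apply: (zero _ _ Re); apply/eqP; rewrite -subset0 -SI subsetI subxx /=.
by apply: subset_trans (atom_sub (B := B) (ex_intro _ f Rf) lS); rewrite -SU subsetUl.
Qed.

End BlockEquivalence.

Section Families.
Variables (C : fieldType) (gT : finGroupType) (G : {group gT}) (n : nat).
Variable rG : mx_representation C G n.
Hypothesis C0 : [pchar C] =i pred0.
Variable c : gT -> C.
Hypothesis cG : forall s w, s \in reflections rG -> w \in G -> c (s ^ w)%g = c s.
Variable sG : irrType C G.
Hypothesis C'G : [pchar C]^'.-group G.
Let ro := hbar_restricted_ops C0 cG.
Local Notation em l := (eps_mx ro (irr_repr l)).
Local Notation B := (block_set ro (sG := sG)).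

Lemma cm_equivP (l m : sG) : cm_equiv rG c l m <-> forall S, B S -> (l \in S) = (m \in S).
Proof.
apply: (iff_trans _ (block_equivP ro C'G l m)).
split=> [[b [pb bl bm]]|[b [pb bl bm]]]; exists b; have [cb _ _] := pb.
  by split=> //; [apply: (proj1 (in_block_head C0 cG l C'G cb))|apply: (proj1 (in_block_head C0 cG m C'G cb))].
by split=> //; [apply: (proj2 (in_block_head C0 cG l C'G cb))|apply: (proj2 (in_block_head C0 cG m C'G cb))].
Qed.

Lemma cm_familiesE : cm_families rG c sG = [set atom B l | l : sG].
Proof.
have BT : B setT := block_setT ro sG.
have BC := @block_setC _ _ _ _ _ _ _ _ _ _ ro sG.
have BI := @block_setI _ _ _ _ _ _ _ _ _ _ ro sG.
apply: eq_imset => l; apply/setP => m; rewrite inE.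
by apply/asboolP/(atomP BT BC BI) => /cm_equivP.
Qed.

End Families.

(** * Combinatorics of atoms and orbits *)

Section OrbitCorrespondence.
Variables (X Y : finType) (BX : {set X} -> Prop) (BY : {set Y} -> Prop).
Hypotheses (BXT : BX setT) (BXC : forall S, BX S -> BX (~: S)).
Hypothesis BXI : forall S T, BX S -> BX T -> BX (S :&: T).
Hypotheses (BYT : BY setT) (BYC : forall S, BY S -> BY (~: S)).
Hypothesis BYI : forall S T, BY S -> BY T -> BY (S :&: T).
Variables (gD : finGroupType) (D : {group gD}) (act : gD -> Y -> Y).
Hypothesis act1 : forall y, act 1%g y = y.
Hypothesis actM : {in D &, forall s t y, act (s * t)%g y = act s (act t y)}.
Hypothesis BY_act : forall s S, s \in D -> BY S -> BY [set act s y | y in S].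
Variable R : Y -> X -> bool.
Hypotheses (R_total : forall x, exists y, R y x) (R_onto : forall y, exists x, R y x).
Hypothesis R_act : forall s y x, s \in D -> R y x -> R (act s y) x.
Hypothesis R_orbit : forall y y' x, R y x -> R y' x -> exists2 s, s \in D & y' = act s y.
Let res (S : {set X}) : {set Y} := [set y | [exists x in S, R y x]].
Hypothesis BX_res : forall S, BX S -> BY (res S).
Hypothesis BX_resP : forall S x y, BX S -> R y x -> (y \in res S) = (x \in S).
Hypothesis BY_ind : forall T, BY T -> (forall s y, s \in D -> y \in T -> act s y \in T) ->
  BX [set x | [exists y in T, R y x]].

Local Notation aX := (atom BX).
Local Notation aY := (atom BY).

(** The group permutes the sets of [BY], so minimality of the atom gives one inclusion for s and the
    other by applying the inverse of s. *)
Lemma act_atom s y : s \in D -> [set act s z | z in aY y] = aY (act s y).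
Proof.
move=> Ds; have sub (t : gD) u : t \in D -> aY (act t u) \subset [set act t z | z in aY u].
  move=> Dt; apply: atom_sub; first exact: BY_act (atom_set BYT BYI u).
  by apply: imset_f; apply: atom_mem.
apply/eqP; rewrite eqEsubset sub // andbT; apply/subsetP => _ /imsetP[z zy ->].
have := sub s^-1%g (act s y) (groupVr Ds); rewrite -actM ?groupV // mulVg act1.
move/subsetP/(_ z zy)/imsetP => [u uy ->].
by rewrite -actM ?groupV // mulgV act1.
Qed.

(** The union T of the orbit of the atom of y is a D-stable set of [BY], so the set it induces
    contains the atom of x, and [R_orbit] brings every constituent back into T. The other inclusion
    pulls sets of [BX] back through [BX_res]. *)
Lemma res_atom x y : R y x ->
  res (aX x) = \bigcup_(s in D) aY (act s y).
Proof.
move=> Ryx; apply/setP => y'; rewrite inE; apply/existsP/bigcupP => [[x' /andP[x'x Ry'x']]|[s Ds ys]].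
  pose T := \bigcup_(s in D) aY (act s y).
  have BT : BY T.
    apply: (big_ind BY) => [|S S'|s Ds]; [exact: set0_closed BYT BYC| |exact: atom_set BYT BYI _].
    by move=> BS BS'; apply: (setU_closed BYC BYI).
  have Tact s z : s \in D -> z \in T -> act s z \in T.
    move=> Ds /bigcupP[t Dt zt]; apply/bigcupP; exists (s * t)%g; first exact: groupM.
    by rewrite actM // -act_atom //; apply: imset_f.
  have yT : y \in T by apply/bigcupP; exists 1%g => //; rewrite act1 atom_mem.
  have := atomP BXT BXC BXI _ _ x'x _ (BY_ind BT Tact); rewrite !inE.
  have -> : [exists z in T, R z x] by apply/existsP; exists y; rewrite yT.
  move/esym/existsP => [z /andP[zT Rzx']]; have [t Dt ->] := R_orbit Rzx' Ry'x'.
  by have /bigcupP[s Ds] := Tact t z Dt zT; exists s.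
have [x' Rx'] := R_onto y'; exists x'; rewrite Rx' andbT.
apply/(atomP BXT BXC BXI) => S BS; rewrite -(BX_resP BS Rx') -(BX_resP BS (R_act Ds Ryx)).
exact: (atomP BYT BYC BYI _ _ ys _ (BX_res BS)).
Qed.

(** X, Y, D and R are modelled on Irr W, Irr K, W/K and the relation of being a constituent of the
    restriction; [BX] and [BY] are the unions of families. Phi sends an atom to the set of atoms
    that its restriction meets. *)
Theorem orbit_correspondence :
  let OX := [set aX x | x : X] in let OY := [set aY y | y : Y] in
  (forall s F, s \in D -> F \in OY -> [set act s y | y in F] \in OY) /\
  exists Phi : {set X} -> {set {set Y}},
    [/\ {in OX &, injective Phi},
        Phi @: OX = [set [set [set act s y | y in (F : {set Y})] | s in D] | F in OY]
      & forall F, F \in OX -> cover (Phi F) = res F].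
Proof.
move=> OX OY; split=> [s _ Ds /imsetP[y _ ->]|].
  by rewrite act_atom //; apply: imset_f.
pose Phi (F : {set X}) := [set aY y | y in res F].
have coverP x : cover (Phi (aX x)) = res (aX x).
  have [y Ryx] := R_total x; apply/setP => z; apply/bigcupP/idP => [[_ /imsetP[u ux ->] zu]|zx].
    move: ux; rewrite (res_atom Ryx) => /bigcupP[s Ds us].
    by apply/bigcupP; exists s => //; rewrite -(atom_eq BYT BYC BYI us).
  by exists (aY z); rewrite ?atom_mem //; apply: imset_f.
have PhiE x y : R y x -> Phi (aX x) = [set [set act s z | z in aY y] | s in D].
  move=> Ryx; apply/setP => F; apply/imsetP/imsetP => [[z zx ->]|[s Ds ->]].
    move: zx; rewrite (res_atom Ryx) => /bigcupP[s Ds zs]; exists s => //.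
    by rewrite act_atom // (atom_eq BYT BYC BYI zs).
  exists (act s y); last by rewrite act_atom.
  by rewrite (res_atom Ryx); apply/bigcupP; exists s => //; apply: atom_mem.
exists Phi; split=> [_ _ /imsetP[x _ ->] /imsetP[x' _ ->] PP||_ /imsetP[x _ ->]]; last exact: coverP.
  have rr : res (aX x) = res (aX x') by rewrite -!coverP PP.
  have [y Ryx] := R_total x.
  have : y \in res (aX x') by rewrite -rr inE; apply/existsP; exists x; rewrite atom_mem.
  rewrite inE => /existsP[x2 /andP[x2x' Ryx2]].
  rewrite -(atom_eq BXT BXC BXI x2x'); apply/esym/(atom_eq BXT BXC BXI).
  by apply/(atomP BXT BXC BXI) => S BS; rewrite -(BX_resP BS Ryx) (BX_resP BS Ryx2).
apply/setP => P; apply/imsetP/imsetP => [[_ /imsetP[x _ ->] ->]|[_ /imsetP[y _ ->] ->]].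
  have [y Ryx] := R_total x; exists (aY y); first exact: imset_f.
  exact: PhiE.
have [x Ryx] := R_onto y; exists (aX x); first exact: imset_f.
by rewrite (PhiE _ _ Ryx).
Qed.

End OrbitCorrespondence.

Lemma sub_sum (C : fieldType) (n : nat) (A : 'M[C]_n) (I : Type) (r : seq I)
    (P : pred I) (F : I -> mpoly n C) :
  sub A (\sum_(i <- r | P i) F i) = \sum_(i <- r | P i) sub A (F i).
Proof. exact: raddf_sum. Qed.

Lemma sub_subr (C : fieldType) (n : nat) (A : 'M[C]_n) (p q : mpoly n C) :
  sub A (p - q) = sub A p - sub A q.
Proof. exact: raddfB. Qed.

(** * Central elements of Hbar(W) are supported on K *)

Section InvariantFixers.
Variables (C : fieldType) (gT : finGroupType) (G K : {group gT}) (n : nat).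
Variable rG : mx_representation C G n.
Hypothesis C0 : [pchar C] =i pred0.
Hypotheses (nKG : K <| G) (faithG : mx_faithful rG).
Let sKG : K \subset G := normal_sub nKG.
Let rK := subg_repr rG sKG.
Local Notation mp := (mpoly n C).

Lemma inv_conj f g : g \in G -> inv rK f -> inv rK (sub (rG g) f).
Proof.
move=> Gg If k Kk; have Gk := subsetP sKG k Kk; rewrite /= sub_mul -repr_mxM //.
have Kkg : (k ^ g)%g \in K by rewrite memJ_norm // (subsetP (normal_norm nKG)).
have -> : (k * g)%g = (g * k ^ g)%g by rewrite conjgC.
by rewrite repr_mxM ?(subsetP sKG _ Kkg) // -sub_mul (If _ Kkg).
Qed.

Lemma inv_avg p : inv rK (\sum_(k in K) sub (rG k) p).
Proof.
move=> h Kh; rewrite sub_sum [RHS](reindex_inj (mulgI h)) /=.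
apply: eq_big => [k|k Kk]; first by rewrite groupMl.
by rewrite sub_mul -repr_mxM ?(subsetP sKG).
Qed.

Lemma nat_card_neq0 (L : {group gT}) : (#|L|%:R : C) != 0.
Proof. by rewrite (proj1 (pcharf0P C) C0) -lt0n cardG_gt0. Qed.

(** Averaging over K fixes f and the invariants of G, and makes the other factors K-invariant. *)
Lemma coinv_invK f : coinv rG f -> inv rK f -> exists s : seq (mp * mp),
  (forall u, u \in s -> [/\ inv rG u.1, constant_term u.1 = 0 & inv rK u.2])
  /\ f = \sum_(u <- s) u.1 * u.2.
Proof.
move=> [s [Is fE]] If; pose avg p := #|K|%:R^-1 *: \sum_(k in K) sub (rG k) p.
exists [seq (u.1, avg u.2) | u <- s]; split.
  move=> u /mapP[v /Is[I0 I1] ->] /=; split=> // k Kk.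
  by rewrite subZ (inv_avg v.2 Kk).
have avgD : {morph avg : p q / p + q}.
  move=> p q; rewrite /avg -scalerDr -big_split; congr (_ *: _).
  by apply: eq_bigr => k _; rewrite subD.
have avg0 : avg 0 = 0 by apply: (addrI (avg 0)); rewrite -avgD !addr0.
have fav : f = avg f.
  rewrite /avg (eq_bigr (fun=> f)) => [|k Kk]; last exact: If.
  by rewrite sumr_const -scaler_nat scalerA mulVf ?scale1r // nat_card_neq0.
rewrite {1}fav fE (big_morph avg avgD avg0) big_map big_seq [RHS]big_seq.
apply: eq_bigr => u /Is[Iu _]; rewrite /avg -scalerAr mulr_sumr; congr (_ *: _).
by apply: eq_bigr => k Kk; rewrite subM Iu // (subsetP sKG).
Qed.

(* A graded Nakayama argument: modulo I_G each K-invariant is its average over *)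
(* the powers of g, and the coefficients of the difference can be taken K-invariant. *)
Lemma invariant_nakayama g : g \in G ->
  (forall f, inv rK f -> coinv rG (sub (rG g) f - f)) ->
  forall f, inv rK f -> sub (rG g) f = f.
Proof.
move=> Gg gI.
have gIj f j : inv rK f -> coinv rG (sub (rG (g ^+ j)%g) f - f).
  move=> If; elim: j => [|j IH].
    by rewrite expg0 repr_mx1 sub1 subrr; apply: coinv0.
  have E : rG (g ^+ j.+1)%g = rG g *m rG (g ^+ j)%g by rewrite expgS repr_mxM ?groupX.
  rewrite E -sub_mul.
  have -> : sub (rG g) (sub (rG (g ^+ j)%g) f) - f
      = sub (rG g) (sub (rG (g ^+ j)%g) f - f) + (sub (rG g) f - f).
    by rewrite sub_subr addrA subrK.
  by apply: coinvD; [apply: coinv_subG|apply: gI].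
pose m := #[g]%g; have m0 : (m%:R : C) != 0 by exact: nat_card_neq0.
pose avg f := m%:R^-1 *: \sum_(j < m) sub (rG (g ^+ j)%g) f.
have avg_fix f : sub (rG g) (avg f) = avg f.
  rewrite /avg subZ sub_sum; congr (_ *: _).
  rewrite (eq_bigr (fun j : 'I_m => sub (rG (g ^+ j.+1)%g) f)) => [|j _]; last first.
    by rewrite sub_mul -repr_mxM ?groupX // -expgS.
  rewrite /m; have := expg_order g; case: #[g]%g => [|k] gk; first by rewrite !big_ord0.
  by rewrite big_ord_recr /= gk big_ord_recl /= expg0 addrC.
suff H k f : inv rK f -> order_ge k (sub (rG g) f - f).
  move=> f If; apply/eqP; rewrite -subr_eq0; apply/eqP.
  by apply: order_ge_eq0 => k; apply: H.
elim: k f => [|k IH] f If; first exact: order_ge0.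
have Ic : coinv rG (f - avg f).
  have -> : f - avg f = - (m%:R^-1 *: \sum_(j < m) (sub (rG (g ^+ j)%g) f - f)).
    rewrite sumrB sumr_const card_ord scalerBr -scaler_nat scalerA mulVf // scale1r.
    by rewrite opprB.
  by apply/coinvN/coinvZ/coinv_sum => j _; apply: gIj.
have Ifa : inv rK (f - avg f).
  apply: invD => //; rewrite -scaleN1r -mul_mpolyC; apply: invM; first exact: invC.
  rewrite /avg -mul_mpolyC; apply: invM; first exact: invC.
  apply: (big_ind (inv rK)) => [|p q|j _]; [by rewrite -mpolyC0; apply: invC|exact: invD|].
  by apply: inv_conj => //; apply: groupX.
have [s [Is fE]] := coinv_invK Ic Ifa.
(* The average is fixed by g, so f may be replaced by f - avg f; the factors u.1 are fixed too and
   have order at least 1, which gains one order over the induction hypothesis for u.2. *)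
have -> : sub (rG g) f - f = \sum_(u <- s) u.1 * (sub (rG g) u.2 - u.2).
  transitivity (sub (rG g) (f - avg f) - (f - avg f)).
    by rewrite sub_subr avg_fix opprB addrA subrK.
  rewrite fE sub_sum -sumrB big_seq [RHS]big_seq; apply: eq_bigr => u /Is[Iu _ _].
  by rewrite /= subM Iu // mulrBr.
rewrite big_seq; apply: (big_ind (order_ge k.+1)) => [|p q|u /Is[Iu u0 Iu2]].
- exact: order_ge_zero.
- exact: order_geD.
by rewrite -add1n; apply: order_geM; [apply/order_ge1|apply: IH].
Qed.

(** The orbit polynomial, the product of T - kx over k in K, has K-invariant coefficients, which g
    fixes. It therefore has gx as a root, and gx is some kx. *)
Lemma fixer_pointwise g : g \in G -> (forall f, inv rK f -> sub (rG g) f = f) ->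
  forall x : 'cV_n, exists2 k, k \in K & rG g *m x = rG k *m x.
Proof.
move=> Gg gfix x.
pose Q : {poly mp} := \prod_(k in K) ('X - (lin (rG k *m x))%:P).
have Qinv h : h \in G -> map_poly (sub (rG h)) Q = \prod_(k in K) ('X - (lin (rG (h * k)%g *m x))%:P).
  move=> Gh; rewrite rmorph_prod; apply: eq_bigr => k Kk.
  rewrite rmorphB /= map_polyX map_polyC /= sub_lin mulmxA -repr_mxM //.
  exact: subsetP sKG k Kk.
have invQ j : inv rK Q`_j.
  move=> h Kh; have E : map_poly (sub (rG h)) Q = Q.
    rewrite (Qinv h (subsetP sKG h Kh)) /Q [RHS](reindex_inj (mulgI h)) /=.
    by apply: eq_bigl => k; rewrite groupMl.
  by rewrite -[in RHS]E coef_map.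
have Qg : map_poly (sub (rG g)) Q = Q.
  by apply/polyP => j; rewrite coef_map /= gfix.
have : (map_poly (sub (rG g)) Q).[lin (rG g *m x)] = 0.
  rewrite Qinv // (bigD1 1%g) //= mulg1 hornerM hornerXsubC subrr mul0r //.
rewrite Qg /Q horner_prod => /eqP; rewrite prodf_seq_eq0 => /hasP[k _ /andP[Kk]].
rewrite hornerXsubC subr_eq0 -subr_eq0 => E; exists k => //.
apply/eqP; rewrite -subr_eq0 -lin_eq0 linD.
by have -> : lin (- (rG k *m x)) = - lin (rG k *m x) by rewrite -scaleN1r linZ scaleN1r.
Qed.

(** Otherwise h* would be the finite union of the subspaces where g agrees with some k in K, each
    proper by faithfulness. *)
Lemma invariants_fixer g : g \in G -> (forall f, inv rK f -> sub (rG g) f = f) -> g \in K.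
Proof.
move=> Gg gfix; apply: contraT => nKg.
have neq k : k \in K -> exists i, row i (rG g - rG k) != 0.
  move=> Kk; have Gk := subsetP sKG k Kk.
  apply/existsP; apply: contraR nKg; rewrite negb_exists => /forallP r0.
  have E : rG g = rG k.
    apply/eqP; rewrite -subr_eq0; apply/eqP/row_matrixP => i.
    by rewrite row0; apply/eqP; have := r0 i; rewrite negbK.
  have : (g * k^-1)%g \in rker rG.
    by rewrite inE groupM ?groupV //= mul1mx repr_mxM ?groupV // E -repr_mxM ?groupV // mulgV repr_mx1.
  by move/(subsetP faithG); rewrite inE -eq_mulgV1 => /eqP->.
have [iK iKP] : exists iK : gT -> 'I_n, forall k, k \in K -> row (iK k) (rG g - rG k) != 0.
  have H k : exists i : 'I_n, k \in K -> row i (rG g - rG k) != 0.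
    have [Kk|nK] := boolP (k \in K); first by case: (neq k Kk) => i ri; exists i.
    by case: (neq 1%g (group1 K)) => i _; exists i.
  by have [iK iKP] := boolp.choice H; exists iK.
(* One nonzero linear form for each subspace, vanishing on it; their product is nonzero at some
   vector, which then lies in none of them. *)
pose P : mp := \prod_(k in K) lin (row (iK k) (rG g - rG k))^T.
have P0 : P != 0.
  apply/prodf_neq0 => k Kk; rewrite lin_eq0.
  by apply: contraNneq (iKP k Kk) => /(congr1 trmx); rewrite trmxK trmx0 => ->.
have [v Pv] : exists v, meval v P != 0.
  apply: contrapT => nv; case/eqP: P0; apply: (mpoly_vanish C0) => v.
  by apply/eqP; apply: contrapT => /negP Pv; apply: nv; exists v.
have [k Kk E] := fixer_pointwise Gg gfix (\col_i v i).
case/eqP: Pv; rewrite /P (bigD1 k) //= mevalM meval_lin.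
rewrite [X in X * _](_ : _ = 0) ?mul0r //.
transitivity (((rG g - rG k) *m \col_i v i) (iK k) 0); last first.
  by rewrite mulmxBl E subrr mxE.
by rewrite mxE; apply: eq_bigr => j _; rewrite !mxE mulrC.
Qed.

Variables (H : pzRingType) (c : gT -> C) (W : gT -> H) (EX EY : mp -> H).
Hypothesis ro : restricted_ops rG c W EX EY.
Hypothesis cK : forall s, s \in reflections rG -> s \notin K -> c s = 0.
Let ops := ro_ops ro.

(** Divided differences along reflections in K kill f; those along other reflections carry the
    coefficient c s = 0. *)
Lemma invK_commY f q : inv rK f -> EX f * EY q = EY q * EX f.
Proof.
move=> If; have [Del DelP] := demazure_exists rG C0.
elim/mpoly_ring_ind: q => [a|i|p q IHp IHq|p q IHp IHq].
- by rewrite (co_YC ops) (co_sC ops).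
- rewrite -lin_delta -[delta_mx i 0]trmxK (co_YXp ops DelP) big1 ?subr0 // => s Rs.
  have [_ _ _ DI _] := DelP s (delta_mx i 0)^T Rs.
  have [Ks|nKs] := boolP (s \in K); first by rewrite DI ?(If s Ks) // scaler0 (co_X0 ops) mul0r.
  by rewrite cK // scale0r (co_X0 ops) mul0r.
- by rewrite (co_YD ops) mulrDl mulrDr IHp IHq.
by rewrite (co_YM ops) mulrA IHp -!mulrA IHq.
Qed.

Lemma central_support e g : (forall a, e * a = a * e) -> g \in G -> g \notin K ->
  eps ro e g = 0.
Proof.
move=> eC Gg nKg; apply/eqP; apply: contraNT nKg => a0.
apply: invariants_fixer => //; apply: (invariant_nakayama Gg) => f If.
have [Gt tE] := tri_ofP ro e; set t := tri_of ro e in Gt tE.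
pose P := \sum_(u <- t | u.1.2 == g) constant_term u.2 *: u.1.1.
have aE : constant_term P = eps ro e g.
  rewrite /P /constant_term raddf_sum; apply: eq_bigr => u _.
  by rewrite /= mevalZ mulrC.
have Pc : coinv rG (P * (sub (rG g) f - f)).
  (* An expression of ef - fe = 0: in each term f crosses [EY] freely and is transformed by the
     group element on its way to the left. *)
  pose t' := [seq (u.1.1 * (sub (rG u.1.2) f - f), u.1.2, u.2) | u <- t].
  have Gt' : tri_in G t' by rewrite /tri_in all_map.
  have t'0 : tri W EX EY t' = 0.
    have := eC (EX f); rewrite -tE /tri mulr_suml mulr_sumr big_map => E.
    apply/eqP; rewrite -[X in _ == X](subrr (\sum_(u <- t) EX f * (EX u.1.1 * W u.1.2 * EY u.2))).
    rewrite -{1}E -sumrB !big_seq; apply/eqP; apply: eq_bigr => u tu /=.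
    have Gu := allP Gt u tu.
    rewrite -!mulrA -invK_commY // (mulrA (W _)) (co_WXp ops) // !mulrA -!(co_XM ops).
    by rewrite -!mulrBl -(co_XN ops) -(co_XD ops) mulrBr (mulrC f).
  have := ro_indep ro g Gt' t'0; rewrite big_map /= mulr_suml.
  congr coinv; apply: eq_bigr => u /eqP ->.
  by rewrite scalerAl.
set a := eps ro e g in a0 aE; set F := sub (rG g) f - f in Pc *.
(* As P = a + P' with a nonzero and P' of order at least 1, the containment of PF in the Hilbert
   ideal replaces F by a multiple of P'F modulo that ideal. The order of the remainder thus grows
   until the remainder itself lies in the ideal. *)
have Ik k : exists2 r, order_ge k r & coinv rG (F - r).
  elim: k => [|k [r or Ir]]; first by exists F => //; rewrite subrr; apply: coinv0.
  pose P' := P - a%:MP; exists (- a^-1 *: (P' * r)).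
    rewrite -mul_mpolyC -[k.+1]/(0 + (1 + k))%N; apply: order_geM => //.
    apply: order_geM => //; apply/order_ge1.
    by rewrite constant_termD aE -mpolyCN constant_termC subrr.
  have -> : F - - a^-1 *: (P' * r) = a^-1 *: (P * F) - a^-1 *: (P' * (F - r)).
    have aM : a^-1 *: (a%:MP * F) = F by rewrite mul_mpolyC scalerA mulVf // scale1r.
    rewrite -{1}aM scaleNr opprK -scalerDr -scalerBr /P'; congr (_ *: _).
    by ring.
  by apply: coinvB; apply: coinvZ => //; apply: coinvMl.
have [r or Ir] := Ik (n * #|G|).+1.
by rewrite -(subrK r F); apply: coinvD => //; apply: coinv_order.
Qed.

End InvariantFixers.

(** * Coinduction from K to W *)

Section EquivariantFunctions.
Variables (gT : finGroupType) (G K : {group gT}) (H : pzRingType) (W : gT -> H).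

(** The module coinduced from the regular module of Hbar(K), as functions on G. Requiring zero
    outside G lets values on G determine the function. *)
Definition equivariant : {pred {ffun gT -> H}} :=
  [pred phi : {ffun gT -> H} |
    [forall v, (v \notin G) ==> (phi v == 0)] &&
    [forall k in K, forall v in G, phi (k * v)%g == W k * phi v]].

Lemma equivariantP (phi : {ffun gT -> H}) : reflect
  ((forall v, v \notin G -> phi v = 0) /\
   (forall k v, k \in K -> v \in G -> phi (k * v)%g = W k * phi v))
  (phi \in equivariant).
Proof.
apply: (iffP andP) => [[/forallP s0 /forallP e0]|[s0 e0]]; split.
- by move=> v nGv; apply/eqP; apply: (implyP (s0 v)).
- move=> k v Kk Gv; apply/eqP.
  by have /implyP/(_ Kk)/forallP/(_ v)/implyP/(_ Gv) := e0 k.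
- by apply/forallP => v; apply/implyP => nGv; rewrite s0.
by apply/forallP => k; apply/implyP => Kk; apply/forallP => v; apply/implyP => Gv; rewrite e0.
Qed.

Fact equivariant_zmod : zmod_closed equivariant.
Proof.
split=> [|u v /equivariantP[u0 ue] /equivariantP[v0 ve]]; apply/equivariantP; split=> [x Gx|k x Kk Gx].
- by rewrite ffunE.
- by rewrite !ffunE mulr0.
- by rewrite !ffunE u0 // v0 // subr0.
by rewrite !ffunE ue // ve // mulrBr.
Qed.
HB.instance Definition _ := GRing.isZmodClosed.Build _ equivariant equivariant_zmod.

Record eqfun := Eqfun { eqfun_val :> {ffun gT -> H}; eqfunP : eqfun_val \in equivariant }.
HB.instance Definition _ := [isSub for eqfun_val].
HB.instance Definition _ := [Choice of eqfun by <:].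
HB.instance Definition _ := [SubChoice_isSubZmodule of eqfun by <:].

Lemma eqfun_eq (u v : eqfun) : (forall x, x \in G -> u x = v x) -> u = v.
Proof.
move=> uv; apply: val_inj; apply/ffunP => x.
have [Gx|nGx] := boolP (x \in G); first exact: uv.
have [/equivariantP[u0 _] /equivariantP[v0 _]] := (eqfunP u, eqfunP v).
by rewrite /= u0 ?v0.
Qed.

Lemma eqfun0E x : (0 : eqfun) x = 0. Proof. by rewrite /= ffunE. Qed.
Lemma eqfunDE (u v : eqfun) x : (u + v) x = u x + v x. Proof. by rewrite /= ffunE. Qed.
Lemma eqfunNE (u : eqfun) x : (- u) x = - u x. Proof. by rewrite /= ffunE. Qed.
Lemma eqfun_out (u : eqfun) x : x \notin G -> u x = 0.
Proof. by have /equivariantP[u0 _] := eqfunP u; apply: u0. Qed.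
Lemma eqfunM (u : eqfun) k x : k \in K -> x \in G -> u (k * x)%g = W k * u x.
Proof. by have /equivariantP[_ ue] := eqfunP u; apply: ue. Qed.
Lemma eqfun_sumE (I : Type) (r : seq I) (P : pred I) (F : I -> eqfun) x :
  (\sum_(i <- r | P i) F i) x = \sum_(i <- r | P i) F i x.
Proof.
by apply: (big_morph (fun u : eqfun => u x)) => [u v|]; [exact: eqfunDE|exact: eqfun0E].
Qed.

End EquivariantFunctions.

Section Coinduction.
Variables (C : fieldType) (gT : finGroupType) (G K : {group gT}) (n : nat).
Variable rG : mx_representation C G n.
Hypothesis C0 : [pchar C] =i pred0.
Hypotheses (nKG : K <| G).
Let sKG : K \subset G := normal_sub nKG.
Let rK := subg_repr rG sKG.
Local Notation mp := (mpoly n C).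
Variable c : gT -> C.
Hypothesis cG : forall s w, s \in reflections rK -> w \in G -> c (s ^ w)%g = c s.
Let c' := extend_by_zero (reflections rK) c.
Variables (H : pzRingType) (W : gT -> H) (EX EY : mp -> H).
Hypothesis ro : restricted_ops rK c W EX EY.
Let ops := ro_ops ro.
Local Notation V := (eqfun G K W).

Lemma subK_reflections : reflections rK = reflections rG :&: K.
Proof.
apply/setP => s; rewrite !inE andbC; case Ks: (s \in K); rewrite /= ?andbF //.
by rewrite (subsetP sKG).
Qed.

Let inK k : k \in K -> k \in G. Proof. exact: (subsetP sKG). Qed.
Let WXK k p : k \in K -> W k * EX p = EX (sub (rG k) p) * W k.
Proof. by move=> Kk; exact: (co_WXp ops p Kk). Qed.
Let WYK k p : k \in K -> W k * EY p = EY (sub (dual_repr rG k) p) * W k.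
Proof. by move=> Kk; exact: (co_WYp ops p Kk). Qed.

Lemma eqfun_mul_equivariant (a : gT -> H) (phi : V) :
  (forall k v, k \in K -> v \in G -> a (k * v)%g * W k = W k * a v) ->
  [ffun v => a v * phi v] \in equivariant G K W.
Proof.
move=> aW; apply/equivariantP; split=> [v nGv|k v Kk Gv]; rewrite !ffunE.
  by rewrite eqfun_out ?mulr0.
by rewrite eqfunM // !mulrA aW.
Qed.

Fact cX_equi p (phi : V) : [ffun v => EX (sub (rG v) p) * phi v] \in equivariant G K W.
Proof.
apply: eqfun_mul_equivariant => k v Kk Gv.
by rewrite (WXK _ Kk) sub_mul (repr_mxM rG (inK Kk) Gv).
Qed.

Fact cY_equi q (phi : V) :
  [ffun v => EY (sub (dual_repr rG v) q) * phi v] \in equivariant G K W.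
Proof.
apply: eqfun_mul_equivariant => k v Kk Gv.
by rewrite (WYK _ Kk) sub_mul (repr_mxM (dual_repr rG) (inK Kk) Gv).
Qed.

(** A default element of G, so that translation by an arbitrary g is an operator on equivariant
    functions. *)
Let inG g := if g \in G then g else 1%g.
Let inGP g : inG g \in G. Proof. by rewrite /inG; case: ifP. Qed.
Let inGE g : g \in G -> inG g = g. Proof. by rewrite /inG => ->. Qed.

Fact cW_equi g (phi : V) : [ffun v => phi (v * inG g)%g] \in equivariant G K W.
Proof.
apply/equivariantP; split=> [v nGv|k v Kk Gv]; rewrite !ffunE.
  by rewrite eqfun_out // groupMr.
by rewrite -mulgA; exact: (eqfunM phi Kk (groupM Gv (inGP g))).
Qed.

Fact cs_equi a (phi : V) : [ffun v => EX a%:MP * phi v] \in equivariant G K W.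
Proof. by apply: eqfun_mul_equivariant => k v _ _; rewrite (co_sC ops). Qed.

Definition cs0 a (phi : V) : V := Eqfun (cs_equi a phi).
Fact cs0D a : {morph cs0 a : u v / u + v}.
Proof. by move=> u v; apply: eqfun_eq => x _; rewrite eqfunDE !ffunE mulrDr. Qed.
Definition cs a := Addmap (cs0D a).
Local Notation B := (aend cs).

Lemma csE a (phi : V) x : cs a phi x = EX a%:MP * phi x. Proof. by rewrite ffunE. Qed.

Definition cX0 p (phi : V) : V := Eqfun (cX_equi p phi).
Fact cX0D p : {morph cX0 p : u v / u + v}.
Proof. by move=> u v; apply: eqfun_eq => x _; rewrite eqfunDE !ffunE mulrDr. Qed.
Fact cX0S p a u : cX0 p (cs a u) = cs a (cX0 p u).
Proof. by apply: eqfun_eq => x _; rewrite !ffunE mulrA -(co_sC ops) mulrA. Qed.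
Definition cX p : B := Aend (cX0D p) (cX0S p).
Lemma cXE p (phi : V) x : cX p phi x = EX (sub (rG x) p) * phi x. Proof. by rewrite ffunE. Qed.

Definition cY0 p (phi : V) : V := Eqfun (cY_equi p phi).
Fact cY0D p : {morph cY0 p : u v / u + v}.
Proof. by move=> u v; apply: eqfun_eq => x _; rewrite eqfunDE !ffunE mulrDr. Qed.
Fact cY0S p a u : cY0 p (cs a u) = cs a (cY0 p u).
Proof. by apply: eqfun_eq => x _; rewrite !ffunE mulrA -(co_sC ops) mulrA. Qed.
Definition cY p : B := Aend (cY0D p) (cY0S p).
Lemma cYE p (phi : V) x : cY p phi x = EY (sub (dual_repr rG x) p) * phi x.
Proof. by rewrite ffunE. Qed.

Definition cW0 g (phi : V) : V := Eqfun (cW_equi g phi).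
Fact cW0D p : {morph cW0 p : u v / u + v}.
Proof. by move=> u v; apply: eqfun_eq => x _; rewrite eqfunDE !ffunE. Qed.
Fact cW0S p a u : cW0 p (cs a u) = cs a (cW0 p u).
Proof. by apply: eqfun_eq => x _; rewrite !ffunE. Qed.
Definition cW p : B := Aend (cW0D p) (cW0S p).
Lemma cWE g (phi : V) x : g \in G -> cW g phi x = phi (x * g)%g.
Proof. by move=> Gg; rewrite ffunE inGE. Qed.

Lemma coind_eq (f g : B) : (forall phi x, x \in G -> f phi x = g phi x) -> f = g.
Proof. by move=> fg; apply: aend_eq => phi; apply: eqfun_eq => x; apply: fg. Qed.

(** At the point v the commutator is that of Hbar(K) for the translates of y and x by v. It is
    matched term by term through s -> s ^ v, by the invariance of c under G; reflections outside K
    contribute zero. *)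
Lemma coind_ops : cherednik_ops rG c' cW cX cY.
Proof.
split.
- by move=> p q; apply: coind_eq => phi x _; rewrite eqfunDE !cXE subD (co_XD ops) mulrDl.
- by move=> p q; apply: coind_eq => phi x _; rewrite aend_mulE !cXE subM (co_XM ops) mulrA.
- by apply: coind_eq => phi x _; rewrite cXE -mpolyC1 subC mpolyC1 (co_X1 ops) mul1r.
- by move=> p q; apply: coind_eq => phi x _; rewrite eqfunDE !cYE subD (co_YD ops) mulrDl.
- by move=> p q; apply: coind_eq => phi x _; rewrite aend_mulE !cYE subM (co_YM ops) mulrA.
- by move=> a; apply: coind_eq => phi x _; rewrite cYE cXE !subC (co_YC ops).
- move=> a h; apply: aend_eq => phi; rewrite !aend_mulE.
  have E u : cX a%:MP u = cs a u by apply: eqfun_eq => x _; rewrite cXE subC csE.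
  by rewrite !E aendS.
- by apply: coind_eq => phi x _; rewrite cWE ?mulg1.
- by move=> g h Gg Gh; apply: coind_eq => phi x _; rewrite aend_mulE !cWE ?groupM // mulgA.
- move=> g y Gg; apply: coind_eq => phi x Gx; rewrite !aend_mulE (cWE _ _ Gg) !cXE (cWE _ _ Gg).
  by rewrite !sub_lin mulmxA (repr_mxM rG Gx Gg).
- move=> g y Gg; apply: coind_eq => phi x Gx; rewrite !aend_mulE (cWE _ _ Gg) !cYE (cWE _ _ Gg).
  by rewrite !sub_lin mulmxA (repr_mxM (dual_repr rG) Gx Gg).
move=> y x; apply: coind_eq => phi v Gv.
rewrite aend_addE aend_oppE eqfunDE eqfunNE !aend_mulE !(cXE, cYE) !mulrA -mulrBl.
rewrite !sub_lin -[dual_repr rG v *m y^T]trmxK (co_YX ops) trmx_mul trmxK /= /dual_mx trmxK.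
rewrite eqfunNE aend_sumE eqfun_sumE mulNr; congr (- _).
rewrite mulr_suml [RHS](bigID (mem K)) /= [X in _ + X]big1 ?addr0; last first.
  move=> s /andP[Rs nKs]; rewrite ffunE subC /c' /extend_by_zero subK_reflections.
  by rewrite inE (negPf nKs) andbF mul0r mpolyC0 (co_X0 ops) mul0r.
rewrite [RHS](reindex_inj (conjg_inj v)) /=; apply: eq_big => [s|s].
  by rewrite subK_reflections inE reflections_conj // memJ_norm // (subsetP (normal_norm nKG)).
move=> Rs; have := Rs; rewrite subK_reflections inE => /andP[RGs Ks].
have Gs := subsetP sKG s Ks.
rewrite !ffunE subC inGE ?groupJ // conjgE mulKVg eqfunM // mulrA.
congr (EX (_ * _)%:MP * _ * _).
  rewrite /c' /extend_by_zero -[(v^-1 * _)%g]/(s ^ v)%g.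
  have -> : (s ^ v)%g \in reflections rK.
    rewrite subK_reflections inE reflections_conj // RGs memJ_norm //.
    exact: subsetP (normal_norm nKG) v Gv.
  by rewrite cG.
rewrite -[(v^-1 * _)%g]/(s ^ v)%g root_mx_conj // /pairing.
by rewrite !mulmxA.
Qed.

Lemma coind_D s : D_seq rG s -> \sum_(u <- s) cX u.1 * cY u.2 = 0.
Proof.
move=> [Is s0]; apply: coind_eq => phi v Gv.
rewrite aend_sumE eqfun_sumE aend_zeroE eqfun0E.
rewrite big_seq (eq_bigr (fun u => EX u.1 * EY u.2 * phi v)) => [|u /Is[I1 I2]].
  rewrite -mulr_suml -big_seq (ro_D ro) ?mul0r //; split=> // u /Is[I1 I2].
  by split=> k Kk; [apply: I1|apply: I2]; apply: (subsetP sKG).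
by rewrite aend_mulE cXE cYE I1 ?I2 // mulrA.
Qed.

Fact delta_equi : [ffun v => if v \in K then W v else 0] \in equivariant G K W.
Proof.
apply/equivariantP; split=> [v nGv|k v Kk Gv]; rewrite !ffunE.
  by case: ifP => // /(subsetP sKG); rewrite (negPf nGv).
by rewrite groupMl //; case: ifP => Kv; rewrite ?mulr0 // (co_WM ops).
Qed.
Definition delta_eq : V := Eqfun delta_equi.

Fact rmul_equi h (phi : V) : [ffun v => phi v * h] \in equivariant G K W.
Proof.
apply/equivariantP; split=> [v nGv|k v Kk Gv]; rewrite !ffunE.
  by rewrite eqfun_out ?mul0r.
by rewrite eqfunM // mulrA.
Qed.
Definition rmul h (phi : V) : V := Eqfun (rmul_equi h phi).
Lemma rmulE h phi v : rmul h phi v = phi v * h. Proof. by rewrite ffunE. Qed.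

Lemma rmul_triangular (f : B) h phi : triangular G cW cX cY f -> f (rmul h phi) = rmul h (f phi).
Proof.
move: f; apply: triangular_ind => [|a b Ea Eb|p g q Gg].
- by apply: eqfun_eq => x _; rewrite rmulE !aend_zeroE !eqfun0E mul0r.
- by apply: eqfun_eq => x _; rewrite rmulE !aend_addE !eqfunDE Ea Eb !rmulE mulrDl.
by apply: eqfun_eq => x _; rewrite rmulE !aend_mulE !cXE !cWE // !cYE rmulE !mulrA.
Qed.

Variables (HG : pzRingType) (WG : gT -> HG) (XG YG : mp -> HG).
Hypothesis roG : restricted_ops rG c' WG XG YG.
Variable Psi : HG -> B.
Hypotheses (PsiD : {morph Psi : a b / a + b}) (PsiM : {morph Psi : a b / a * b}).
Hypotheses (PsiX : forall p, Psi (XG p) = cX p) (PsiY : forall p, Psi (YG p) = cY p).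
Hypothesis PsiW : {in G, forall g, Psi (WG g) = cW g}.

Lemma Psi_tri t : tri_in G t -> Psi (tri WG XG YG t) = tri cW cX cY t.
Proof.
move=> /allP Gt; rewrite /tri (rmap_sum PsiD) !big_seq; apply: eq_bigr => u /Gt Gu.
by rewrite !PsiM PsiX PsiY PsiW.
Qed.

Lemma Psi_triangular h : triangular G cW cX cY (Psi h).
Proof. by have [t Gt ->] := ro_tri roG h; rewrite Psi_tri //; exists t. Qed.

(** The witness z is the value at 1 of e applied to [delta_eq]. Operators from Hbar(W) commute with
    right multiplication by H, which makes z central, and only the terms of e with group part in K
    reach this value, which identifies the coefficients. *)
Lemma central_descent_of e : (forall a, e * a = a * e) ->
  exists z : H, (forall a, z * a = a * z) /\ {in K, forall k, eps ro z k = eps roG e k}.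
Proof.
move=> eC; pose z := Psi e delta_eq 1%g; exists z.
(* The hypotheses say that a acts on [delta_eq] as right multiplication by h, and at the point 1 as
   left multiplication by h; commuting e with a then gives zh = hz. *)
have key (a : HG) (h : H) : Psi a delta_eq = rmul h delta_eq ->
    (forall phi, Psi a phi 1%g = h * phi 1%g) -> z * h = h * z.
  move=> E1 E2; rewrite -{2}[z]/(Psi e delta_eq 1%g) -E2 -aend_mulE -PsiM -eC PsiM aend_mulE E1.
  by rewrite (rmul_triangular _ _ (Psi_triangular e)) rmulE.
have zX p : z * EX p = EX p * z.
  apply: (key (XG p)) => [|phi]; last by rewrite PsiX cXE repr_mx1 sub1.
  apply: eqfun_eq => v Gv; rewrite PsiX cXE rmulE ffunE; case: ifP => Kv; last by rewrite mulr0 mul0r.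
  by rewrite (WXK _ Kv).
have zY p : z * EY p = EY p * z.
  apply: (key (YG p)) => [|phi]; last by rewrite PsiY cYE repr_mx1 sub1.
  apply: eqfun_eq => v Gv; rewrite PsiY cYE rmulE ffunE; case: ifP => Kv; last by rewrite mulr0 mul0r.
  by rewrite (WYK _ Kv).
have zW k : k \in K -> z * W k = W k * z.
  move=> Kk; have Gk := subsetP sKG k Kk; apply: (key (WG k)) => [|phi].
    apply: eqfun_eq => v Gv; rewrite PsiW // cWE // rmulE !ffunE groupMr //.
    by case: ifP => Kv; rewrite ?mul0r // (co_WM ops).
  by rewrite PsiW // cWE // mul1g -[k in LHS]mulg1 eqfunM.
split=> [a|k Kk].
  elim/(eps_ind ro): a => [|a b Ea Eb|p k q Kk]; first by rewrite mulr0 mul0r.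
    by rewrite mulrDr mulrDl Ea Eb.
  by rewrite !mulrA zX -!mulrA (mulrA z) zW // -!mulrA zY.
have [Gt tE] := tri_ofP roG e; set t := tri_of roG e in Gt tE.
pose tK := [seq u <- t | u.1.2 \in K].
have KtK : tri_in K tK by rewrite /tri_in all_filter; apply/allP => u _; apply/implyP.
have -> : z = tri W EX EY tK.
  rewrite /z -tE Psi_tri // /tri aend_sumE eqfun_sumE big_filter [RHS]big_mkcond !big_seq.
  apply: eq_bigr => u tu; have Gu := allP Gt u tu.
  rewrite !aend_mulE cXE cWE // cYE repr_mx1 sub1 mul1g ffunE.
  case: ifP => Ku; last by rewrite !mulr0.
  by rewrite -mulrA (WYK _ Ku).
rewrite (eps_tri ro) // /eps -/t /tri_coef big_filter_cond; apply: eq_bigl => u.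
by case: eqP => [->|_]; rewrite ?Kk ?andbF.
Qed.

End Coinduction.

(** * Clifford theory for K in W *)

Section Intertwiners.
Variables (C : fieldType) (gT : finGroupType) (K : {group gT}).

Lemma intertwiner_free d m (rL : mx_representation C K d) (rE : mx_representation C K m)
    (B : 'M_(d, m)) : mx_irreducible rL -> B != 0 ->
  {in K, forall k, rL k *m B = B *m rE k} -> row_free B.
Proof.
move=> /mx_irrP[_ irrL] nzB BJ; rewrite -kermx_eq0; apply: contraNT nzB => nz.
have modk : mxmodule rL (kermx B).
  by apply/mxmoduleP => k Kk; apply/sub_kermxP; rewrite -mulmxA BJ // mulmxA mulmx_ker mul0mx.
have /sub_kermxP : (1%:M <= kermx B)%MS by rewrite sub1mx; apply: irrL.
by rewrite mul1mx => ->.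
Qed.

Lemma intertwiner_scalar d m (rL : mx_representation C K d) (rE : mx_representation C K m)
    (B : 'M_(d, m)) (a : gT -> C) b : row_free B ->
  {in K, forall k, rL k *m B = B *m rE k} ->
  \sum_(k in K) a k *: rE k = b%:M -> \sum_(k in K) a k *: rL k = b%:M.
Proof.
move=> /row_freeP[B' BB'] BJ E.
have EB : (\sum_(k in K) a k *: rL k) *m B = b%:M *m B.
  rewrite mulmx_suml -scalar_mxC -E mulmx_sumr; apply: eq_bigr => k Kk.
  by rewrite -scalemxAl BJ // scalemxAr.
by rewrite -[LHS]mulmx1 -BB' mulmxA EB -mulmxA BB' mulmx1.
Qed.

Lemma average_intertwines d m (rL : mx_representation C K d) (rE : mx_representation C K m)
    (M : 'M_(d, m)) (A := \sum_(k in K) rL k^-1%g *m M *m rE k) :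
  {in K, forall k, rL k *m A = A *m rE k}.
Proof.
move=> k Kk; rewrite mulmx_sumr mulmx_suml (reindex_inj (mulIg k)).
apply: eq_big => [x|x]; first by rewrite groupMr.
rewrite groupMr // => Kx; rewrite !mulmxA -(repr_mxM _ Kk (groupVr (groupM Kx Kk))).
by rewrite invMg mulKVg -[RHS]mulmxA -(repr_mxM rE Kx Kk).
Qed.

Variable sK : irrType C K.
Implicit Types l : sK.

Lemma constituentP l m (rE : mx_representation C K m) :
  is_constituent l rE <->
  exists2 B : 'M_(irr_degree l, m), B != 0 & {in K, forall k, irr_repr l k *m B = B *m rE k}.
Proof.
split=> [[U [modU [B _ freeB BJ]]]|[B nzB BJ]].
  exists (val_submod B); last first.
    by move=> k Kk; rewrite -val_submodJ // -BJ // val_submodE mulmxA -val_submodE.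
  rewrite val_submod_eq0; apply: contraTneq freeB => ->.
  rewrite /row_free mxrank0 eq_sym -lt0n.
  by have [] := proj1 (mx_irrP (irr_repr l)) (socle_irr l).
have freeB := intertwiner_free (socle_irr l) nzB BJ.
have sB : (B <= <<B>>)%MS by rewrite genmxE.
have modB : mxmodule rE <<B>>%MS.
  by apply/mxmoduleP => k Kk; rewrite (eqmxMr _ (genmxE B)) genmxE -BJ // submxMl.
exists <<B>>%MS, modB; exists (in_submod <<B>>%MS B).
- by rewrite genmxE; apply/esym/eqP.
- by rewrite /row_free mxrank_in_submod //.
move=> k Kk; apply: val_submod_inj.
rewrite (val_submodJ modB) // in_submodK // val_submodE -mulmxA -val_submodE.
by rewrite in_submodK // BJ.
Qed.

Lemma constituent_scalar l m (rE : mx_representation C K m) (a : gT -> C) b :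
  is_constituent l rE -> \sum_(k in K) a k *: rE k = b%:M ->
  \sum_(k in K) a k *: irr_repr l k = b%:M.
Proof.
move=> /constituentP[B nzB BJ].
exact: intertwiner_scalar (intertwiner_free (socle_irr l) nzB BJ) BJ.
Qed.

Hypothesis C'K : [pchar C]^'.-group K.

(* Averaging matrix units: if no l' gave a nonzero average, the matrix entries
   of rE would be annihilated by all irreducible representations. *)
Lemma constituent_exists m (rE : mx_representation C K m) : (0 < m)%N ->
  exists l, is_constituent l rE.
Proof.
case: m rE => // m rE _.
have [[l nz]|z] := pselect (exists l i, exists j,
    \sum_(k in K) irr_repr l k^-1%g *m delta_mx i j *m rE k != 0).
  exists l; have [i [j nzB]] := nz; apply/constituentP; eexists; first exact: nzB.
  exact: average_intertwines.
have E0 j i : forall k, k \in K -> (fun k => rE k^-1%g j i) k = 0.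
  apply: (irr_repr_faithful (sG := sK) C'K) => l.
  apply/matrixP => a b; rewrite summxE mxE.
  have := z; apply: contra_notP => nz; exists l, b, j.
  apply: contra_not_neq nz => /matrixP/(_ a i); rewrite summxE mxE => E.
  rewrite -[RHS]E [RHS](reindex_inj invg_inj) /=; apply: eq_big => [x|x Kx]; first by rewrite groupV.
  rewrite invgK -(mul_delta_mx (0 : 'I_1)) mulmxA -colE -mulmxA -rowE !mxE big_ord1 !mxE.
  by rewrite mulrC.
have := E0 0 0 1%g (group1 K); rewrite invg1 repr_mx1 mxE eqxx => /eqP.
by rewrite oner_eq0.
Qed.

End Intertwiners.

Section CliffordCorrespondence.
Variables (C : fieldType) (gT : finGroupType) (G K : {group gT}).
Hypothesis nKG : K <| G.
Let sKG : K \subset G := normal_sub nKG.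
Variables (sG : irrType C G) (sK : irrType C K).
Hypothesis C'G : [pchar C]^'.-group G.
Implicit Types (l : sK) (x : sG).

Definition under_irr l x := `[< is_constituent l (subg_repr (irr_repr x) sKG) >].

Lemma pchar_normal : [pchar C]^'.-group K.
Proof. exact: pgroupS sKG C'G. Qed.

Lemma under_irrP l x : reflect
  (exists2 B : 'M_(irr_degree l, irr_degree x), B != 0 &
    {in K, forall k, irr_repr l k *m B = B *m irr_repr x k}) (under_irr l x).
Proof. by apply: (iffP (asboolP _)); apply (constituentP l (subg_repr (irr_repr x) sKG)). Qed.

Lemma under_irr_total x : exists l, under_irr l x.
Proof.
have [x0 _] := proj1 (mx_irrP (irr_repr x)) (socle_irr x).
have [l lx] := constituent_exists sK pchar_normal (subg_repr (irr_repr x) sKG) x0.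
by exists l; apply/asboolP.
Qed.

(** If no average of a matrix unit gave an intertwiner from l to some x, the matrix entries of l,
    extended by zero from K to G, would be annihilated by every irreducible representation of G. *)
Lemma under_irr_onto l : exists x, under_irr l x.
Proof.
have [[x nz]|z] := pselect (exists x i, exists j,
    \sum_(k in K) irr_repr l k^-1%g *m delta_mx i j *m subg_repr (irr_repr x) sKG k != 0).
  exists x; have [i [j nzB]] := nz; apply/under_irrP; eexists; first exact: nzB.
  exact: average_intertwines.
have E0 j i k : k \in K -> irr_repr l k^-1%g j i = 0.
  move=> Kk; suff: (fun g => if g \in K then irr_repr l g^-1%g j i else 0) k = 0 by rewrite /= Kk.
  have Gk := subsetP sKG k Kk; move: k Gk {Kk}; apply: (irr_repr_faithful (sG := sG) C'G) => x.
  apply/matrixP => a b; rewrite summxE mxE.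
  have := z; apply: contra_notP => nz; exists x, i, a.
  apply: contra_not_neq nz => /matrixP/(_ j b); rewrite summxE mxE => E.
  rewrite -[RHS]E big_mkcond [RHS]big_mkcond; apply: eq_bigr => g _.
  case: ifP => Gg; last by case: ifP => // Kg; rewrite (subsetP sKG) in Gg.
  case: ifP => Kg; last by rewrite scale0r mxE.
  by rewrite -(mul_delta_mx (0 : 'I_1)) mulmxA -colE -mulmxA -rowE !mxE big_ord1 !mxE.
have [d0 _] := proj1 (mx_irrP (irr_repr l)) (socle_irr l).
have := E0 (Ordinal d0) (Ordinal d0) 1%g (group1 K); rewrite invg1 repr_mx1 mxE eqxx => /eqP.
by rewrite oner_eq0.
Qed.

Lemma conj_repr_irr l w (nKw : w \in 'N(K)) : mx_irreducible (conj_repr (irr_repr l) nKw).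
Proof.
apply/mx_irrP; have [d0 irrl] := proj1 (mx_irrP (irr_repr l)) (socle_irr l); split=> // U modU.
apply: irrl; apply/mxmoduleP => k Kk.
have /(mxmoduleP modU) : (k ^ w^-1)%g \in K by rewrite memJ_norm ?groupV.
by rewrite /= /conj_mx conjgKV.
Qed.

Lemma irr_conj_rsim l w (nKw : w \in 'N(K)) :
  mx_rsim (irr_repr (irr_conj (coset K w) l)) (conj_repr (irr_repr l) nKw).
Proof.
rewrite (irr_conj_coset nKw _ pchar_normal); apply: mx_rsim_sym.
exact: (rsim_irr_comp_pchar sK pchar_normal) (conj_repr_irr _ _).
Qed.

Lemma irr_conjP l l' w : w \in 'N(K) ->
  (exists2 B : 'M_(irr_degree l', irr_degree l), B != 0 &
    {in K, forall k, irr_repr l' k *m B = B *m irr_repr l (k ^ w)%g}) ->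
  l' = irr_conj (coset K w) l.
Proof.
move=> nKw [B nzB BJ]; rewrite (irr_conj_coset nKw _ pchar_normal).
have freeB := intertwiner_free (rE := conj_repr (irr_repr l) nKw) (socle_irr l') nzB BJ.
rewrite -[l' in LHS](irr_reprK_pchar pchar_normal).
apply: (irr_comp_rsim_pchar sK pchar_normal); exists B => //.
have fullB : row_full B.
  have [_ irrl] := proj1 (mx_irrP _) (conj_repr_irr l nKw).
  have modB : mxmodule (conj_repr (irr_repr l) nKw) <<B>>%MS.
    by apply/mxmoduleP => k Kk; rewrite (eqmxMr _ (genmxE B)) genmxE -BJ // submxMl.
  have := irrl _ modB; rewrite -submx0 genmxE submx0 => /(_ nzB).
  by rewrite /row_full genmxE.
exact: etrans (esym (eqP freeB)) (eqP fullB).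
Qed.

Lemma irr_conj1 l : irr_conj 1%g l = l.
Proof.
apply/esym; rewrite -(coset_id (group1 K)); apply: irr_conjP; first exact: group1.
exists 1%:M; last by move=> k Kk; rewrite conjg1 mulmx1 mul1mx.
have [d0 _] := proj1 (mx_irrP (irr_repr l)) (socle_irr l).
by apply/eqP => /matrixP/(_ (Ordinal d0) (Ordinal d0)); rewrite !mxE eqxx => /eqP; rewrite oner_eq0.
Qed.

Lemma irr_conjM w v l : w \in 'N(K) -> v \in 'N(K) ->
  irr_conj (coset K w * coset K v)%g l = irr_conj (coset K w) (irr_conj (coset K v) l).
Proof.
move=> nKw nKv; rewrite -morphM //; apply/esym; apply: irr_conjP; first exact: groupM.
have [A Aeq Afree AJ] := irr_conj_rsim (irr_conj (coset K v) l) nKw.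
have [B Beq Bfree BJ] := irr_conj_rsim l nKv.
exists (A *m B).
  rewrite -mxrank_eq0 mxrankMfree //; move/eqP: Afree => ->; rewrite -lt0n.
  by have [] := proj1 (mx_irrP (irr_repr (irr_conj (coset K w) (irr_conj (coset K v) l)))) (socle_irr _).
move=> k Kk; rewrite mulmxA AJ // -[LHS]mulmxA -[RHS]mulmxA; congr (_ *m _).
have Kkw : (k ^ w)%g \in K by rewrite memJ_norm.
by rewrite conjgM; apply: (BJ _ Kkw).
Qed.

(** Translating a copy of l inside x by w^-1 gives a copy of the conjugate representation. *)
Lemma under_irr_conj l x w : w \in G -> under_irr l x -> under_irr (irr_conj (coset K w) l) x.
Proof.
move=> Gw /under_irrP[B nzB BJ]; have nKw := subsetP (normal_norm nKG) w Gw.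
have [A Aeq Afree AJ] := irr_conj_rsim l nKw.
apply/under_irrP; exists (A *m B *m irr_repr x w^-1%g).
  have fB := intertwiner_free (rE := subg_repr (irr_repr x) sKG) (socle_irr l) nzB BJ.
  rewrite -mxrank_eq0 mxrankMfree; last by rewrite row_free_unit repr_mx_unit ?groupV.
  rewrite mxrankMfree //; move/eqP: Afree => ->; rewrite -lt0n.
  by have [] := proj1 (mx_irrP (irr_repr (irr_conj (coset K w) l))) (socle_irr _).
move=> k Kk; have Gk := subsetP sKG k Kk.
rewrite (mulmxA (irr_repr _ k) (A *m B)) (mulmxA (irr_repr _ k) A) AJ //.
have Kkw : (k ^ w)%g \in K by rewrite memJ_norm.
have -> : A *m conj_repr (irr_repr l) nKw k *m B = A *m (B *m irr_repr x (k ^ w)%g).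
  by rewrite -mulmxA; congr (_ *m _); apply: (BJ _ Kkw).
rewrite (mulmxA A B) -[LHS]mulmxA -[RHS]mulmxA; congr (_ *m _).
rewrite -(repr_mxM (irr_repr x) (groupVr Gw) Gk).
by rewrite -(repr_mxM (irr_repr x) (groupJ Gk Gw) (groupVr Gw)) conjgE -!mulgA mulgV mulg1.
Qed.

(** With P an intertwiner from x back to l, some B' g P must be nonzero: otherwise P would kill the
    G-span of the copy of l', which is all of x. A nonzero B' g P intertwines l' with a conjugate of
    l. *)
Lemma under_irr_orbit l l' x : under_irr l x -> under_irr l' x ->
  exists2 w, w \in G & l' = irr_conj (coset K w) l.
Proof.
move=> /under_irrP[B nzB BJ] /under_irrP[B' nzB' BJ'].
have fB := intertwiner_free (rE := subg_repr (irr_repr x) sKG) (socle_irr l) nzB BJ.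
have /row_freeP[M BM] := fB.
(* Averaging a right inverse M of B over K yields an intertwiner with B P = |K|, nonzero in the
   field. *)
pose P := \sum_(k in K) irr_repr x k^-1%g *m M *m irr_repr l k.
have PJ : {in K, forall k, irr_repr x k *m P = P *m irr_repr l k}.
  exact: (@average_intertwines _ _ _ _ _ (subg_repr (irr_repr x) sKG) (irr_repr l) M).
have BP : B *m P = #|K|%:R%:M.
  rewrite mulmx_sumr (eq_bigr (fun=> 1%:M)) => [|k Kk].
    by rewrite sumr_const raddfMn.
  rewrite 2!(mulmxA B) -(BJ _ (groupVr Kk)) -(mulmxA _ B) BM mulmx1.
  by rewrite -(repr_mxM (irr_repr l) (groupVr Kk) Kk) mulVg repr_mx1.
have nzP : P != 0.
  apply: contra_eq_neq BP => ->; rewrite mulmx0 eq_sym.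
  have [d0 _] := proj1 (mx_irrP (irr_repr l)) (socle_irr l).
  apply/eqP => /matrixP/(_ (Ordinal d0) (Ordinal d0)); rewrite !mxE eqxx mulr1n => /eqP.
  by apply/negP; rewrite natf_neq0_pchar; apply: pchar_normal.
have [[w Gw nz]|z] := pselect (exists2 w, w \in G & B' *m irr_repr x w *m P != 0).
  exists w => //; apply: irr_conjP; first exact: subsetP (normal_norm nKG) w Gw.
  exists (B' *m irr_repr x w *m P) => // k Kk; have Gk := subsetP sKG k Kk.
  rewrite (mulmxA (irr_repr l' k) (B' *m _)) (mulmxA (irr_repr l' k) B') BJ' //.
  rewrite -(mulmxA B') -(repr_mxM (irr_repr x) Gk Gw) conjgC.
  have Kkw : (k ^ w)%g \in K by rewrite memJ_norm // (subsetP (normal_norm nKG)).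
  rewrite (repr_mxM (irr_repr x) Gw (subsetP sKG _ Kkw)) -[RHS]mulmxA -PJ //.
  by rewrite (mulmxA B') -[LHS]mulmxA.
pose U := (\sum_(g in G) <<B' *m irr_repr x g>>)%MS.
have modU : mxmodule (irr_repr x) U.
  apply/mxmoduleP => g Gg; rewrite sumsmxMr; apply/sumsmx_subP => h Gh.
  rewrite (eqmxMr _ (genmxE _)) -mulmxA -(repr_mxM (irr_repr x) Gh Gg).
  by rewrite (submx_trans _ (sumsmx_sup (h * g)%g _ (submx_refl _))) ?genmxE ?groupM.
have [_ irrx] := proj1 (mx_irrP (irr_repr x)) (socle_irr x).
have nzU : U != 0.
  apply: contraNneq nzB' => U0; rewrite -submx0 -U0.
  by rewrite (submx_trans _ (sumsmx_sup 1%g _ (submx_refl _))) // genmxE repr_mx1 mulmx1.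
case/eqP: nzP; rewrite -[P]mul1mx; apply/sub_kermxP.
apply: (submx_trans (B := U)); first by rewrite sub1mx irrx.
apply/sumsmx_subP => g Gg; rewrite genmxE; apply/sub_kermxP.
by apply/eqP; apply: contraT => nz; case: z; exists g.
Qed.

End CliffordCorrespondence.

(** * From central idempotents for W to those for K *)

Section CentralLift.
Variables (C : fieldType) (gT : finGroupType) (G : {group gT}) (n : nat).
Variable rG : mx_representation C G n.
Hypothesis C'G : [pchar C]^'.-group G.
Variables (H : pzRingType) (c : gT -> C) (W : gT -> H) (EX EY : mpoly n C -> H).
Hypothesis ro : restricted_ops rG c W EX EY.
Variable sG : irrType C G.

(** All scalars of z being 0 or 1, the central element z(1 - z) has vanishing [eps] and is
    nilpotent. The Newton step keeps z central and fixes the scalars 0 and 1, so it leads to an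
    idempotent for the same set. *)
Lemma block_set_central (S : {set sG}) z : (forall a, z * a = a * z) ->
  (forall l, eps_mx ro (irr_repr l) z = (l \in S)%:R%:M) -> block_set ro S.
Proof.
move=> zC zS.
pose P y := (forall a, y * a = a * y) /\ forall l : sG, eps_mx ro (irr_repr l) y = (l \in S)%:R%:M.
pose N := ((n * #|G|).+1 + (n * #|G|).+1)%N.
have nil : (z * (1 - z)) ^+ (2 ^ N)%N = 0.
  have zzC a : z * (1 - z) * a = a * (z * (1 - z)).
    have nzC : (1 - z) * a = a * (1 - z) by rewrite mulrBl mulrBr mul1r mulr1 zC.
    by rewrite -mulrA nzC mulrA zC mulrA.
  have zz0 g : eps ro (z * (1 - z)) g = 0.
    rewrite -(eps0 ro g); apply: (eps_mx_faithful (sG := sG) C'G) => l.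
    rewrite eps_mx_central // eps_mxD eps_mxN eps_mx1 zS eps_mx0.
    by case: (l \in S); rewrite ?subrr ?mul0mx // raddf0 mulmx0.
  rewrite -(subnK (ltnW (ltn_expl N (isT : 1 < 2)%N))) exprD.
  by rewrite [X in _ * X](eps0_nilpotent zzC zz0) mulr0.
have Pstep y : P y -> P (y * y * (y + (1 - y) *+ 3)).
  move=> [yC yS]; set b := (y + _).
  have bC a : b * a = a * b.
    by rewrite /b mulrDl mulrDr mulrnAl mulrnAr mulrBl mulrBr mul1r mulr1 yC.
  split=> [a|l]; first by rewrite -mulrA bC mulrA -(mulrA y y a) (yC a) (mulrA y a y) (yC a) !mulrA.
  rewrite -mulrA !eps_mx_central // eps_mxD yS.
  have E m : eps_mx ro (irr_repr l) ((1 - y) *+ m) = (1%:M - (l \in S)%:R%:M) *+ m.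
    elim: m => [|m IH]; first by rewrite !mulr0n eps_mx0.
    by rewrite !mulrS eps_mxD IH eps_mxD eps_mxN eps_mx1 yS.
  rewrite E; case: (l \in S); first by rewrite subrr mul0rn addr0 !mulmx1.
  by rewrite (raddf0 (@scalar_mx _ _)) !mulmx0.
have [e [eC eS] ee] := idempotent_lift Pstep (conj zC zS) nil.
by exists e; split.
Qed.

End CentralLift.

Section Restriction.
Variables (C : fieldType) (gT : finGroupType) (G K : {group gT}) (n : nat).
Variable rG : mx_representation C G n.
Hypotheses (C0 : [pchar C] =i pred0) (C'G : [pchar C]^'.-group G).
Hypotheses (nKG : K <| G) (faithG : mx_faithful rG).
Let sKG : K \subset G := normal_sub nKG.
Let rK := subg_repr rG sKG.
Variables (c : gT -> C) (H HG : pzRingType).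
Variables (W : gT -> H) (EX EY : mpoly n C -> H) (WG : gT -> HG) (XG YG : mpoly n C -> HG).
Hypothesis ro : restricted_ops rK c W EX EY.
Hypothesis roG : restricted_ops rG (extend_by_zero (reflections rK) c) WG XG YG.
Hypothesis descent : forall e : HG, (forall a, e * a = a * e) ->
  exists z : H, (forall a, z * a = a * z) /\ {in K, forall k, eps ro z k = eps roG e k}.
Variables (sG : irrType C G) (sK : irrType C K).

Lemma ext_outside s : s \in reflections rG -> s \notin K ->
  extend_by_zero (reflections rK) c s = 0.
Proof. by move=> _ nKs; rewrite /extend_by_zero inE (negPf nKs). Qed.

Lemma eps_mx_subgroup e (x : sG) : (forall a, e * a = a * e) ->
  eps_mx roG (irr_repr x) e = \sum_(k in K) eps roG e k^-1%g *: irr_repr x k.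
Proof.
move=> eC; rewrite /eps_mx (reindex_inj invg_inj) /= [LHS](bigID (mem K)) /=.
rewrite [X in _ + X]big1 ?addr0 => [|g /andP[Gg nKg]]; last first.
  by rewrite (central_support C0 nKG faithG roG ext_outside eC) ?scale0r ?groupV // -groupV.
apply: eq_big => [g|g _]; last by rewrite invgK.
by rewrite groupV; case Kg: (g \in K); rewrite ?andbF // (subsetP sKG).
Qed.

(** By its support, e acts on x through its coefficients on K, which are those of z. A scalar action
    on x passes to every constituent l, so z acts on l by the scalar of e on any x above l. *)
Lemma block_set_res (S : {set sG}) : block_set roG S ->
  block_set ro [set l : sK | [exists x in S, under_irr nKG l x]] /\
  forall x (l : sK), under_irr nKG l x ->
    (l \in [set l : sK | [exists x in S, under_irr nKG l x]]) = (x \in S).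
Proof.
move=> [e [[ee eC] eS]]; have [z [zC zK]] := descent eC; set T := [set l | _].
have zE (l : sK) x : under_irr nKG l x -> eps_mx ro (irr_repr l) z = (x \in S)%:R%:M.
  move=> lx; rewrite /eps_mx (reindex_inj invg_inj) /=.
  have := eps_mx_subgroup x eC; rewrite eS => /esym E.
  rewrite -(constituent_scalar (asboolP _ lx) E).
  apply: eq_big => [g|g]; first by rewrite groupV.
  by rewrite groupV => Kg; rewrite invgK zK ?groupV.
have TE x (l : sK) : under_irr nKG l x -> (l \in T) = (x \in S).
  move=> lx; rewrite inE; apply/existsP/idP => [[x' /andP[x'S lx']]|xS]; last by exists x; rewrite xS.
  have := zE _ _ lx; rewrite (zE _ _ lx') x'S; case: (x \in S) => // E.
  by case/negP: (irr_one_neq0 l); rewrite E; apply/eqP/matrixP => i j; rewrite !mxE mul0rn.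
split=> //; apply: (block_set_central (pchar_normal nKG C'G) zC) => l.
by have [x lx] := under_irr_onto nKG sG C'G l; rewrite (zE _ _ lx) (TE x).
Qed.

End Restriction.

Section RestrictedDescent.
Variables (C : fieldType) (gT : finGroupType) (G K : {group gT}) (n : nat).
Variable rG : mx_representation C G n.
Hypotheses (C0 : [pchar C] =i pred0) (nKG : K <| G).
Let rK := subg_repr rG (normal_sub nKG).
Variable c : gT -> C.
Let c' := extend_by_zero (reflections rK) c.
Hypothesis cG : forall s w, s \in reflections rK -> w \in G -> c (s ^ w)%g = c s.
Hypothesis c'G : forall s w, s \in reflections rG -> w \in G -> c' (s ^ w)%g = c' s.
Variables (H : pzRingType) (W : gT -> H) (EX EY : mpoly n C -> H).
Hypothesis ro : restricted_ops rK c W EX EY.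

Lemma restricted_descent (e : restricted_cherednik rG c') : (forall a, e * a = a * e) ->
  exists z : H, (forall a, z * a = a * z) /\
    {in K, forall k, eps ro z k = eps (hbar_restricted_ops C0 c'G) e k}.
Proof.
have [Psi [PsiD PsiM _ [PsiX PsiY PsiW]]] := hbar_lift C0 (coind_ops cG ro) (coind_D ro).
exact: (central_descent_of (hbar_restricted_ops C0 c'G) PsiD PsiM PsiX PsiY PsiW).
Qed.

End RestrictedDescent.

(** * Twisting Hbar(K) by elements of W *)

Section ConjugationAutomorphism.
Variables (C : fieldType) (gT : finGroupType) (G K : {group gT}) (n : nat).
Variable rG : mx_representation C G n.
Hypotheses (C0 : [pchar C] =i pred0) (nKG : K <| G).
Let sKG : K \subset G := normal_sub nKG.
Let rK := subg_repr rG sKG.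
Local Notation mp := (mpoly n C).
Variables (c : gT -> C) (H : pzRingType) (W : gT -> H) (EX EY : mp -> H).
Hypothesis cG : forall s w, s \in reflections rK -> w \in G -> c (s ^ w)%g = c s.
Hypothesis ro : restricted_ops rK c W EX EY.
Let ops := ro_ops ro.

Definition conj_term w (u : mp * gT * mp) : mp * gT * mp :=
  (sub (rG w) u.1.1, (u.1.2 ^ w^-1)%g, sub (dual_repr rG w) u.2).

Lemma reflectionsK_conj s w : w \in G -> ((s ^ w)%g \in reflections rK) = (s \in reflections rK).
Proof.
move=> Gw; rewrite !subK_reflections 2!in_setI.
by rewrite (reflections_conj rG) // memJ_norm // (subsetP (normal_norm nKG)).
Qed.

Lemma conj_ops w : w \in G -> cherednik_ops rK c (fun k => W (k ^ w^-1)%g)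
  (fun p => EX (sub (rG w) p)) (fun q => EY (sub (dual_repr rG w) q)).
Proof.
move=> Gw; have nw k : k \in K -> (k ^ w^-1)%g \in K.
  by move=> Kk; rewrite memJ_norm ?groupV // (subsetP (normal_norm nKG)).
have conjw k : (w * k)%g = (k ^ w^-1 * w)%g by rewrite conjgE invgK !mulgA mulgKV.
split.
- by move=> p q; rewrite subD (co_XD ops).
- by move=> p q; rewrite subM (co_XM ops).
- by rewrite -mpolyC1 subC mpolyC1 (co_X1 ops).
- by move=> p q; rewrite subD (co_YD ops).
- by move=> p q; rewrite subM (co_YM ops).
- by move=> a; rewrite !subC (co_YC ops).
- by move=> a h; rewrite subC (co_sC ops).
- by rewrite conj1g (co_W1 ops).
- by move=> g h Kg Kh; rewrite conjMg (co_WM ops) ?nw.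
- move=> g x Kg; have Gg := subsetP sKG g Kg; have Kg' := nw g Kg.
  rewrite !sub_lin (co_WX ops) // /= !mulmxA -(repr_mxM rG Gw Gg) conjw.
  by rewrite -(repr_mxM rG (subsetP sKG _ Kg') Gw).
- move=> g x Kg; have Gg := subsetP sKG g Kg; have Kg' := nw g Kg.
  rewrite !sub_lin (co_WY ops) // !mulmxA -(repr_mxM (dual_repr rG) Gw Gg) conjw.
  by rewrite (repr_mxM (dual_repr rG) (subsetP sKG _ Kg') Gw).
move=> y x; rewrite !sub_lin -[dual_repr rG w *m y^T]trmxK (co_YX ops) trmx_mul trmxK /= /dual_mx trmxK.
congr (- _); rewrite [LHS](reindex_inj (conjg_inj w^-1%g)).
apply: eq_big => [s|s]; first by rewrite reflectionsK_conj ?groupV.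
rewrite reflectionsK_conj ?groupV // => Rs.
rewrite cG ?groupV // subC; congr (EX (_ * _)%:MP * _).
have Gs : s \in G by move: Rs; rewrite subK_reflections inE => /andP[/reflections_in].
rewrite -[root_mx rK _]/(root_mx rG _) root_mx_conj ?groupV // /pairing invgK !mulmxA.
rewrite -(mulmxA y (rG w^-1%g)) -(repr_mxM rG (groupVr Gw) Gw) mulVg repr_mx1 mulmx1.
by rewrite -(mulmxA _ (rG w^-1%g) (rG w)) -(repr_mxM rG (groupVr Gw) Gw) mulVg repr_mx1 mulmx1.
Qed.

Lemma conj_D w s : w \in G -> D_seq rK s ->
  \sum_(u <- s) EX (sub (rG w) u.1) * EY (sub (dual_repr rG w) u.2) = 0.
Proof.
move=> Gw [Is s0].
rewrite -(big_map (fun u => (sub (rG w) u.1, sub (dual_repr rG w) u.2)) predT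
  (fun u : mp * mp => EX u.1 * EY u.2)) (ro_D ro) //; split.
  move=> _ /mapP[u /Is[I1 I2] ->]; split; first exact: inv_conj.
  exact: (inv_conj (rG := dual_repr rG)).
by rewrite big_map -[RHS]s0; apply: eq_bigr => u _; rewrite !constant_term_sub.
Qed.

Variables (w : gT) (theta : H -> H).
Hypothesis Gw : w \in G.
Hypotheses (thetaD : {morph theta : a b / a + b}) (thetaM : {morph theta : a b / a * b}).
Hypothesis thetaX : forall p, theta (EX p) = EX (sub (rG w) p).
Hypothesis thetaY : forall q, theta (EY q) = EY (sub (dual_repr rG w) q).
Hypothesis thetaW : {in K, forall k, theta (W k) = W (k ^ w^-1)%g}.

Lemma theta_tri t : tri_in K t -> theta (tri W EX EY t) = tri W EX EY (map (conj_term w) t).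
Proof.
move=> /allP Kt; rewrite /tri (rmap_sum thetaD) big_map !big_seq; apply: eq_bigr => u /Kt Ku.
by rewrite !thetaM thetaX thetaY thetaW.
Qed.

Lemma tri_in_conj t : tri_in K t -> tri_in K (map (conj_term w) t).
Proof.
move=> /allP Kt; apply/allP => _ /mapP[u /Kt Ku ->] /=.
by rewrite memJ_norm ?groupV // (subsetP (normal_norm nKG)).
Qed.

Lemma eps_theta h k : k \in K -> eps ro (theta h) (k ^ w^-1)%g = eps ro h k.
Proof.
move=> Kk; have nKw := subsetP (normal_norm nKG) w Gw.
elim/(eps_ind ro): h => [|a b Ea Eb|p g q Kg].
- by rewrite (rmap0 thetaD) !eps0.
- by rewrite thetaD !epsD Ea Eb.
rewrite !thetaM thetaX thetaY thetaW // !eps_term ?memJ_norm ?groupV //.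
by rewrite !constant_term_sub (inj_eq (conjg_inj _)).
Qed.

Lemma theta_central e : (forall a, e * a = a * e) -> forall a, theta e * a = a * theta e.
Proof.
move=> eC a; have nKw := subsetP (normal_norm nKG) w Gw.
have key b : theta e * theta b = theta b * theta e by rewrite -!thetaM eC.
have subK (r : mx_representation C G n) p : p = sub (r w) (sub (r w^-1%g) p).
  by rewrite sub_mul -repr_mxM ?groupV // mulgV repr_mx1 sub1.
elim/(eps_ind ro): a => [|a b Ea Eb|p k q Kk]; first by rewrite mulr0 mul0r.
  by rewrite mulrDr mulrDl Ea Eb.
(* Every term is the image of its translate by w^-1, so commuting with the image of [theta] amounts
   to being central. *)
have -> : EX p * W k * EY q = theta (EX (sub (rG w^-1%g) p) * W (k ^ w)%g * EY (sub (dual_repr rG w^-1%g) q)).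
  by rewrite !thetaM thetaX thetaY thetaW ?memJ_norm // -!subK conjgK.
exact: key.
Qed.

Variable sK : irrType C K.
Hypothesis C'G : [pchar C]^'.-group G.

Lemma represents_theta (S : {set sK}) e :
  represents ro S e -> represents ro [set irr_conj (coset K w) l | l in S] (theta e).
Proof.
have nKw := subsetP (normal_norm nKG) w Gw.
move=> [[ee eC] eS]; split; first by split; [rewrite -thetaM ee|exact: theta_central].
move=> l; pose l' := irr_conj (coset K w^-1%g) l.
have cosV : (coset K w * coset K w^-1)%g = 1%g.
  by rewrite -morphM ?groupV // mulgV morph1.
have cosV' : (coset K w^-1 * coset K w)%g = 1%g.
  by rewrite -morphM ?groupV // mulVg morph1.
have lE : l = irr_conj (coset K w) l'.
  by rewrite /l' -(irr_conjM nKG C'G) ?groupV // cosV (irr_conj1 nKG C'G).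
have -> : (l \in [set irr_conj (coset K w) l | l in S]) = (l' \in S).
  apply/imsetP/idP => [[m mS E]|l'S]; last by exists l'.
  by rewrite /l' E -(irr_conjM nKG C'G) ?groupV // cosV' (irr_conj1 nKG C'G).
have nKw' : (w^-1)%g \in 'N(K) by rewrite groupV.
have [B _ fB BJ] := mx_rsim_sym (irr_conj_rsim nKG C'G l nKw').
have := eS l'; rewrite /eps_mx (reindex_inj invg_inj) /= => E.
have {E} := intertwiner_scalar (b := (l' \in S)%:R) (a := fun k => eps ro e k^-1%g) fB BJ.
move=> E; rewrite (reindex_inj (conjg_inj w^-1%g)) /= -[RHS]E.
  rewrite [RHS](reindex_inj invg_inj) /=.
  apply: eq_big => [k|k]; first by rewrite memJ_norm // groupV.
  rewrite memJ_norm // => Kk; rewrite eps_theta // invgK; congr (_ *: _).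
  by rewrite /conj_mx conjVg.
rewrite -[RHS]eS /eps_mx [RHS](reindex_inj invg_inj) /=.
by apply: eq_big => [k|k _]; rewrite ?groupV // invgK.
Qed.

End ConjugationAutomorphism.

(** * From central idempotents for K to those for W *)

Section ProductOps.
Variables (C : fieldType) (gT : finGroupType) (G : {group gT}) (n : nat).
Variables (rG : mx_representation C G n) (c : gT -> C) (H H' : pzRingType).
Variables (W : gT -> H) (EX EY : mpoly n C -> H) (W' : gT -> H') (EX' EY' : mpoly n C -> H').

(** A triangular element of the product ring is a pair of elements with a common triangular
    expression; closure properties of such pairs then come for free. *)
Lemma pair_ops : cherednik_ops rG c W EX EY -> cherednik_ops rG c W' EX' EY' ->
  cherednik_ops rG c (fun g => (W g, W' g)) (fun p => (EX p, EX' p)) (fun q => (EY q, EY' q)).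
Proof.
move=> [XD XM X1 YD YM YC sC W1 WM WX WY YX] [XD' XM' X1' YD' YM' YC' sC' W1' WM' WX' WY' YX'].
split.
- by move=> p q; exact: (f_equal2 pair (XD p q) (XD' p q)).
- by move=> p q; exact: (f_equal2 pair (XM p q) (XM' p q)).
- exact: (f_equal2 pair X1 X1').
- by move=> p q; exact: (f_equal2 pair (YD p q) (YD' p q)).
- by move=> p q; exact: (f_equal2 pair (YM p q) (YM' p q)).
- by move=> a; exact: (f_equal2 pair (YC a) (YC' a)).
- by move=> a [h h']; exact: (f_equal2 pair (sC a h) (sC' a h')).
- exact: (f_equal2 pair W1 W1').
- by move=> g h Gg Gh; exact: (f_equal2 pair (WM g h Gg Gh) (WM' g h Gg Gh)).
- by move=> g x Gg; exact: (f_equal2 pair (WX g x Gg) (WX' g x Gg)).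
- by move=> g x Gg; exact: (f_equal2 pair (WY g x Gg) (WY' g x Gg)).
move=> y x; apply: etrans (f_equal2 pair (YX y x) (YX' y x)) _.
have pair_sum (I : Type) (r : seq I) (P : pred I) (F : I -> H) (F' : I -> H') :
    (\sum_(i <- r | P i) F i, \sum_(i <- r | P i) F' i) = \sum_(i <- r | P i) (F i, F' i).
  by apply: (big_rec3 (fun u v w => (u, v) = w)) => // i u v _ _ <-.
by rewrite -pair_sum.
Qed.

Lemma pair_tri t : tri (fun g => (W g, W' g)) (fun p => (EX p, EX' p)) (fun q => (EY q, EY' q)) t
  = (tri W EX EY t, tri W' EX' EY' t).
Proof.
by apply: (big_rec3 (fun x y z => x = (y, z))) => // u x y z _ ->.
Qed.

End ProductOps.

Section Induction.
Variables (C : fieldType) (gT : finGroupType) (G K : {group gT}) (n : nat).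
Variable rG : mx_representation C G n.
Hypotheses (C0 : [pchar C] =i pred0) (C'G : [pchar C]^'.-group G) (nKG : K <| G).
Let sKG : K \subset G := normal_sub nKG.
Let rK := subg_repr rG sKG.
Local Notation mp := (mpoly n C).
Variables (c : gT -> C) (H HG : pzRingType).
Variables (W : gT -> H) (EX EY : mp -> H) (WG : gT -> HG) (XG YG : mp -> HG).
Hypothesis ro : restricted_ops rK c W EX EY.
Hypothesis roG : restricted_ops rG (extend_by_zero (reflections rK) c) WG XG YG.
Let ops := ro_ops ro.
Let opsG := ro_ops roG.

(** Since c is extended by zero, reflections outside K drop out of the commutator, and Hbar(W)
    satisfies the relations attached to K. *)
Lemma sub_ops : cherednik_ops rK c WG XG YG.
Proof.
have [XD XM X1 YD YM YC sC W1 WM WX WY YX] := opsG; split=> //.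
- by move=> g h Kg Kh; rewrite WM ?(subsetP sKG).
- by move=> g x Kg; rewrite WX ?(subsetP sKG).
- by move=> g x Kg; rewrite WY ?(subsetP sKG).
move=> y x; rewrite YX; congr (- _); rewrite (bigID (mem K)) /= [X in _ + X]big1 ?addr0.
  apply: eq_big => [s|s /andP[Rs Ks]]; first by rewrite subK_reflections in_setI.
  by rewrite /extend_by_zero subK_reflections in_setI Rs Ks.
move=> s /andP[Rs nKs].
by rewrite ext_outside // mul0r mpolyC0 (co_X0 opsG) mul0r.
Qed.

Local Notation A := (triangular K WG XG YG).

Lemma inv_centralX p a : inv rK p -> A a -> XG p * a = a * XG p.
Proof. exact: (inv_comm C0 sub_ops). Qed.

Lemma inv_centralY q a : inv (dual_repr rK) q -> A a -> YG q * a = a * YG q.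
Proof.
move=> Iq; move: a; apply: triangular_ind; first by rewrite mul0r mulr0.
  by move=> a b; rewrite mulrDl mulrDr => -> ->.
move=> p k r Kk; have WY : WG k * YG q = YG q * WG k by rewrite (co_WYp sub_ops) // Iq.
rewrite -!mulrA -[YG r * YG q](co_YM opsG) [r * q]mulrC (co_YM opsG) (mulrA (WG k)) WY.
by rewrite !mulrA (inv_commY C0 (dual_ops C0 sub_ops) p Iq).
Qed.

(* The products of K-invariants of h and h* of total order at least k span, over
   the subalgebra A generated by K, h and h*, ideals vanishing for large k. *)
Inductive inv_ideal (k : nat) : HG -> Prop :=
| inv_ideal0 : inv_ideal k 0
| inv_idealD a b : inv_ideal k a -> inv_ideal k b -> inv_ideal k (a + b)
| inv_idealT i j p q a : inv rK p -> inv (dual_repr rK) q -> order_ge i p -> order_ge j q ->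
    (k <= i + j)%N -> A a -> inv_ideal k (XG p * YG q * a).

Lemma inv_idealMr k x a : inv_ideal k x -> A a -> inv_ideal k (x * a).
Proof.
move=> + Aa; elim=> [|b d _ Nb _ Nd|i j p q b Ip Iq op oq kij Ab].
- by rewrite mul0r; apply: inv_ideal0.
- by rewrite mulrDl; apply: inv_idealD.
by rewrite -mulrA; apply: (inv_idealT Ip Iq op oq kij); apply: (triangularM C0 sub_ops).
Qed.

Lemma inv_idealMl k x a : inv_ideal k x -> A a -> inv_ideal k (a * x).
Proof.
move=> + Aa; elim=> [|b d _ Nb _ Nd|i j p q b Ip Iq op oq kij Ab].
- by rewrite mulr0; apply: inv_ideal0.
- by rewrite mulrDr; apply: inv_idealD.
rewrite 2!mulrA -(inv_centralX Ip Aa) -(mulrA _ a) -(inv_centralY Iq Aa) mulrA -mulrA.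
by apply: (inv_idealT Ip Iq op oq kij); apply: (triangularM C0 sub_ops).
Qed.

Lemma inv_idealM j k x y : inv_ideal j x -> inv_ideal k y -> inv_ideal (j + k) (x * y).
Proof.
move=> + Ny; elim=> [|b d _ Nb _ Nd|i i' p q a Ip Iq op oq ji Aa].
- by rewrite mul0r; apply: inv_ideal0.
- by rewrite mulrDl; apply: inv_idealD.
rewrite -mulrA; have := inv_idealMl Ny Aa; move: (a * y) => z; elim=> [|b d _ Nb _ Nd|].
- by rewrite mulr0; apply: inv_ideal0.
- by rewrite mulrDr; apply: inv_idealD.
move=> l l' p' q' b Ip' Iq' op' oq' kl Ab.
have -> : XG p * YG q * (XG p' * YG q' * b) = XG (p * p') * YG (q * q') * b.
  rewrite (co_XM opsG) (co_YM opsG) !mulrA; congr (_ * _ * _); rewrite -!mulrA; congr (_ * _).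
  by rewrite (inv_centralY Iq (triangularX sub_ops p')).
apply: (inv_idealT (invM Ip Ip') (invM Iq Iq') (order_geM op op') (order_geM oq oq')) => //.
by rewrite addnACA leq_add.
Qed.

(** One of the two invariants in each product has order above n |G|, hence lies in the Hilbert ideal
    of G and vanishes in Hbar(W). *)
Lemma inv_ideal_vanish x : inv_ideal ((n * #|G|).+1 + (n * #|G|).+1) x -> x = 0.
Proof.
elim=> [//|b d _ -> _ ->|i j p q a Ip Iq op oq kij Aa]; first by rewrite addr0.
have [Ni|iN] := leqP (n * #|G|).+1 i.
  rewrite (coinvX0 roG) ?mul0r //; exact: coinv_order (order_geW Ni op).
have Nj : ((n * #|G|).+1 <= j)%N by rewrite -(leq_add2l i); apply: leq_trans kij; rewrite leq_add2r ltnW.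
rewrite (coinvY0 roG) ?mulr0 ?mul0r //; exact: coinv_order (order_geW Nj oq).
Qed.

Lemma inv_ideal_D s : D_seq rK s -> inv_ideal 1 (\sum_(u <- s) XG u.1 * YG u.2).
Proof.
move=> [Is s0].
(* Uses fq - f(0)q(0) = (f - f(0))q + f(0)(q - q(0)); the sum of the products of constant terms is
   zero. *)
have -> : \sum_(u <- s) XG u.1 * YG u.2 = \sum_(u <- s) (XG (u.1 - (constant_term u.1)%:MP) * YG u.2 * 1
    + XG (constant_term u.1)%:MP * YG (u.2 - (constant_term u.2)%:MP) * 1).
  apply/eqP; rewrite -subr_eq0 -sumrB (eq_bigr (fun u : mp * mp => XG (constant_term u.1 * constant_term u.2)%:MP)).
    by rewrite -(co_Xsum opsG) -(big_morph (@mpolyC n C) (@mpolyCD n C) (mpolyC0 _ _)) s0 mpolyC0 (co_X0 opsG).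
  move=> u _; rewrite !mulr1 (co_XD opsG) (co_YD opsG) (co_XN opsG) (co_YN opsG) mulrDl mulrDr.
  rewrite addrA mulNr subrK mulrN opprB addrC subrK (co_YC opsG) -(co_XM opsG).
  by rewrite mpolyCM.
rewrite big_seq; apply: (big_ind (inv_ideal 1)) => [||u /Is[I1 I2]]; [exact: inv_ideal0|exact: inv_idealD|].
have A1 := triangular1 sub_ops.
have ct p : order_ge 1 (p - (constant_term p)%:MP).
  by apply/order_ge1; rewrite /constant_term mevalB mevalC subrr.
have invB (r : mx_representation C K n) p a : inv r p -> inv r (p - a%:MP).
  by move=> Ip g Kg; rewrite sub_subr Ip // subC.
apply: inv_idealD.
  by apply: (@inv_idealT 1 1 0) => //; exact: invB.
by apply: (@inv_idealT 1 0 1) => //; [exact: invC|exact: invB].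
Qed.

Lemma inv_idealX x k : inv_ideal 1 x -> inv_ideal k (x ^+ k).
Proof.
move=> N1; elim: k => [|k IH]; last by rewrite exprS -add1n; apply: inv_idealM.
have -> : x ^+ 0 = XG 1 * YG 1 * 1 by rewrite (co_X1 opsG) (co_Y1 opsG) !mulr1.
have inv1 (r : mx_representation C K n) : inv r 1 by rewrite -mpolyC1; apply: invC.
exact: (@inv_idealT 0 0 0 _ _ _ (inv1 _) (inv1 _) _ _ _ (triangular1 sub_ops)).
Qed.

Lemma inv_idealW j k x : (j <= k)%N -> inv_ideal k x -> inv_ideal j x.
Proof.
move=> jk; elim=> [|b d _ Nb _ Nd|i j' p q a Ip Iq op oq kij Aa]; first exact: inv_ideal0.
  exact: inv_idealD.
by apply: (inv_idealT Ip Iq op oq) => //; apply: leq_trans kij.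
Qed.

(** A relation instead of a map: h determines its lifts only modulo [inv_ideal 1]. *)
Definition lifts (h : H) (a : HG) : Prop :=
  exists2 t, tri_in K t & h = tri W EX EY t /\ a = tri WG XG YG t.

Lemma liftsE h a : lifts h a <-> triangular K (fun g => (W g, WG g))
  (fun p => (EX p, XG p)) (fun q => (EY q, YG q)) (h, a).
Proof.
split=> [[t Kt [-> ->]]|[t Kt]]; first by exists t; rewrite // pair_tri.
by rewrite pair_tri => -[-> ->]; exists t.
Qed.

Let pops := pair_ops ops sub_ops.

Lemma lifts1 : lifts 1 1.
Proof. by apply/liftsE; exact: (triangular1 pops). Qed.
Lemma liftsD h a h' a' : lifts h a -> lifts h' a' -> lifts (h + h') (a + a').
Proof. by move=> /liftsE ta /liftsE ta'; apply/liftsE; exact: (triangularD ta ta'). Qed.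
Lemma liftsN h a : lifts h a -> lifts (- h) (- a).
Proof. by move=> /liftsE ta; apply/liftsE; exact: (triangularN pops ta). Qed.
Lemma liftsM h a h' a' : lifts h a -> lifts h' a' -> lifts (h * h') (a * a').
Proof. by move=> /liftsE ta /liftsE ta'; apply/liftsE; exact: (triangularM C0 pops ta ta'). Qed.
Lemma lifts_A h a : lifts h a -> A a.
Proof. by case=> t Kt [_ ->]; exists t. Qed.
Lemma A_lifts a : A a -> exists h, lifts h a.
Proof. by case=> t Kt ->; exists (tri W EX EY t), t. Qed.

Hypothesis lifts0_ideal : forall a, lifts 0 a -> inv_ideal 1 a.

(** For any lift z, the element z(1 - z) lies over e(1 - e) = 0, hence in the nilpotent ideal. The
    Newton step sends e to itself, so the iteration stays over e. *)
Lemma idempotent_lifts e : e * e = e -> exists2 a, lifts e a & a * a = a.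
Proof.
move=> ee; have [t Kt eE] := ro_tri ro e.
have lz : lifts e (tri WG XG YG t) by exists t.
pose N := ((n * #|G|).+1 + (n * #|G|).+1)%N.
apply: (idempotent_lift (P := lifts e) _ (k := N) lz).
  move=> y ly; have E : e * e * (e + (1 - e) *+ 3) = e.
    by rewrite ee mulrDr ee mulrnAr mulrBr mulr1 ee subrr mul0rn addr0.
  rewrite -{1}E; apply: liftsM; first exact: liftsM.
  apply: liftsD => //; have l1 : lifts (1 - e) (1 - y) by apply: liftsD; [exact: lifts1|exact: liftsN].
  by rewrite !mulrS !mulr0n !addr0; apply: liftsD => //; apply: liftsD.
apply: inv_ideal_vanish; set z := tri _ _ _ _ in lz *.
apply: (inv_idealW (ltnW (ltn_expl N (isT : 1 < 2)%N))); apply: inv_idealX.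
apply: lifts0_ideal; rewrite -[0](subrr (e * e)) {1}ee -[e in e - _]mulr1 -mulrBr.
by apply: liftsM => //; apply: liftsD; [exact: lifts1|exact: liftsN].
Qed.

(* u a v = u (u a v) v, so membership in inv_ideal k improves to k + 1. *)
Lemma lifts_orthogonal e f u v a : lifts e u -> lifts f v -> u * u = u -> v * v = v ->
  (forall h, e * h * f = 0) -> A a -> u * a * v = 0.
Proof.
move=> eu fv uu vv ehf Aa.
have N1 b : A b -> inv_ideal 1 (u * b * v).
  move=> /A_lifts[h hb]; apply: lifts0_ideal; rewrite -(ehf h).
  by do 2?apply: liftsM.
have step k x : inv_ideal k x -> inv_ideal k.+1 (u * x * v).
  have [Au Av] := (lifts_A eu, lifts_A fv).
  elim=> [|b d _ Nb _ Nd|i j p q b Ip Iq op oq kij Ab].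
  - by rewrite mulr0 mul0r; apply: inv_ideal0.
  - by rewrite mulrDr mulrDl; apply: inv_idealD.
  have -> : u * (XG p * YG q * b) * v = XG p * YG q * 1 * (u * b * v).
    rewrite mulr1 !mulrA -(inv_centralX Ip Au) -(mulrA _ u) -(inv_centralY Iq Au).
    by rewrite !mulrA.
  rewrite -addn1; apply: inv_idealM; last exact: N1.
  exact: (inv_idealT Ip Iq op oq kij (triangular1 sub_ops)).
have E : u * a * v = u * (u * a * v) * v by rewrite !mulrA uu -!mulrA vv.
suff Nk k : inv_ideal k.+1 (u * a * v) by exact: inv_ideal_vanish (Nk _).
by elim: k => [|k IH]; [exact: N1|rewrite E; apply: step].
Qed.

(** Centrality of e reads e h (1 - e) = 0 = (1 - e) h e; orthogonality lifts to a and 1 - a, which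
    gives ab = aba = ba. *)
Lemma lifts_central e a : (forall h, e * h = h * e) -> e * e = e -> lifts e a -> a * a = a ->
  forall b, A b -> a * b = b * a.
Proof.
move=> eC ee ea aa b Ab.
have l1 : lifts (1 - e) (1 - a) by apply: liftsD; [exact: lifts1|exact: liftsN].
have aa1 : (1 - a) * (1 - a) = 1 - a by rewrite mulrBl !mulrBr !mul1r !mulr1 aa subrr subr0.
have e0 h : e * h * (1 - e) = 0 by rewrite eC -mulrA mulrBr mulr1 ee subrr mulr0.
have e0' h : (1 - e) * h * e = 0 by rewrite -mulrA -eC mulrA mulrBl mul1r ee subrr mul0r.
have := lifts_orthogonal ea l1 aa aa1 e0 Ab; have := lifts_orthogonal l1 ea aa1 aa e0' Ab.
rewrite 2!mulrBl mul1r mulrBr mulr1 => /eqP; rewrite subr_eq0 => /eqP E /eqP.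
by rewrite subr_eq0 => /eqP ->; rewrite E.
Qed.

(** Orthogonality of e and 1 - e lifts to a(1 - b) = 0 and b(1 - a) = 0, so a = ab = ba = b. *)
Lemma lifts_unique e a b : (forall h, e * h = h * e) -> e * e = e ->
  lifts e a -> lifts e b -> a * a = a -> b * b = b -> a = b.
Proof.
move=> eC ee ea eb aa bb.
have half u v : lifts e u -> lifts e v -> u * u = u -> v * v = v -> u = u * v.
  move=> eu ev uu vv.
  have l1 : lifts (1 - e) (1 - v) by apply: liftsD; [exact: lifts1|exact: liftsN].
  have vv1 : (1 - v) * (1 - v) = 1 - v by rewrite mulrBl !mulrBr !mul1r !mulr1 vv subrr subr0.
  have e0 h : e * h * (1 - e) = 0 by rewrite eC -mulrA mulrBr mulr1 ee subrr mulr0.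
  have := lifts_orthogonal eu l1 uu vv1 e0 (triangular1 sub_ops).
  by rewrite mulr1 mulrBr mulr1 => /eqP; rewrite subr_eq0 => /eqP.
by rewrite (half a b) // (lifts_central eC ee ea aa (lifts_A eb)) -half.
Qed.

End Induction.

(** * Stable idempotents of Hbar(K) give central idempotents of Hbar(W) *)

Section InducedBlocks.
Variables (C : fieldType) (gT : finGroupType) (G K : {group gT}) (n : nat).
Variable rG : mx_representation C G n.
Hypotheses (C0 : [pchar C] =i pred0) (C'G : [pchar C]^'.-group G) (nKG : K <| G).
Let sKG : K \subset G := normal_sub nKG.
Let rK := subg_repr rG sKG.
Local Notation mp := (mpoly n C).
Variables (c : gT -> C) (H HG : pzRingType).
Variables (W : gT -> H) (EX EY : mp -> H) (WG : gT -> HG) (XG YG : mp -> HG).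
Hypothesis ro : restricted_ops rK c W EX EY.
Hypothesis roG : restricted_ops rG (extend_by_zero (reflections rK) c) WG XG YG.
Hypothesis lifts0_ideal : forall a, lifts K W EX EY WG XG YG 0 a ->
  inv_ideal rG nKG WG XG YG 1 a.
Hypothesis thetaP : forall w, w \in G -> exists theta : H -> H,
  [/\ {morph theta : a b / a + b}, {morph theta : a b / a * b},
      forall p, theta (EX p) = EX (sub (rG w) p),
      forall q, theta (EY q) = EY (sub (dual_repr rG w) q) &
      {in K, forall k, theta (W k) = W (k ^ w^-1)%g}].
Variables (sG : irrType C G) (sK : irrType C K).

Lemma block_set_conj w (S : {set sK}) : w \in G -> block_set ro S ->
  block_set ro [set irr_conj (coset K w) l | l in S].
Proof.
move=> Gw [e Se]; have [theta [thD thM thX thY thW]] := thetaP Gw.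
by exists (theta e); apply: (represents_theta Gw thD thM thX thY thW C'G Se).
Qed.

Lemma WG_conj_tri w t : w \in G -> tri_in K t ->
  WG w * tri WG XG YG t * WG w^-1%g = tri WG XG YG (map (conj_term rG w) t).
Proof.
have opsG := ro_ops roG; move=> Gw /allP Kt.
rewrite /tri mulr_sumr mulr_suml big_map !big_seq; apply: eq_bigr => u /Kt Ku.
have Gu := subsetP sKG _ Ku.
rewrite /conj_term /= !mulrA (co_WXp opsG) // -(mulrA _ (WG w)) -(co_WM opsG) //.
have -> : (w * u.1.2)%g = (u.1.2 ^ w^-1 * w)%g by rewrite conjgE invgK !mulgA mulgKV.
rewrite (co_WM opsG) ?groupJ ?groupV // -!mulrA; congr (_ * (_ * _)).
by rewrite mulrA (co_WYp opsG) // -mulrA -(co_WM opsG) ?groupV // mulgV (co_W1 opsG) mulr1.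
Qed.

Lemma block_set_induced (T : {set sK}) : block_set ro T ->
  (forall w l, w \in G -> l \in T -> irr_conj (coset K w) l \in T) ->
  block_set roG [set x : sG | [exists l in T, under_irr nKG l x]].
Proof.
move=> [e Te] Tst; have [[ee eC] eT] := Te; have opsG := ro_ops roG.
have [a ea aa] := idempotent_lifts C0 ro roG lifts0_ideal ee.
have aA := lifts_central C0 ro roG lifts0_ideal eC ee ea aa.
(* Stability of T gives [theta e = e], so the conjugate of a by w is another idempotent lift of e
   and equals a by uniqueness. *)
have aW w : w \in G -> a * WG w = WG w * a.
  move=> Gw; have [theta [thD thM thX thY thW]] := thetaP Gw.
  have := represents_theta Gw thD thM thX thY thW C'G Te.
  have -> : [set irr_conj (coset K w) l | l in T] = T.
    apply/setP => l; apply/imsetP/idP => [[m mT ->]|lT]; first exact: Tst.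
    have nKw := subsetP (normal_norm nKG) w Gw.
    exists (irr_conj (coset K w^-1%g) l); first by apply: Tst; rewrite ?groupV.
    by rewrite -(irr_conjM nKG C'G) ?groupV // -morphM ?groupV // mulgV morph1 (irr_conj1 nKG C'G).
  move=> /(represents_inj (pchar_normal nKG C'G) Te) E.
  have WV : WG w^-1%g * WG w = 1 by rewrite -(co_WM opsG) ?groupV // mulVg (co_W1 opsG).
  have eJ : lifts K W EX EY WG XG YG e (WG w * a * WG w^-1%g).
    have [t Kt [eE ->]] := ea; exists (map (conj_term rG w) t); first exact: tri_in_conj.
    by rewrite WG_conj_tri // -(theta_tri thD thM thX thY thW) // -eE.
  have aJ := lifts_unique C0 ro roG lifts0_ideal eC ee ea eJ aa.
  rewrite {1}aJ; first by rewrite -!mulrA WV mulr1.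
  by rewrite -!mulrA (mulrA (WG _) (WG w)) WV mul1r (mulrA a a) aa.
have subops := sub_ops roG.
have aC b : a * b = b * a.
  elim/(eps_ind roG): b => [|b d Eb Ed|p g q Gg]; first by rewrite mulr0 mul0r.
    by rewrite mulrDr mulrDl Eb Ed.
  rewrite !mulrA (aA _ (triangularX subops p)).
  by rewrite -(mulrA _ a) aW // !mulrA -(mulrA _ a) (aA _ (triangularY C0 subops q)) !mulrA.
exists a; split=> // x; have [l lx] := under_irr_total nKG sK C'G x.
(* The common expression of e and a has group parts in K, so a has the coefficients of e on K and
   none elsewhere. *)
have aE : eps_mx roG (irr_repr x) a = \sum_(k in K) eps ro e k^-1%g *: irr_repr x k.
  have [t /allP Kt [eE aEt]] := ea.
  have Kt' : tri_in K t by apply/allP.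
  have Gt : tri_in G t by apply/allP => u /Kt; apply: subsetP sKG _.
  rewrite /eps_mx (reindex_inj invg_inj) /= [LHS](bigID (mem K)) /=.
  rewrite [X in _ + X]big1 ?addr0 => [|g /andP[Gg nKg]].
    apply: eq_big => [g|g _]; first by rewrite groupV; case Kg: (g \in K); rewrite ?andbF // (subsetP sKG).
    by rewrite invgK aEt eE !eps_tri.
  rewrite aEt eps_tri // /tri_coef big_seq_cond big1 ?scale0r // => u /andP[/Kt Ku /eqP E].
  by rewrite E groupV (negPf nKg) in Ku.
have -> : (x \in [set x : sG | [exists l in T, under_irr nKG l x]]) = (l \in T).
  rewrite inE; apply/existsP/idP => [[m /andP[mT mx]]|lT]; last by exists l; rewrite lT.
  by have [w Gw ->] := under_irr_orbit C'G mx lx; apply: Tst.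
have lE b : eps_mx roG (irr_repr x) a = b%:M -> b%:M = (l \in T)%:R%:M :> 'M[C]_(irr_degree l).
  rewrite aE -eT => E.
  rewrite -(constituent_scalar (rE := subg_repr (irr_repr x) sKG) (asboolP _ lx) E).
  rewrite /eps_mx [RHS](reindex_inj invg_inj) /=.
  by apply: eq_big => [k|k _]; rewrite ?groupV // invgK.
have nz := irr_one_neq0 l; have z0 d : 0%:M = 0 :> 'M[C]_d by rewrite raddf0.
(* The scalar of a on x is 0 or 1, and its restriction to the constituent l tells which. *)
have [E|E] := central_idempotent_mx roG (socle_irr x) (conj aa aC); rewrite E.
  have := lE 0; rewrite z0 => /(_ E); case: (l \in T) => [/esym/eqP|_].
    by rewrite z0 (negPf nz).
  by rewrite z0.
have := lE 1 E; case: (l \in T) => // /eqP.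
by rewrite z0 (negPf nz).
Qed.

End InducedBlocks.

(** * The correspondence of families *)

Section RestrictedFamilies.
Variables (C : fieldType) (gT : finGroupType) (G K : {group gT}) (n : nat).
Variable rG : mx_representation C G n.
Hypotheses (C0 : [pchar C] =i pred0) (nKG : K <| G).
Let sKG : K \subset G := normal_sub nKG.
Let rK := subg_repr rG sKG.
Variable c : gT -> C.
Hypothesis cG : forall s w, s \in reflections rK -> w \in G -> c (s ^ w)%g = c s.
Local Notation c' := (extend_by_zero (reflections rK) c).

Lemma pchar0_group (A : {group gT}) : [pchar C]^'.-group A.
Proof. by apply/pgroupP => p _ _; change (p \notin [pchar C]); rewrite C0. Qed.

Lemma sub_conj_invariant s w : s \in reflections rK -> w \in K -> c (s ^ w)%g = c s.
Proof. by move=> Rs Kw; rewrite cG // (subsetP sKG). Qed.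

Lemma ext_conj_invariant s w : s \in reflections rG -> w \in G -> c' (s ^ w)%g = c' s.
Proof.
move=> _ Gw; rewrite /extend_by_zero reflectionsK_conj //.
by case: ifP => // Rs; rewrite cG.
Qed.

Local Notation roK := (hbar_restricted_ops C0 sub_conj_invariant).
Local Notation roG := (hbar_restricted_ops C0 ext_conj_invariant).

(** An expression that vanishes in Hbar(K) comes from the relations of K, which hold in Hbar(W), and
    from D(K)_+, which falls into [inv_ideal 1]. *)
Lemma restricted_lifts0 a :
  lifts K (hW rK c) (hX rK c) (hY rK c) (hW rG c') (hX rG c') (hY rG c') 0 a ->
  inv_ideal rG nKG (hW rG c') (hX rG c') (hY rG c') 1 a.
Proof.
have A1 := triangular1 (sub_ops roG).
case=> t Kt [/esym t0 ->]; move: t Kt t0; apply: (hbar_tri_ideal C0 (sub_ops roG)).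
- exact: inv_ideal0.
- move=> x y Nx Ny; apply: inv_idealD => //; rewrite -mulrN1.
  by apply: (inv_idealMr C0 roG Ny); apply: (triangularN (sub_ops roG)).
- move=> x z y Ax Ay Nz; apply: (inv_idealMr C0 roG) => //.
  exact: (inv_idealMl C0 roG).
exact: (inv_ideal_D roG).
Qed.

Lemma restricted_theta w : w \in G ->
  exists theta : restricted_cherednik rK c -> restricted_cherednik rK c,
  [/\ {morph theta : a b / a + b}, {morph theta : a b / a * b},
      forall p, theta (hX rK c p) = hX rK c (sub (rG w) p),
      forall q, theta (hY rK c q) = hY rK c (sub (dual_repr rG w) q) &
      {in K, forall k, theta (hW rK c k) = hW rK c (k ^ w^-1)%g}].
Proof.
move=> Gw; have ops := conj_ops cG roK Gw.
have [F [FD FM _ [FX FY FW]]] := hbar_lift C0 ops (fun s => conj_D roK Gw).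
exact: (ex_intro _ F (And5 FD FM FX FY FW)).
Qed.

Variables (sG : irrType C G) (sK : irrType C K).
Hypothesis faithG : mx_faithful rG.

Lemma cm_families_correspondence :
  let OG := cm_families rG c' sG in
  let OK := cm_families rK c sK in
  (forall sigma F, sigma \in (G / K)%g -> F \in OK -> family_conj sigma F \in OK) /\
  exists Phi : {set sG} -> {set {set sK}},
    [/\ {in OG &, injective Phi},
        Phi @: OG = [set family_orbit G F | F in OK]
      & forall F, F \in OG -> cover (Phi F) = res_constituents sK sKG F].
Proof.
have C'G := pchar0_group G; have C'K := pchar0_group K.
rewrite /= (cm_familiesE C0 ext_conj_invariant) // (cm_familiesE C0 sub_conj_invariant) //.
have cosP sigma : sigma \in (G / K)%g -> exists2 w, w \in G & sigma = coset K w.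
  by case/morphimP=> w _ Gw ->; exists w.
have nK w : w \in G -> w \in 'N(K) by apply: subsetP (normal_norm nKG) w.
have descent := restricted_descent C0 cG ext_conj_invariant roK.
pose R : sK -> sG -> bool := @under_irr _ _ _ _ nKG sG sK.
have R_act sigma l x : sigma \in (G / K)%g -> R l x -> R (irr_conj sigma l) x.
  by move=> /cosP[w Gw ->]; apply: under_irr_conj.
have R_orbit l l' x : R l x -> R l' x -> exists2 sigma, sigma \in (G / K)%g & l' = irr_conj sigma l.
  move=> lx l'x; have [w Gw ->] := under_irr_orbit C'G lx l'x.
  by exists (coset K w) => //; apply: mem_quotient.
have actM : {in (G / K)%g &, forall sigma tau (l : sK),
    irr_conj (sigma * tau)%g l = irr_conj sigma (irr_conj tau l)}.
  by move=> _ _ /cosP[w Gw ->] /cosP[v Gv ->] l; apply: (irr_conjM nKG); rewrite ?nK.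
have B_act sigma (S : {set sK}) : sigma \in (G / K)%g -> block_set roK S ->
    block_set roK [set irr_conj sigma l | l in S].
  by move=> /cosP[w Gw ->]; apply: (block_set_conj C'G restricted_theta).
have B_ind (T : {set sK}) : block_set roK T ->
    (forall sigma l, sigma \in (G / K)%g -> l \in T -> irr_conj sigma l \in T) ->
    block_set roG [set x | [exists l in T, R l x]].
  move=> BT Tst; apply: (block_set_induced C0 C'G roG restricted_lifts0 restricted_theta sG BT).
  by move=> w l Gw; apply: Tst; apply: mem_quotient.
have res1 (S : {set sG}) (BS : block_set roG S) := proj1 (block_set_res C0 C'G faithG descent sK BS).
have res2 (S : {set sG}) x l (BS : block_set roG S) :=
  proj2 (block_set_res C0 C'G faithG descent sK BS) x l.
have [E1 [Phi [inj im cov]]] := orbit_correspondence (block_setT roG sG)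
  (@block_setC _ _ _ _ _ _ _ _ _ _ roG sG) (@block_setI _ _ _ _ _ _ _ _ _ _ roG sG)
  (block_setT roK sK) (@block_setC _ _ _ _ _ _ _ _ _ _ roK sK)
  (@block_setI _ _ _ _ _ _ _ _ _ _ roK sK)
  (irr_conj1 nKG C'G (sK := sK)) actM B_act (under_irr_total nKG sK C'G)
  (under_irr_onto nKG sG C'G) R_act R_orbit res1 res2 B_ind.
by split; [exact: E1|exists Phi; split].
Qed.

End RestrictedFamilies.

Theorem theorem4p20 (R : realType) (gT : finGroupType) (W K : {group gT})
    (n : nat) (rW : mx_representation R[i] W n) (nKW : (K <| W)%g)
    (c : gT -> R[i]) (sW : irrType R[i] W) (sK : irrType R[i] K) :
  let rK := subg_repr rW (normal_sub nKW) in
  complex_reflection_group rW ->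
  mx_irreducible rW ->
  complex_reflection_group rK ->
  (forall s w, s \in reflections rK -> w \in W -> c (s ^ w)%g = c s) ->
  let OmegaW := cm_families rW (extend_by_zero (reflections rK) c) sW in
  let OmegaK := cm_families rK c sK in
  (* (a) *)
  [/\ forall sigma F, sigma \in (W / K)%g -> F \in OmegaK ->
        family_conj sigma F \in OmegaK,
      forall F, F \in OmegaK -> family_conj 1%g F = F
    & forall sigma tau F, sigma \in (W / K)%g -> tau \in (W / K)%g ->
        F \in OmegaK ->
        family_conj (sigma * tau)%g F = family_conj sigma (family_conj tau F)]
  (* (b) *)
  /\ exists Phi : {set sW} -> {set {set sK}},
       [/\ {in OmegaW &, injective Phi},
           Phi @: OmegaW = [set family_orbit W F | F in OmegaK]
         & forall F, F \in OmegaW ->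
             cover (Phi F) = res_constituents sK (normal_sub nKW) F].
Proof.
move=> rK [faithW _ _] _ _ cW /=; have C0 : [pchar R[i]] =i pred0 := @Num.Theory.pchar_num R[i].
have C'W := pchar0_group C0 W.
have [stable corr] := cm_families_correspondence C0 cW sW sK faithW.
split; last exact: corr; split=> [|F _|_ _ F /morphimP[v nKv Wv ->] /morphimP[w nKw Ww ->] _].
- exact: stable.
- rewrite /family_conj (eq_imset _ (irr_conj1 nKW C'W (sK := sK))).
  exact: imset_id.
apply: etrans (imset_comp (irr_conj (coset K v)) (irr_conj (coset K w)) F).
exact: eq_imset (fun l => irr_conjM nKW C'W (sK := sK) l nKv nKw).
Qed.
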